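(* Let $p,q\ge 1$ be integers, let $m>n\ge 0$ be integers, and let $\bm X_n=(P_n,Q_n)$ and $\bm X_m=(P_m,Q_m)$ be planar polynomial vector fields that are quasi-homogeneous with weight $(p,q)$ and of degree $n$ and $m$ respectively. Consider the planar system $$\frac{d}{dt}(x,y)=\bm X_n(x,y)+\bm X_m(x,y),$$ and let $a_n,b_n,b_m$ be the associated $2\pi$-periodic functions defined in the context. Suppose that $b_m(\theta)\neq 0$ for all $\theta$ and that $$\varPhi(\theta):=\frac{a_n(\theta)}{b_m(\theta)}-\frac{d}{d\theta}\left(\frac{b_n}{b_m}\right)(\theta)\neq 0\quad\text{for all }\theta\in[0,2\pi].$$ Then the system has at most $1$ limit cycle, counted with multiplicity. This upper bound is sharp (there exist systems satisfying the hypotheses which have exactly one limit cycle). Furthermore, if the limit cycle exists, then it surrounds the origin, and it is stable when $b_m\varPhi>0$ and unstable when $b_m\varPhi<0$.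
   Context: A vector field $\bm X=(P,Q):\mathbb R^2\to\mathbb R^2$ is quasi-homogeneous with weight $(p,q)$ ($p,q$ positive integers) and degree $s$ ($s$ a nonnegative integer) if $P(\lambda^p x,\lambda^q y)=\lambda^{p+s-1}P(x,y)$ and $Q(\lambda^p x,\lambda^q y)=\lambda^{q+s-1}Q(x,y)$ for all $\lambda\in\mathbb R$ and all $(x,y)$. For $i=n,m$ define $$a_i(\theta)=(m-n)\big(\cos\theta\, P_i(\cos\theta,\sin\theta)+\sin\theta\, Q_i(\cos\theta,\sin\theta)\big),$$ $$b_i(\theta)=p\cos\theta\, Q_i(\cos\theta,\sin\theta)-q\sin\theta\, P_i(\cos\theta,\sin\theta).$$ A limit cycle is an isolated (non-constant) periodic orbit; its multiplicity is its multiplicity as a fixed point of the Poincaré return map. A periodic orbit surrounds the origin if the origin lies in the bounded component of its complement. *)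

(* Defs.v *)
From HB Require Import structures.
From mathcomp Require Import all_boot all_order all_algebra.
From mathcomp Require Import all_classical all_reals all_analysis.

Set Implicit Arguments.
Unset Strict Implicit.
Unset Printing Implicit Defensive.

Import Order.TTheory GRing.Theory Num.Theory.
Import numFieldNormedType.Exports.

Local Open Scope classical_set_scope.
Local Open Scope ring_scope.

(* In {poly {poly R}} the outer indeterminate is x and the inner one is y. *)
Definition eval2 (R : realType) (F : {poly {poly R}}) (x y : R) : R :=
  F.[x%:P].[y].

Definition polyvf (R : realType) : zmodType :=
  ({poly {poly R}} * {poly {poly R}})%type.

Definition vfP (R : realType) (X : polyvf R) (x y : R) : R := eval2 X.1 x y.
Definition vfQ (R : realType) (X : polyvf R) (x y : R) : R := eval2 X.2 x y.

(* The truncated subtractions are exact as soon as 0 < p and 0 < q. *)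
Definition quasi_homogeneous (R : realType) (p q s : nat) (X : polyvf R) : Prop :=
  forall l x y : R,
    vfP X (l ^+ p * x) (l ^+ q * y) = l ^+ (p + s - 1) * vfP X x y /\
    vfQ X (l ^+ p * x) (l ^+ q * y) = l ^+ (q + s - 1) * vfQ X x y.

Definition a_fun (R : realType) (n m : nat) (X : polyvf R) (t : R) : R :=
  (m%:R - n%:R) *
  (cos t * vfP X (cos t) (sin t) + sin t * vfQ X (cos t) (sin t)).

Definition b_fun (R : realType) (p q : nat) (X : polyvf R) (t : R) : R :=
  p%:R * cos t * vfQ X (cos t) (sin t) - q%:R * sin t * vfP X (cos t) (sin t).

Definition Phi (R : realType) (p q n m : nat) (Xn Xm : polyvf R) (t : R) : R :=
  a_fun n m Xn t / b_fun p q Xm t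
  - derive1 (fun u => b_fun p q Xn u / b_fun p q Xm u) t.

Definition hypotheses (R : realType) (p q n m : nat) (Xn Xm : polyvf R) : Prop :=
  [/\ (0 < p)%N, (0 < q)%N & (n < m)%N] /\
  [/\ quasi_homogeneous p q n Xn,
      quasi_homogeneous p q m Xm,
      (forall t : R, b_fun p q Xm t <> 0) &
      (forall t : R, 0 <= t <= 2 * pi -> Phi p q n m Xn Xm t <> 0)].

Section Dynamics.
Variable R : realType.
Implicit Types (X : polyvf R) (G : set (R * R)) (f : R -> R * R).

Definition solution_on X (I : set R) f : Prop :=
  forall t, I t ->
    is_derive t 1 (fun u => (f u).1) (vfP X (f t).1 (f t).2) /\
    is_derive t 1 (fun u => (f u).2) (vfQ X (f t).1 (f t).2).

Definition periodic_orbit X G : Prop :=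
  exists f, [/\ solution_on X setT f,
                (exists2 T : R, 0 < T & forall t, f (t + T) = f t),
                (exists t, f t <> f 0) &
                G = range f].

Definition limit_cycle X G : Prop :=
  periodic_orbit X G /\
  exists U, [/\ open U, G `<=` U &
                forall G', periodic_orbit X G' -> G' `<=` U -> G' = G].

Definition section_point (z v : R * R) (s : R) : R * R :=
  (z.1 + s * v.1, z.2 + s * v.2).

Definition transversal X (z v : R * R) : Prop :=
  vfP X z.1 z.2 * v.2 - vfQ X z.1 z.2 * v.1 <> 0.

Definition least_period f (T : R) : Prop :=
  [/\ 0 < T, f T = f 0 & forall t, 0 < t < T -> f t <> f 0].

(* [h] is, near 0, the Poincare return map of the periodic orbit through [z]
   for the section s |-> z + s v: the trajectory [f s] starting at parameter s
   meets the section again at parameter [h s], at time [tau s].  Continuity of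
   [tau] at 0, where its value is the least period, selects the first return
   and, by transversality, determines the germ of [h] at 0. *)
Definition return_map X (z v : R * R) (h : R -> R) : Prop :=
  exists (T : R) (tau : R -> R) (f : R -> R -> R * R),
    [/\ least_period (f 0) T,
        tau 0 = T,
        tau x @[x --> (0 : R)] --> T &
        \forall s \near (0 : R),
          [/\ solution_on X [set t | 0 <= t <= tau s] (f s),
              f s 0 = section_point z v s &
              f s (tau s) = section_point z v (h s)]].

(* Order of vanishing at 0 of the displacement function [h - id].  [derive1n]
   is a total operator, hence the explicit derivability. *)
Definition fixpoint_multiplicity (h : R -> R) (k : nat) : Prop :=
  let d := fun s : R => h s - s in
  (forall j, (j < k)%N -> derivable (derive1n j d) 0 1 /\ derive1n j d 0 = 0) /\
  derive1n k d 0 <> 0.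

(* The value does not depend on the transversal section that is chosen. *)
Definition cycle_multiplicity X G (k : nat) : Prop :=
  exists z v h,
    [/\ G z, transversal X z v, return_map X z v h & fixpoint_multiplicity h k].

Definition at_most_limit_cycles_with_mult X (N : nat) : Prop :=
  forall (k : nat) (G : 'I_k -> set (R * R)),
    injective G -> (forall i, limit_cycle X (G i)) ->
    exists mu : 'I_k -> nat,
      (forall i, cycle_multiplicity X (G i) (mu i)) /\
      (\sum_i mu i <= N)%N.

Definition surrounds G (z : R * R) : Prop :=
  ~ G z /\ bounded_set (connected_component (~` G) z).

Definition forward_solution X (z : R * R) f : Prop :=
  solution_on X [set t | 0 <= t] f /\ f 0 = z.

(* Orbital asymptotic stability.  Periodic orbits being compact, entering every
   neighbourhood of [G] means that the distance to [G] tends to 0. *)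
Definition stable_cycle X G : Prop :=
  (forall V, open V -> G `<=` V ->
     exists U, [/\ open U, G `<=` U &
       forall z, U z -> exists2 f, forward_solution X z f &
         forall t, 0 <= t -> V (f t)]) /\
  (exists U, [/\ open U, G `<=` U &
     forall z, U z -> exists2 f, forward_solution X z f &
       forall V, open V -> G `<=` V -> \forall t \near +oo, V (f t)]).

(* A repelling cycle: asymptotically stable after reversing time. *)
Definition unstable_cycle X G : Prop := stable_cycle (- X) G.

End Dynamics.

(* Main.v *)
(** In the coordinates [x = r^p cos th], [y = r^q sin th], with [w = r^(n-m)],
    trajectories satisfy [th' = mu (1 + beta w)] and [w' = - mu w (alpha w + gamma)],
    where [alpha], [gamma], [beta] are [a_n], [a_m], [b_n] divided by [b_m], [mu] has the
    sign of [b_m], and [Phi = alpha - beta'].  Along trajectories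
    [d (ln w + beta w) = - (Phi w + gamma) dth], which is the divergence computation
    for the Dulac factor [1 / w].

    The symmetry [lambda = -1] forces [n] to be odd, so the origin is an equilibrium
    and periodic orbits avoid it.  Where [beta < 0] the quantity
    [ln (- beta w) + beta w + 1] is the kinetic part of an energy that is monotone along
    trajectories; hence a closed orbit has no turning point and is the graph
    [w = W(th)] of a [2 pi]-periodic function, which surrounds the origin.
    Two solutions [W1], [W2] of the resulting scalar equation satisfy
    [g' = - Phi (W2 - W1)] for [g = ln W2 - ln W1 + beta (W2 - W1)].  If both are
    periodic, then either [g^2] or [g] is monotone and periodic, so that [W1 = W2].
    If [W1] is the cycle and [W2] is close to it, the same identity shows that the return
    map has derivative [exp (- int Phi W / (1 + beta W)) <> 1], and that [g^2] is a
    Lyapunov function when [b_m Phi > 0].  Neighbouring solutions are obtained by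
    Picard iteration, and instability is stability of the reversed field. *)

(* The scalar equation in [w] is singular where [1 + beta w = 0], that is where the angle of a
   trajectory turns back, so the graph form of a closed orbit has to be earned before periodic
   solutions can be compared. The energy comes from splitting the radial term [A w + C] into its
   value at [w = - 1 / beta], a function of the angle alone that acts as a potential force, and a
   remainder with the factor [U = 1 + beta w]; together with [beta'] that remainder becomes a
   friction proportional to [Phi]. A closed orbit might wind several times. Its graph is first
   periodic only with the total angle increment; uniqueness applied to the graph and its translate
   by [2 pi] makes it [2 pi]-periodic. Near the cycle the equation is clamped to a band where it is
   uniformly Lipschitz, so that solutions exist for all angles. The derivative of the return map is
   not drawn from smooth dependence on initial data: the gap [g] obeys a linear equation up to a
   quadratic error, and a quadratic remainder at one point is all that a first derivative needs. *)
Require Import Defs.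
From HB Require Import structures.
From mathcomp Require Import all_boot all_order all_algebra.
From mathcomp Require Import all_classical all_reals all_analysis.
From mathcomp Require Import ring lra zify.

Set Implicit Arguments.
Unset Strict Implicit.
Unset Printing Implicit Defensive.

Import Order.TTheory GRing.Theory Num.Theory.
Import numFieldNormedType.Exports.

Local Open Scope classical_set_scope.
Local Open Scope ring_scope.

(** * Differential calculus on the real line *)

Section Calculus.
Variable R : realType.
Implicit Types (f g F G : R -> R) (a b x y l : R).

(** Derivatives are assembled as terms from the rules below; this adapts the value so produced to
    the one wanted, usually by [ring] or [field]. *)
Lemma derE l' f x l : is_derive x 1 f l' -> l' = l -> is_derive x 1 f l.
Proof. by move=> h <-. Qed.
Arguments derE l' {f x l}.

Lemma derC (c x : R) : is_derive x 1 (fun=> c) 0.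
Proof. exact: is_derive_cst. Qed.

Lemma derX x : is_derive x 1 (fun t : R => t) 1.
Proof. exact: is_derive_id. Qed.

Lemma derD f g x a b : is_derive x 1 f a -> is_derive x 1 g b ->
  is_derive x 1 (fun t => f t + g t) (a + b).
Proof. by move=> hf hg; exact: is_deriveD. Qed.

Lemma derN f x a : is_derive x 1 f a -> is_derive x 1 (fun t => - f t) (- a).
Proof. by move=> hf; exact: is_deriveN. Qed.

Lemma derB f g x a b : is_derive x 1 f a -> is_derive x 1 g b ->
  is_derive x 1 (fun t => f t - g t) (a - b).
Proof. by move=> hf hg; exact: is_deriveB. Qed.

Lemma derM f g x a b : is_derive x 1 f a -> is_derive x 1 g b ->
  is_derive x 1 (fun t => f t * g t) (a * g x + f x * b).
Proof.
move=> hf hg; apply: (derE _ (is_deriveM hf hg)).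
by rewrite /GRing.scale /=; ring.
Qed.

Lemma derXn f x a n : is_derive x 1 f a ->
  is_derive x 1 (fun t => f t ^+ n) (n%:R * f x ^+ n.-1 * a).
Proof.
move=> hf; elim: n => [|n ih].
  by apply: (derE 0); [exact: derC|rewrite !mul0r].
have -> : (fun t => f t ^+ n.+1) = (fun t => f t * f t ^+ n).
  by apply: funext => t; rewrite exprS.
apply: (derE _ (derM hf ih)).
by case: n {ih} => [|n] /=; rewrite ?exprS; ring.
Qed.

Lemma der_comp f g x a b : is_derive (g x) 1 f a -> is_derive x 1 g b ->
  is_derive x 1 (fun t => f (g t)) (a * b).
Proof.
move=> hf hg; exact: is_derive1_comp.
Qed.

Lemma derV f x a : f x != 0 -> is_derive x 1 f a ->
  is_derive x 1 (fun t => (f t)^-1) (- a / f x ^+ 2).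
Proof.
move=> fx hf; apply: (derE _ (is_deriveV fx hf)).
by rewrite /GRing.scale /=; ring.
Qed.

Lemma derdiv f g x a b : g x != 0 -> is_derive x 1 f a -> is_derive x 1 g b ->
  is_derive x 1 (fun t => f t / g t) ((a * g x - f x * b) / g x ^+ 2).
Proof.
move=> gx hf hg; apply: (derE _ (derM hf (derV gx hg))).
by field.
Qed.

Lemma derexp f x a : is_derive x 1 f a ->
  is_derive x 1 (fun t => expR (f t)) (expR (f x) * a).
Proof. by move=> hf; apply: der_comp. Qed.

Lemma derln f x a : 0 < f x -> is_derive x 1 f a ->
  is_derive x 1 (fun t => ln (f t)) (a / f x).
Proof.
move=> fx hf; apply: (derE ((f x)^-1 * a)); last by ring.
by apply: der_comp => //; exact: is_derive1_ln.
Qed.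

Lemma dercos f x a : is_derive x 1 f a ->
  is_derive x 1 (fun t => cos (f t)) (- sin (f x) * a).
Proof. by move=> hf; apply: der_comp. Qed.

Lemma dersin f x a : is_derive x 1 f a ->
  is_derive x 1 (fun t => sin (f t)) (cos (f x) * a).
Proof. by move=> hf; apply: der_comp. Qed.

Lemma der_val f x l : is_derive x 1 f l -> derivable f x 1 /\ derive1 f x = l.
Proof. by move=> h; split; [exact: ex_derive|rewrite derive1E; exact: derive_val]. Qed.

Lemma der_uniq f x l l' : is_derive x 1 f l -> is_derive x 1 f l' -> l = l'.
Proof. by move=> /der_val[_ <-] /der_val[_ <-]. Qed.

Lemma der_cont f x l : is_derive x 1 f l -> {for x, continuous f}.
Proof. by move=> h; apply/differentiable_continuous/derivable1_diffP; exact: ex_derive. Qed.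

Lemma der_near f g x l : {near x, f =1 g} -> is_derive x 1 f l -> is_derive x 1 g l.
Proof. by move=> fg; apply: near_eq_is_derive; rewrite ?oner_eq0. Qed.

Lemma mvt f (f' : R -> R) a b : a < b ->
  (forall x, a <= x <= b -> is_derive x 1 f (f' x)) ->
  exists2 c, a < c < b & f b - f a = f' c * (b - a).
Proof.
move=> ab hf.
have [c cab e] : exists2 c, c \in `]a, b[ & f b - f a = f' c * (b - a).
  apply: MVT => //.
    move=> x; rewrite in_itv /= => /andP[ax xb].
    by apply: hf; rewrite !ltW.
  apply: continuous_in_subspaceT => x; rewrite inE /= in_itv /= => /hf.
  exact: der_cont.
by exists c => //; move: cab; rewrite in_itv.
Qed.

Lemma der_ge0_le f (f' : R -> R) a b : a <= b ->
  (forall x, a <= x <= b -> is_derive x 1 f (f' x)) ->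
  (forall x, a < x < b -> 0 <= f' x) -> f a <= f b.
Proof.
rewrite le_eqVlt => /predU1P[->//|ab] hf f0.
have [c cab e] := mvt ab hf.
by rewrite -subr_ge0 e mulr_ge0 ?f0 // subr_ge0 ltW.
Qed.

Lemma der_gt0_lt f (f' : R -> R) a b : a < b ->
  (forall x, a <= x <= b -> is_derive x 1 f (f' x)) ->
  (forall x, a < x < b -> 0 < f' x) -> f a < f b.
Proof.
move=> ab hf f0.
have [c cab e] := mvt ab hf.
by rewrite -subr_gt0 e mulr_gt0 ?f0 // subr_gt0.
Qed.

Lemma der_0_cst f a b : (forall x, is_derive x 1 f 0) -> f a = f b.
Proof.
move=> hf; wlog ab : a b / a <= b.
  by move=> h; case: (leP a b) => [/h//|/ltW/h ->].
apply/eqP; rewrite eq_le; apply/andP; split.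
  exact: (@der_ge0_le _ (fun=> 0)).
rewrite -lerN2; apply: (@der_ge0_le (fun x => - f x) (fun=> 0)) => // x _.
by rewrite -oppr0; exact: derN.
Qed.

(** Both [G + f] and [G - f] are nondecreasing, so [G] plays the part of an integral of the bound on
    [f']. *)
Lemma der_le_increment f (f' : R -> R) G (G' : R -> R) a b : a <= b ->
  (forall x, a <= x <= b -> is_derive x 1 f (f' x)) ->
  (forall x, a <= x <= b -> is_derive x 1 G (G' x)) ->
  (forall x, a <= x <= b -> `|f' x| <= G' x) -> `|f b - f a| <= G b - G a.
Proof.
move=> ab hf hG h; rewrite ler_norml; apply/andP; split.
  rewrite -subr_ge0.
  have : G a + f a <= G b + f b; last by lra.
  apply: (@der_ge0_le (fun x => G x + f x) (fun x => G' x + f' x)) => // x /[dup] xab.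
    by move=> _; apply: derD; [exact: hG|exact: hf].
  move=> /andP[/ltW ax /ltW xb]; have := h x; rewrite ax xb => /(_ erefl).
  by rewrite ler_norml; lra.
have : G a - f a <= G b - f b; last by lra.
apply: (@der_ge0_le (fun x => G x - f x) (fun x => G' x - f' x)) => // x /[dup] xab.
  by move=> _; apply: derB; [exact: hG|exact: hf].
move=> /andP[/ltW ax /ltW xb]; have := h x; rewrite ax xb => /(_ erefl).
by rewrite ler_norml; lra.
Qed.

Lemma der_lipschitz f (f' : R -> R) (M : R) a b :
  (forall x, Num.min a b <= x <= Num.max a b -> is_derive x 1 f (f' x)) ->
  (forall x, Num.min a b <= x <= Num.max a b -> `|f' x| <= M) ->
  `|f b - f a| <= M * `|b - a|.
Proof.
wlog ab : a b / a <= b.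
  move=> H; case: (leP a b) => [ab|/ltW ba] h1 h2.
    by apply: H => //; rewrite (min_idPl ab) (max_idPr ab).
  rewrite distrC [`|b - a|]distrC; apply: H => //;
  by rewrite (min_idPl ba) (max_idPr ba).
rewrite (min_idPl ab) (max_idPr ab) => h1 h2.
have -> : M * `|b - a| = M * b - M * a by rewrite ger0_norm ?subr_ge0 // mulrBr.
apply: (@der_le_increment _ f' (fun x => M * x) (fun=> M)) => // x _.
by apply: (derE _ (derM (derC M x) (derX x))); ring.
Qed.

(** The integral from [a] is a primitive only to the right of [a]. Primitives based at the points
    [- (k + 1)] and normalized to vanish at 0 agree where both are defined, so they glue to one on
    the whole line. *)
Lemma antiderivative f : continuous f -> exists F, forall x, is_derive x 1 F (f x).
Proof.
move=> cf.
pose I a x := (\int[lebesgue_measure]_(t in `[a, x]) f t)%R.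
have dI a x : a < x -> is_derive x 1 (I a) (f x).
  move=> ax; have xu : x < x + 1 by lra.
  have [|dI vI] := @continuous_FTC1_closed R f a x _ xu _ ax (cf x).
    apply: continuous_compact_integrable; first exact: segment_compact.
    exact: continuous_subspaceT.
  by rewrite -vI derive1E; exact: derivableP.
pose N (k : nat) : R := - k.+1%:R.
pose J k x := I (N k) x - I (N k) 0.
have dJ k x : N k < x -> is_derive x 1 (J k) (f x).
  move=> h; apply: (derE (f x - 0)); last by rewrite subr0.
  exact: derB (dI _ _ h) (derC _ _).
have J0 k : J k 0 = 0 by rewrite /J subrr.
have JE k k' x : (k <= k')%N -> N k < x -> J k x = J k' x.
  move=> kk' kx.
  have kk : N k' <= N k by rewrite /N lerN2 ler_nat.
  have N0 : N k < 0 by rewrite /N oppr_lt0 ltr0n.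
  have aux a b : a <= b -> N k < a -> J k b - J k' b = J k a - J k' a.
    move=> ab ka; apply/eqP; rewrite -subr_eq0 -normr_le0.
    rewrite (_ : 0 = 0 - 0 :> R); last by ring.
    apply: (@der_le_increment (fun x => J k x - J k' x) (fun=> 0) (fun=> 0) (fun=> 0)) => //.
      move=> t /andP[at_ tb]; apply: (derE (f t - f t)); last by ring.
      apply: derB; apply: dJ; first exact: lt_le_trans at_.
      by apply: le_lt_trans kk _; exact: lt_le_trans at_.
    by move=> *; rewrite normr0.
  have : J k x - J k' x = J k 0 - J k' 0.
    by case: (leP 0 x) => [x0|/ltW x0]; [exact: aux|symmetry; exact: aux].
  by rewrite !J0; lra.
(* Chosen so that [- (n x + 1) < x]. The derivative at [x] is computed with the next base point,
   which serves a whole neighbourhood of [x]. *)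
pose n x := Num.truncn `|x|.
have nP x : N (n x) < x.
  rewrite /N /n ltrNl; apply: le_lt_trans (truncnS_gt _).
  by rewrite -normrN ler_norm.
exists (fun x => J (n x) x) => x.
have hx : N (n x).+1 < x - 1 by have := nP x; rewrite /N -[_.+2]addn1 natrD; lra.
apply: (@der_near (J (n x).+1)); last by apply: dJ; lra.
have : \forall y \near x, x - 1 < y < x + 1.
  have : 0 < (1 : R) by [].
  move=> /(nbhsx_ballx x); apply: filterS => y.
  by rewrite /ball /= ltr_distlC.
apply: filterS => y /andP[hy1 hy2].
case: (leqP (n y) (n x).+1) => hn.
  by rewrite (JE (n y) _ _ hn) // .
by apply: JE; [exact: ltnW|lra].
Qed.

End Calculus.
Arguments derE {R} l' {f x l}.

(** * Zeros, inverse functions and geometric limits *)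

Section RealFunctions.
Variable R : realType.
Implicit Types (f g F G : R -> R) (a b c x y t T l : R).

Lemma le_of_eq x y : x = y -> x <= y.
Proof. by move=> ->. Qed.

Lemma der_continuous f (f' : R -> R) : (forall x, is_derive x 1 f (f' x)) -> continuous f.
Proof. by move=> h x; exact: der_cont. Qed.

Lemma ivt f a b v : continuous f -> a <= b -> f a <= v <= f b \/ f b <= v <= f a ->
  exists2 c, a <= c <= b & f c = v.
Proof.
move=> cf ab h; have [|c cab e] := @IVT R f a b v ab (continuous_subspaceT cf).
  by rewrite ge_min le_max; case: h => /andP[-> ->] //; rewrite !orbT.
by exists c => //; move: cab; rewrite in_itv.
Qed.

Lemma cont_near_lt0 f x : continuous f -> f x < 0 ->
  exists2 e, 0 < e & forall y, `|y - x| < e -> f y < 0.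
Proof.
move=> cf fx; have fx0 : 0 < - f x by rewrite oppr_gt0.
have /cvgrPdist_lt /(_ _ fx0) := cf x.
move=> /nbhs_ballP[e /= e0 he]; exists e => // y hy.
have := he y; rewrite /ball /= distrC => /(_ hy).
by rewrite ltr_norml opprK => /andP[h1 _]; lra.
Qed.

(** The zero is the supremum of the points of [[a, b]] where [f] is nonnegative. *)
Lemma last_nonneg f a b : continuous f -> a <= b -> 0 <= f a -> f b < 0 ->
  exists c, [/\ a <= c < b, f c = 0 & forall t, c < t <= b -> f t < 0].
Proof.
move=> cf ab fa fb.
pose S := [set t | a <= t <= b /\ 0 <= f t].
have Sa : S a by split=> //; rewrite lexx.
have hS : has_sup S by split; [exists a|exists b => t [/andP[]]].
pose c := sup S.
have ac : a <= c by apply: sup_upper_bound.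
have cb : c <= b by apply: ge_sup => [|t [/andP[]]//]; exists a.
have after t : c < t -> t <= b -> f t < 0.
  move=> ct tb; rewrite ltNge; apply/negP => ft.
  suff : t <= c by rewrite leNgt ct.
  by apply: sup_upper_bound => //; split=> //; rewrite tb (le_trans ac) // ltW.
have fc : 0 <= f c.
  rewrite leNgt; apply/negP => fc.
  have [e e0 he] := cont_near_lt0 cf fc.
  have [t [/andP[at_ tb] ft] ct] := sup_adherent e0 hS.
  have tc : t <= c by apply: sup_upper_bound => //; split=> //; rewrite at_.
  suff : f t < 0 by rewrite ltNge ft.
  by apply: he; rewrite ltr_norml; move: ct tc; rewrite -/c; lra.
have [|d /andP[cd db] fd] := @ivt f c b 0 cf cb; first by right; rewrite fc ltW.
have dc : d <= c.
  by apply: sup_upper_bound => //; split; [rewrite db (le_trans ac)|rewrite fd].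
have {}dc : d = c by apply/eqP; rewrite eq_le dc cd.
exists c; split; [|by rewrite -dc|by move=> t /andP[]; exact: after].
by rewrite ac /= lt_neqAle cb andbT; apply: contraTneq fb => <-; rewrite -dc fd ltxx.
Qed.

Lemma last_nonpos f a b : continuous f -> a <= b -> f a <= 0 -> 0 < f b ->
  exists c, [/\ a <= c < b, f c = 0 & forall t, c < t <= b -> 0 < f t].
Proof.
move=> cf ab fa fb.
have [||||c [h1 h2 h3]] := @last_nonneg (fun t => - f t) a b => //.
- by move=> x; apply: cvgN; exact: cf.
- by rewrite oppr_ge0.
- by rewrite oppr_lt0.
exists c; split=> //; first by apply: oppr_inj; rewrite h2 oppr0.
by move=> t /h3; rewrite oppr_lt0.
Qed.

Lemma der_gt0_inverse f (f' : R -> R) : (forall x, is_derive x 1 f (f' x)) ->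
  (forall x, 0 < f' x) -> (forall y, exists x, f x = y) ->
  exists g, [/\ cancel g f, cancel f g &
    forall y, is_derive y 1 g (f' (g y))^-1].
Proof.
move=> hf f0 /choice[g fg].
have gf : cancel f g.
  move=> x; have := fg (f x).
  by apply: inc_inj; apply: le_mono => u v uv; exact: (@der_gt0_lt _ f f').
exists g; split=> // y.
rewrite -{1}(fg y); apply: (@is_derive_inverse _ f g _ (g y)).
- by near=> z; exact: gf.
- by near=> z; exact: (der_cont (hf z)).
- by rewrite gt_eqF.
Unshelve. all: by end_near. Qed.

Lemma der_neq0_inverse f (f' : R -> R) : (forall x, is_derive x 1 f (f' x)) ->
  (forall x, 0 < f' x) \/ (forall x, f' x < 0) -> (forall y, exists x, f x = y) ->
  exists g, [/\ cancel g f, cancel f g &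
    forall y, is_derive y 1 g (f' (g y))^-1].
Proof.
move=> hf [f0|f0] sf; first exact: der_gt0_inverse.
have [||g [gf fg dg]] := @der_gt0_inverse (fun x => - f x) (fun x => - f' x) (fun x => derN (hf x)).
- by move=> x; rewrite oppr_gt0.
- by move=> y; have [x fx] := sf (- y); exists x; rewrite fx opprK.
exists (fun y => g (- y)); split.
- by move=> y; apply: oppr_inj; exact: gf.
- exact: fg.
move=> y; apply: (derE _ (der_comp (dg (- y)) (derN (derX y)))).
by rewrite invrN; ring.
Qed.

Lemma geom_small (A x : R) : (forall k : nat, `|x| <= A * 2^-1 ^+ k) -> x = 0.
Proof.
move=> h; apply/normr0_eq0/eqP; rewrite eq_le normr_ge0 andbT.
have A0 : 0 <= A by have := h 0; rewrite expr0 mulr1; exact: le_trans.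
apply/ler_addgt0Pr => e e0; rewrite add0r.
have /cvgrPdist_le /(_ (e / (A + 1))) : geometric (1 : R) 2^-1 @ \oo --> 0.
  by apply: cvg_geometric; rewrite ger0_norm; lra.
have /[swap] /[apply] : 0 < e / (A + 1) by rewrite divr_gt0 //; lra.
case=> N _ /(_ N (leqnn N)) /=; rewrite mul1r sub0r normrN ger0_norm ?exprn_ge0 // => hN.
apply: le_trans (h N) _; apply: le_trans (ler_wpM2l A0 hN) _.
by rewrite mulrCA ger_pMr // ler_pdivrMr; lra.
Qed.

(** The intervals of radius [2 A / 2^k] around [u k] are nested, and the supremum of their left ends
    lies in all of them. *)
Lemma squeeze_limit (u : nat -> R) (A : R) :
  (forall k, `|u k.+1 - u k| <= A * 2^-1 ^+ k) ->
  exists l, forall k, `|l - u k| <= 2 * A * 2^-1 ^+ k.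
Proof.
move=> h; pose e k := 2 * A * 2^-1 ^+ k.
have eS k : e k = 2 * e k.+1 by rewrite /e exprS; field.
have hk k : `|u k.+1 - u k| <= e k.+1.
  by apply: le_trans (h k) _; rewrite /e exprS; apply: le_of_eq; field.
have e0 k : 0 <= e k by rewrite eS mulr_ge0 //; apply: le_trans (hk k).
have mono i n : u i - e i <= u (i + n)%N - e (i + n)%N /\ u (i + n)%N + e (i + n)%N <= u i + e i.
  elim: n => [|n [ih1 ih2]]; first by rewrite addn0.
  rewrite addnS; have := hk (i + n)%N; have := eS (i + n)%N; rewrite ler_norml => ? /andP[].
  by split; lra.
have cross i j : u i - e i <= u j + e j.
  have := e0 (maxn i j).
  have /subnKC <- := leq_maxl i j; have [m1 _] := mono i (maxn i j - i)%N.
  rewrite subnKC ?leq_maxl // in m1 *.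
  have /subnKC E := leq_maxr i j; have [_ m2] := mono j (maxn i j - j)%N.
  by rewrite E in m2; lra.
pose S := range (fun k => u k - e k).
have hS : has_sup S.
  by split; [exists (u 0 - e 0), 0|exists (u 0 + e 0) => _ [k _ <-]].
exists (sup S) => k; rewrite ler_norml; apply/andP; split.
  have : u k - e k <= sup S by apply: sup_upper_bound => //; exists k.
  by rewrite -/(e k); lra.
have : sup S <= u k + e k by apply: ge_sup => [|_ [i _ <-]//]; case: hS.
by rewrite -/(e k); lra.
Qed.

(** * Picard iteration on the whole line *)

Section Picard.
Variables (K t0 : R).
Hypothesis K0 : 0 < K.
(** Weight of a Bielecki norm, twice a hyperbolic cosine. Its primitive [S] is bounded by [C / K] on
    both sides of [t0]. *)
Let C t := expR (K * (t - t0)) + expR (- K * (t - t0)).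
Let S t := (expR (K * (t - t0)) - expR (- K * (t - t0))) / K.

Let dlin (k : R) t : is_derive t 1 (fun t => k * (t - t0)) k.
Proof. by apply: (derE _ (derM (derC k t) (derB (derX t) (derC t0 t)))); ring. Qed.

Let dS t : is_derive t 1 S (C t).
Proof.
apply: (derE _ (derM (derB (derexp (dlin K t)) (derexp (dlin (- K) t))) (derC K^-1 t))).
by rewrite /C; field; rewrite gt_eqF.
Qed.

Let dC t : is_derive t 1 C (K * (expR (K * (t - t0)) - expR (- K * (t - t0)))).
Proof.
by apply: (derE _ (derD (derexp (dlin K t)) (derexp (dlin (- K) t)))); ring.
Qed.

Let C_ge1 t : 1 <= C t.
Proof.
have := expR_gt0 (K * (t - t0)); have := expR_gt0 (- K * (t - t0)).
have := expR_ge1Dx (K * (t - t0)); have := expR_ge1Dx (- K * (t - t0)).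
by rewrite /C; case: (leP 0 (K * (t - t0))) => h; rewrite !mulNr in h *; lra.
Qed.

(** Integration from [t0] divides a bound proportional to the weight by [K]; this is the contraction
    estimate of the Picard operator. *)
Lemma cosh_bound f (f' : R -> R) (A t : R) : f t0 = 0 ->
  (forall x, is_derive x 1 f (f' x)) -> (forall x, `|f' x| <= A * C x) ->
  `|f t| <= A / K * C t.
Proof.
move=> f0 hf h.
have A0 : 0 <= A.
  by rewrite -(pmulr_lge0 _ (lt_le_trans ltr01 (C_ge1 t0))); apply: le_trans (h t0).
have S0 : S t0 = 0 by rewrite /S subrr !mulr0 expR0; ring.
have dAS x : is_derive x 1 (fun x => A * S x) (A * C x).
  by apply: (derE _ (derM (derC A x) (dS x))); ring.
have e1 := expR_gt0 (K * (t - t0)); have e2 := expR_gt0 (- K * (t - t0)).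
have SC : `|S t| <= C t / K.
  rewrite /S /C normrM [`|K^-1|]gtr0_norm ?invr_gt0 //.
  rewrite ler_pM2r ?invr_gt0 // ler_norml; lra.
have -> : A / K * C t = A * (C t / K) by ring.
apply: le_trans (ler_wpM2l A0 SC).
rewrite -{1}(ger0_norm A0) -normrM.
case: (leP t0 t) => [tt|/ltW tt].
  have := der_le_increment tt (fun x _ => hf x) (fun x _ => dAS x) (fun x _ => h x).
  by rewrite f0 S0 mulr0 !subr0 => /le_trans; apply; exact: ler_norm.
have := der_le_increment tt (fun x _ => hf x) (fun x _ => dAS x) (fun x _ => h x).
by rewrite f0 S0 mulr0 !sub0r normrN => /le_trans; apply; rewrite -normrN; exact: ler_norm.
Qed.

Lemma unif_cont_limit (u : nat -> R -> R) (y : R -> R) (A : R) :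
  (forall k, continuous (u k)) ->
  (forall k t, `|y t - u k t| <= A * C t * 2^-1 ^+ k) -> continuous y.
Proof.
move=> cu h t; apply/cvgrPdist_lt => e e0.
have A0 : 0 <= A.
  have := h 0 t; rewrite expr0 mulr1 -(pmulr_lge0 A (lt_le_trans ltr01 (C_ge1 t))).
  exact: le_trans.
(* Bounds [A * C s] for all [s] near [t], where [C s <= C t + 1]; the final 1 makes it positive. *)
pose D := A * (C t + 1) + 1.
have D0 : 0 < D by rewrite ltr_wpDl // mulr_ge0 // addr_ge0 // (le_trans _ (C_ge1 t)).
have [k hk] : exists k : nat, D * 2^-1 ^+ k < e / 3.
  apply: contrapT => /forallNP H.
  suff : (e / 3) = 0 by lra.
  apply: (@geom_small D) => k; rewrite gtr0_norm; last by lra.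
  by rewrite leNgt; apply/negP/H.
have e3 : 0 < e / 3 by lra.
have /cvgrPdist_lt /(_ _ e3) hu := cu k t.
have /cvgrPdist_lt /(_ _ ltr01) hC := der_cont (dC t).
near=> s.
have b1 : `|u k t - u k s| < e / 3 by near: s.
have b2 : `|C t - C s| < 1 by near: s.
have pk : 0 <= (2^-1 : R) ^+ k by rewrite exprn_ge0.
have b (r : R) : C r <= C t + 1 -> `|y r - u k r| < e / 3.
  move=> Cr; apply: le_lt_trans (h k r) _; apply: le_lt_trans hk.
  rewrite ler_wpM2r // /D; apply: ler_wpDr => //.
  exact: ler_wpM2l.
have bt : `|y t - u k t| < e / 3 by apply: b; lra.
have bs : `|y s - u k s| < e / 3 by apply: b; move: b2; rewrite ltr_norml; lra.
by move: bt bs b1; rewrite !ltr_norml; lra.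
Unshelve. all: by end_near. Qed.

End Picard.

(** With the rate [K = 2 L] every iteration halves the weighted distance, so a global Lipschitz
    bound gives a solution on the whole line at once. Continuity of [F] is asked along continuous
    curves, the form in which the clamped field supplies it. *)
Lemma picard (F : R -> R -> R) (B L t0 y0 : R) : 0 < L ->
  (forall y : R -> R, continuous y -> continuous (fun t => F t (y t))) ->
  (forall t y, `|F t y| <= B) ->
  (forall t y1 y2, `|F t y1 - F t y2| <= L * `|y1 - y2|) ->
  exists y : R -> R, y t0 = y0 /\ forall t, is_derive t 1 y (F t (y t)).
Proof.
move=> L0 cF bF lF.
have [step stepP] : exists step : (R -> R) -> R -> R, forall y : R -> R, continuous y ->
    step y t0 = y0 /\ forall t, is_derive t 1 (step y) (F t (y t)).
  have /choice[s hs] : forall y : R -> R, exists Y : R -> R, continuous y ->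
      Y t0 = y0 /\ forall t, is_derive t 1 Y (F t (y t)).
    move=> y; have [cy|ny] := pselect (continuous y); last by exists y.
    have [Y dY] := antiderivative (cF _ cy).
    exists (fun t => Y t + (y0 - Y t0)) => _; split; first by ring.
    by move=> t; apply: (derE _ (derD (dY t) (derC _ t))); ring.
  by exists s.
pose u k := iter k step (fun=> y0).
have cu k : continuous (u k).
  elim: k => [|k ih]; first exact: cst_continuous.
  by have [_ /der_continuous] := stepP _ ih.
have u0 k : u k t0 = y0 by case: k => [//|k]; have [] := stepP _ (cu k).
have du k t : is_derive t 1 (u k.+1) (F t (u k t)) by have [_] := stepP _ (cu k).
have K0 : 0 < 2 * L by rewrite mulr_gt0.
pose C t := expR (2 * L * (t - t0)) + expR (- (2 * L) * (t - t0)).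
have C_ge1 t : 1 <= C t.
  have := expR_gt0 (2 * L * (t - t0)); have := expR_gt0 (- (2 * L) * (t - t0)).
  have := expR_ge1Dx (2 * L * (t - t0)); have := expR_ge1Dx (- (2 * L) * (t - t0)).
  by rewrite /C mulNr; case: (leP 0 (2 * L * (t - t0))) => h; lra.
have B0 : 0 <= B by apply: le_trans (bF 0 0).
pose M := B / (2 * L).
have M0 : 0 <= M by rewrite divr_ge0 // ltW.
have hu k t : `|u k.+1 t - u k t| <= M * C t * 2^-1 ^+ k.
  elim: k t => [|k ih] t.
    rewrite expr0 mulr1.
    apply: (@cosh_bound _ _ K0 (fun t => u 1 t - u 0 t) (fun t => F t (u 0 t))).
    - by rewrite !u0 subrr.
    - by move=> x; apply: (derE _ (derB (du 0 x) (derC y0 x))); rewrite subr0.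
    - by move=> x; apply: le_trans (bF _ _) _; rewrite -{1}[B]mulr1; apply: ler_wpM2l => //; exact: C_ge1.
  have -> : M * C t * 2^-1 ^+ k.+1 = (L * (M * 2^-1 ^+ k)) / (2 * L) * C t.
    by rewrite exprS; field; rewrite gt_eqF.
  apply: (@cosh_bound _ _ K0 (fun t => u k.+2 t - u k.+1 t)
            (fun t => F t (u k.+1 t) - F t (u k t))).
  - by rewrite !u0 subrr.
  - move=> x; apply: le_trans (lF _ _ _) _.
    rewrite -[L * _ * _]mulrA ler_pM2l //; apply: le_trans (ih x) _.
    by apply: le_of_eq; rewrite /C; ring.
have /choice[y hy] : forall t, exists l, forall k, `|l - u k t| <= 2 * (M * C t) * 2^-1 ^+ k.
  by move=> t; apply: squeeze_limit => k; exact: hu.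
have cy : continuous y.
  apply: (@unif_cont_limit (2 * L) t0 u y (2 * M) cu) => k t.
  by have := hy t k; rewrite mulrA.
have [Y0 dY] := stepP _ cy.
(* [step y] and [y] are both limits of the iterates, at a common geometric rate. *)
suff Yy : step y = y by exists y; rewrite Yy in Y0 dY.
apply: funext => t; apply/eqP; rewrite -subr_eq0; apply/eqP.
apply: (@geom_small (2 * (M * C t))) => k.
have h1 : `|step y t - u k.+1 t| <= M * C t * 2^-1 ^+ k.
  have -> : M * C t * 2^-1 ^+ k = (L * (2 * M * 2^-1 ^+ k)) / (2 * L) * C t.
    by field; rewrite gt_eqF.
  apply: (@cosh_bound _ _ K0 (fun t => step y t - u k.+1 t)
            (fun t => F t (y t) - F t (u k t))).
  - by rewrite u0 Y0 subrr.
  - move=> x; apply: le_trans (lF _ _ _) _.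
    rewrite -[L * _ * _]mulrA ler_pM2l //; apply: le_trans (hy x k) _.
    by apply: le_of_eq; rewrite /C; ring.
have h2 := hy t k.+1.
rewrite exprS in h2.
have -> : step y t - y t = (step y t - u k.+1 t) - (y t - u k.+1 t) by ring.
apply: le_trans (ler_normB _ _) _; apply: le_trans (lerD h1 h2) _.
by apply: le_of_eq; field.
Qed.

End RealFunctions.

(** * Angular motion of closed orbits *)

Section AngularMotion.
Variable R : realType.
Implicit Types (f g : R -> R) (a b c x y t T l : R).

Lemma der_gt0_local f x l : is_derive x 1 f l -> 0 < l ->
  exists2 e, 0 < e & forall t, `|t - x| < e -> (x < t -> f x < f t) /\ (t < x -> f t < f x).
Proof.
move=> /is_derive1_caratheodory[g [gE cg gx]] l0.
rewrite -gx in l0; have /cvgrPdist_lt /(_ _ l0) := cg.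
move=> /nbhs_ballP[e /= e0 he]; exists e => // t ht.
have : 0 < g t.
  have := he t; rewrite /ball /= distrC => /(_ ht).
  by rewrite ltr_norml => /andP[_]; lra.
have := gE t => E gt; split=> h.
  by rewrite -subr_gt0 E mulr_gt0 // subr_gt0.
by rewrite -subr_lt0 E pmulr_rlt0 // subr_lt0.
Qed.

(** After leaving the level [y] upwards, a first return to it would come from above, against the
    positive derivative there. *)
Lemma one_way_crossing f (f' : R -> R) y a b : (forall t, is_derive t 1 f (f' t)) ->
  (forall t, f t = y -> 0 < f' t) -> f a = y -> a < b -> y < f b.
Proof.
move=> df pos fa ab; rewrite ltNge; apply/negP => fb.
have [e e0 he] := der_gt0_local (df a) (pos _ fa).
pose a' := Num.min (a + e / 2) b.
have aa' : a < a' by rewrite lt_min ab andbT; lra.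
have a'b : a' <= b by rewrite ge_min lexx orbT.
have a'e : a' <= a + e / 2 by rewrite ge_min lexx.
have fa' : y < f a'.
  by rewrite -fa; apply: (he a' _).1 => //; rewrite ltr_norml; lra.
have cf := der_continuous df.
(* Reversing time turns the last zero into the first return to [y] after [a']. *)
have [||||c [/andP[c1 c2] fc hc]] := @last_nonpos R (fun t => f (- t) - y) (- b) (- a').
- move=> t; apply: cvgB; last exact: cvg_cst.
  by apply: continuous_comp; [exact: continuousN|exact: cf].
- by lra.
- by rewrite opprK subr_le0.
- by rewrite opprK subr_gt0.
have {}fc : f (- c) = y by apply/eqP; rewrite -subr_eq0 fc.
have [e' e'0 he'] := der_gt0_local (df (- c)) (pos _ fc).
pose d := Num.min (c + e' / 2) (- a').
have cd : c < d by rewrite lt_min c2 andbT; lra.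
have da' : d <= - a' by rewrite ge_min lexx orbT.
have de : d <= c + e' / 2 by rewrite ge_min lexx.
have := hc d; rewrite cd da' => /(_ erefl); rewrite subr_gt0 => h1.
have [|_ h2] := he' (- d); first by rewrite ltr_norml; lra.
have : f (- d) < f (- c) by apply: h2; lra.
by rewrite fc; lra.
Qed.

Lemma der_reverse f (f' : R -> R) : (forall t, is_derive t 1 f (f' t)) ->
  forall t, is_derive t 1 (fun t => f (- t)) (- f' (- t)).
Proof. by move=> df t; apply: (derE _ (der_comp (df (- t)) (derN (derX t)))); ring. Qed.

Lemma one_way_crossing_before f (f' : R -> R) y a b : (forall t, is_derive t 1 f (f' t)) ->
  (forall t, f t = y -> 0 < f' t) -> f b = y -> a < b -> f a < y.
Proof.
move=> df pos fb ab; rewrite -ltrN2.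
have := @one_way_crossing (fun t => - f (- t)) (fun t => f' (- t)) (- y) (- b) (- a).
rewrite !opprK; apply.
- by move=> t; apply: (derE _ (derN (der_reverse df t))); rewrite opprK.
- by move=> t /oppr_inj/pos.
- by rewrite fb.
- by rewrite ltrN2.
Qed.

(** * Energy of the angular motion *)

Section Energy.
Variables (A C beta beta' : R -> R).
Hypotheses (cA : continuous A) (cC : continuous C).
Hypothesis dbeta : forall x, is_derive x 1 beta (beta' x).

Section Trajectory.
Variables (mu th w : R -> R).
Hypothesis mu0 : forall t, 0 < mu t.
Hypothesis w0 : forall t, 0 < w t.
Let U t := 1 + beta (th t) * w t.
Hypothesis dth : forall t, is_derive t 1 th (mu t * U t).
Hypothesis dw : forall t,
  is_derive t 1 w (- mu t * w t * (A (th t) * w t + C (th t))).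

Let cbeta : continuous beta.
Proof. exact: der_continuous dbeta. Qed.

(** At an angle with [beta >= 0] the angular velocity is positive for every [w > 0], so such an
    angle is crossed once and for all. A trajectory that comes back to its angle meets none of them
    in between. *)
Lemma return_beta_lt0 a b t : a < b -> th a = th b -> a <= t <= b -> beta (th t) < 0.
Proof.
move=> ab thab /andP[at_ tb]; rewrite ltNge; apply/negP => h.
have pos s : th s = th t -> 0 < mu s * U s.
  by move=> e; rewrite mulr_gt0 // /U e ltr_wpDr // mulr_ge0 // ltW.
have after s : t < s -> th t < th s := one_way_crossing dth pos erefl.
have before s : s < t -> th s < th t := one_way_crossing_before dth pos erefl.
move: at_; rewrite le_eqVlt => /predU1P[e|at_].
  by have := after b; rewrite -e thab ltxx => H; have := H ab.
move: tb; rewrite le_eqVlt => /predU1P[e|tb].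
  by have := before a; rewrite e thab ltxx => H; have := H ab.
by have := after b tb; have := before a at_; rewrite thab; lra.
Qed.

Hypothesis Phi0 : forall x, 0 < A x - beta' x.

(* [E] is a mechanical energy for the angular motion: its kinetic part
   [ln x - x + 1], with [x = - beta w], is nonpositive and vanishes exactly when
   [U = 0]; friction makes [E] monotone, so the angle of a turning point is
   never reached again. *)
Lemma turning_point_no_return a b : a < b -> th a = th b -> U a = 0 ->
  forall t, a < t < b -> U t = 0.
Proof.
move=> ab thab Ua.
have bneg t : a <= t <= b -> beta (th t) < 0 by exact: return_beta_lt0.
have cbt : continuous (fun t => beta (th t)).
  by move=> x; apply: continuous_comp; [exact: der_continuous dth x|exact: cbeta].
have [m mab hm] := EVT_max (ltW ab) (continuous_subspaceT cbt).
pose e := beta (th m).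
have e0 : e < 0 by apply: bneg; move: mab; rewrite in_itv.
have he t : a <= t <= b -> beta (th t) <= e by move=> tab; apply: hm; rewrite in_itv.
(* Continuous on the whole line, and equal to [1 / beta] along the trajectory. *)
pose cut x := beta x * (beta x * beta x + e * e + `|beta x * beta x - e * e|)^-1 * 2.
have cutE t : a <= t <= b -> cut (th t) = (beta (th t))^-1.
  move=> tab; rewrite /cut ger0_norm; last by have := he _ tab; nra.
  have b0 : beta (th t) != 0 by rewrite lt_eqF // bneg.
  rewrite (_ : _ + _ = 2 * (beta (th t) * beta (th t))); last by ring.
  by field.
have ccut : continuous cut.
  move=> x; rewrite /cut; apply: cvgM; last exact: cvg_cst.
  have cbb : {for x, continuous (fun x => beta x * beta x)} by apply: cvgM; exact: cbeta.
  apply: cvgM; first exact: cbeta.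
  apply: cvgV.
    have : 0 < e * e by nra.
    have := normr_ge0 (beta x * beta x - e * e).
    have := sqr_ge0 (beta x); rewrite expr2 => h1 h2 h3.
    by rewrite gt_eqF //; lra.
  apply: cvgD; first by apply: cvgD; [exact: cbb|exact: cvg_cst].
  by apply: cvg_norm; apply: cvgB; [exact: cbb|exact: cvg_cst].
(* The potential: along the trajectory its slope is the value of [- (A w + C)] on the turning curve
   [w = - 1 / beta]. With this choice the derivative of [E] carries the factor [U ^+ 2]. *)
have [K dK] : exists K, forall x, is_derive x 1 K (A x * cut x - C x).
  apply: antiderivative => x; apply: cvgB; last exact: cC.
  by apply: cvgM; [exact: cA|exact: ccut].
pose H t := ln (- (beta (th t) * w t)) + beta (th t) * w t + 1.
pose E t := H t - K (th t).
have pos t : a <= t <= b -> 0 < - (beta (th t) * w t).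
  by move=> tab; rewrite oppr_gt0 nmulr_rlt0 // bneg.
have dE t : a <= t <= b ->
    is_derive t 1 E (mu t * U t ^+ 2 * (A (th t) - beta' (th t)) / - beta (th t)).
  move=> tab.
  have dbw := derM (der_comp (dbeta (th t)) (dth t)) (dw t).
  have dl := @derln R (fun t => - (beta (th t) * w t)) t _ (pos _ tab) (derN dbw).
  apply: (derE _ (derB (derD (derD dl dbw) (derC 1 t))
                      (der_comp (dK (th t)) (dth t)))).
  rewrite cutE // /U; field.
  by rewrite lt_eqF ?bneg // gt_eqF.
have H0 t : a <= t <= b -> H t <= 0.
  move=> /pos h; have := @le_ln1Dx R (- (beta (th t) * w t) - 1).
  rewrite /H (_ : 1 + (- (beta (th t) * w t) - 1) = - (beta (th t) * w t)); last by ring.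
  have h2 : -1 < - (beta (th t) * w t) - 1 by lra.
  by move=> /(_ h2); lra.
(* At the turning point [H] attains its maximum 0, and the potential is the same at both ends, so
   [E] has not increased. Being monotone it is constant, and a vanishing derivative means
   [U = 0]. *)
have Ea : E b <= E a.
  have Ha : H a = 0.
    have e1 : beta (th a) * w a = -1 by move: Ua; rewrite /U; lra.
    by rewrite /H e1 opprK ln1; ring.
  rewrite /E Ha thab; have := H0 b; rewrite lexx (ltW ab) => /(_ erefl); lra.
have dE0 t : a <= t <= b -> 0 <= mu t * U t ^+ 2 * (A (th t) - beta' (th t)) / - beta (th t).
  move=> tab; apply: divr_ge0; last by rewrite oppr_ge0 ltW // bneg.
  apply: mulr_ge0; last exact: ltW.
  by apply: mulr_ge0; [exact: ltW|exact: sqr_ge0].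
have Emono s t : a <= s -> s <= t -> t <= b -> E s <= E t.
  move=> as_ st tb; apply: (der_ge0_le st) => x /andP[sx xt].
    by apply: dE; rewrite (le_trans as_ sx) (le_trans xt tb).
  by apply: dE0; rewrite (le_trans as_ (ltW sx)) (le_trans (ltW xt) tb).
move=> t /andP[at_ tb]; apply/eqP; apply: contraT => Ut.
have tab : a <= t <= b by rewrite !ltW.
have dpos : 0 < mu t * U t ^+ 2 * (A (th t) - beta' (th t)) / - beta (th t).
  apply: divr_gt0; last by rewrite oppr_gt0 bneg.
  apply: mulr_gt0 => //; apply: mulr_gt0 => //.
  by rewrite lt_neqAle sqr_ge0 eq_sym sqrf_eq0 Ut.
have [d d0 hd] := der_gt0_local (dE _ tab) dpos.
pose s := Num.min (t + d / 2) b.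
have ts : t < s by rewrite lt_min tb andbT; lra.
have sb : s <= b by rewrite ge_min lexx orbT.
have sd : s <= t + d / 2 by rewrite ge_min lexx.
have [|h _] := hd s; first by rewrite ltr_norml; lra.
have := h ts; have := Emono s b (le_trans (ltW at_) (ltW ts)) sb (lexx _).
by have := Emono a t (lexx _) (ltW at_) (ltW tb); lra.
Qed.

End Trajectory.
End Energy.
End AngularMotion.

Section ClosedTrajectories.
Variable R : realType.
Implicit Types (f g : R -> R) (a b c x y t T l : R).

Lemma shift_iter f T c t (n : nat) : (forall t, f (t + T) = f t + c) ->
  f (t + n%:R * T) = f t + n%:R * c.
Proof.
move=> h; elim: n => [|n ih]; first by rewrite !mul0r !addr0.
have -> : t + n.+1%:R * T = (t + n%:R * T) + T by rewrite -natr1; ring.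
by rewrite h ih -natr1; ring.
Qed.

Lemma archimedean_mul T y : 0 < T -> exists n : nat, y < n%:R * T.
Proof.
move=> T0; exists (Num.truncn `|y / T|).+1.
rewrite -ltr_pdivrMr //; apply: le_lt_trans (truncnS_gt _).
exact: ler_norm.
Qed.

Lemma der_at_min f x l : is_derive x 1 f l -> (forall t, f x <= f t) -> l = 0.
Proof.
move=> df hm; apply/eqP; apply: contraT; rewrite neq_lt => /orP[l0|l0].
  have l0' : 0 < - l by rewrite oppr_gt0.
  have [e e0 he] := der_gt0_local (derN df) l0'.
  have [|h _] := he (x + e / 2); first by rewrite ltr_norml; lra.
  have : x < x + e / 2 by lra.
  by move=> /h; rewrite ltrN2 ltNge hm.
have [e e0 he] := der_gt0_local df l0.
have [|_ h] := he (x - e / 2); first by rewrite ltr_norml; lra.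
have : x - e / 2 < x by lra.
by move=> /h; rewrite ltNge hm.
Qed.

Section NoTurning.
Variables (T : R).
Hypothesis T0 : 0 < T.

Definition polar_motion (A C beta mu th w : R -> R) :=
  (forall t, is_derive t 1 th (mu t * (1 + beta (th t) * w t))) /\
  (forall t, is_derive t 1 w (- mu t * w t * (A (th t) * w t + C (th t)))).

(** If [U] takes both signs, some turning point is followed by an arc that the net rotation [c] has
    to undo; the angle then comes back to that of the turning point, which the energy forbids. If
    [U] keeps a weak sign and vanishes somewhere, it does so at an extremum, which forces an
    equilibrium. *)
Let no_turning_pos (A C beta beta' mu th w : R -> R) c :
  continuous A -> continuous C -> (forall x, is_derive x 1 beta (beta' x)) ->
  (forall x, 0 < A x - beta' x) ->
  (forall t, 0 < mu t) -> (forall t, 0 < w t) -> polar_motion A C beta mu th w ->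
  (forall t, th (t + T) = th t + c) ->
  (forall t, 1 + beta (th (t + T)) * w (t + T) = 1 + beta (th t) * w t) ->
  [\/ forall t, 0 < 1 + beta (th t) * w t, forall t, 1 + beta (th t) * w t < 0 |
    exists2 t, 1 + beta (th t) * w t = 0 & A (th t) * w t + C (th t) = 0].
Proof.
move=> cA cC db Phi0 mu0 w0 [dth dw] thT UT.
pose U t := 1 + beta (th t) * w t.
have dU t : is_derive t 1 U (beta' (th t) * (mu t * U t) * w t -
     beta (th t) * (mu t * w t * (A (th t) * w t + C (th t)))).
  apply: (derE _ (derD (derC 1 t) (derM (der_comp (db (th t)) (dth t)) (dw t)))).
  by rewrite /U; ring.
have cU := der_continuous dU; have cth := der_continuous dth.
have UnT t (n : nat) : U (t + n%:R * T) = U t.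
  by rewrite (@shift_iter U T 0) ?mulr0 ?addr0 // => s; rewrite addr0 /U UT.
have zero t : U t = 0 -> (forall s, U t <= U s) \/ (forall s, U s <= U t) ->
    exists2 t, U t = 0 & A (th t) * w t + C (th t) = 0.
  move=> Ut ext; exists t => //.
  (* At a zero of [U] one has [beta w = -1], and the derivative of [U] reduces to [mu (A w + C)]. *)
  have dUt : is_derive t 1 U (mu t * (A (th t) * w t + C (th t))).
    apply: (derE _ (dU t)); rewrite Ut.
    have -> : mu t * (A (th t) * w t + C (th t)) =
       (U t - beta (th t) * w t) * (mu t * (A (th t) * w t + C (th t))).
      by rewrite /U; ring.
    by rewrite Ut; ring.
  have : mu t * (A (th t) * w t + C (th t)) = 0.
    case: ext => ext; first exact: der_at_min ext.
    apply: oppr_inj; rewrite oppr0; apply: (der_at_min (derN dUt)) => s.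
    by rewrite lerN2.
  by move/eqP; rewrite mulf_eq0 gt_eqF //= => /eqP.
have [[ta Ua]|noneg] := pselect (exists t, U t < 0); last first.
  have U0 t : 0 <= U t by rewrite leNgt; apply/negP => h; apply: noneg; exists t.
  have [[t Ut]|nz] := pselect (exists t, U t = 0).
    by apply: Or33; apply: (zero t) => //; left => s; rewrite Ut.
  by apply: Or31 => t; rewrite lt_neqAle U0 andbT eq_sym; apply/eqP => h; apply: nz; exists t.
have [[tb Ub]|nopos] := pselect (exists t, 0 < U t); last first.
  have U0 t : U t <= 0 by rewrite leNgt; apply/negP => h; apply: nopos; exists t.
  have [[t Ut]|nz] := pselect (exists t, U t = 0).
    by apply: Or33; apply: (zero t) => //; right => s; rewrite Ut.
  by apply: Or32 => t; rewrite lt_neqAle U0 andbT; apply/eqP => h; apply: nz; exists t.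
(* For [c >= 0] a decreasing arc has to be undone, for [c < 0] an increasing one. Periodicity
   provides a turning point before the arc and, after enough periods, a return to its angle. *)
exfalso; have [c0|c0] := leP 0 c.
  have [n hn] := archimedean_mul (tb - ta) T0.
  have [|||t1 [/andP[_ t1a] U1 hU]] := @last_nonneg R U (tb - n%:R * T) ta cU.
  - by lra.
  - by rewrite -(UnT _ n) subrK ltW.
  - exact: Ua.
  have tha : th ta < th t1.
    rewrite -ltrN2; apply: (der_gt0_lt t1a (fun x _ => derN (dth x))) => x /andP[x1 x2].
    by rewrite oppr_gt0 pmulr_rlt0 // hU // x1 ltW.
  have [k hk] := archimedean_mul (ta - t1) T0.
  have [||t2 /andP[t2a _] e2] := @ivt R th ta (t1 + k%:R * T) (th t1) cth.
  - by lra.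
  - left; rewrite ltW // (shift_iter _ _ thT) lerDl.
    by rewrite mulr_ge0 // ler0n.
  have at2 : ta < t2.
    by rewrite lt_neqAle t2a andbT; apply: contraTneq tha => ->; rewrite e2 ltxx.
  have := @turning_point_no_return R A C beta beta' cA cC db mu th w mu0 w0 dth dw Phi0
    t1 t2 (lt_trans t1a at2) (esym e2) U1 ta.
  by rewrite t1a at2 => /(_ erefl); move: Ua; rewrite /U => /[swap] ->; rewrite ltxx.
have [n hn] := archimedean_mul (ta - tb) T0.
have [|||t1 [/andP[_ t1b] U1 hU]] := @last_nonpos R U (ta - n%:R * T) tb cU.
- by lra.
- by rewrite -(UnT _ n) subrK ltW.
- exact: Ub.
have thb : th t1 < th tb.
  apply: (der_gt0_lt t1b (fun x _ => dth x)) => x /andP[x1 x2].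
  by rewrite mulr_gt0 // hU // x1 ltW.
have [k hk] := archimedean_mul (tb - t1) T0.
have [||t2 /andP[t2b _] e2] := @ivt R th tb (t1 + k%:R * T) (th t1) cth.
- by lra.
- right; rewrite (ltW thb) andbT (shift_iter _ _ thT) gerDl.
  by rewrite mulr_ge0_le0 // ?ler0n // ltW.
have bt2 : tb < t2.
  by rewrite lt_neqAle t2b andbT; apply: contraTneq thb => ->; rewrite e2 ltxx.
have := @turning_point_no_return R A C beta beta' cA cC db mu th w mu0 w0 dth dw Phi0
  t1 t2 (lt_trans t1b bt2) (esym e2) U1 tb.
by rewrite t1b bt2 => /(_ erefl); move: Ub; rewrite /U => /[swap] ->; rewrite ltxx.
Qed.

(** Reversing time changes the signs of [mu] and [c] and keeps [A], [C], [beta] and [Phi]. *)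
Let no_turning_Phi_pos (A C beta beta' mu th w : R -> R) c :
  continuous A -> continuous C -> (forall x, is_derive x 1 beta (beta' x)) ->
  (forall x, 0 < A x - beta' x) ->
  (forall t, 0 < mu t) \/ (forall t, mu t < 0) ->
  (forall t, 0 < w t) -> polar_motion A C beta mu th w ->
  (forall t, th (t + T) = th t + c) ->
  (forall t, 1 + beta (th (t + T)) * w (t + T) = 1 + beta (th t) * w t) ->
  [\/ forall t, 0 < 1 + beta (th t) * w t, forall t, 1 + beta (th t) * w t < 0 |
    exists2 t, 1 + beta (th t) * w t = 0 & A (th t) * w t + C (th t) = 0].
Proof.
move=> cA cC db Phi0 [mu0|mu0] w0 mot thT UT; first exact: no_turning_pos thT UT.
have [dth dw] := mot.
have [|||||h|h|[t h1 h2]] := @no_turning_pos A C beta beta' (fun t => - mu (- t))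
  (fun t => th (- t)) (fun t => w (- t)) (- c) cA cC db Phi0.
- by move=> t; rewrite oppr_gt0.
- by [].
- split=> t; first by apply: (derE _ (der_reverse dth t)); ring.
  by apply: (derE _ (der_reverse dw t)); ring.
- move=> t; have := thT (- t - T); rewrite subrK => ->.
  by rewrite opprD; ring.
- by move=> t; have := UT (- t - T); rewrite subrK opprD.
- by apply: Or31 => t; have := h (- t); rewrite opprK.
- by apply: Or32 => t; have := h (- t); rewrite opprK.
- by apply: Or33; exists (- t).
Qed.

(** Reflecting the angle replaces [A], [C] by [- A (- x)], [- C (- x)] and [beta] by [beta (- x)],
    which changes the sign of [Phi]. *)
Lemma no_turning (A C beta beta' mu th w : R -> R) c :
  continuous A -> continuous C -> (forall x, is_derive x 1 beta (beta' x)) ->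
  (forall x, 0 < A x - beta' x) \/ (forall x, A x - beta' x < 0) ->
  (forall t, 0 < mu t) \/ (forall t, mu t < 0) ->
  (forall t, 0 < w t) -> polar_motion A C beta mu th w ->
  (forall t, th (t + T) = th t + c) ->
  (forall t, 1 + beta (th (t + T)) * w (t + T) = 1 + beta (th t) * w t) ->
  [\/ forall t, 0 < 1 + beta (th t) * w t, forall t, 1 + beta (th t) * w t < 0 |
    exists2 t, 1 + beta (th t) * w t = 0 & A (th t) * w t + C (th t) = 0].
Proof.
move=> cA cC db [Phi0|Phi0] mu0 w0 mot thT UT; first exact: (no_turning_Phi_pos cA cC db Phi0 mu0 w0 mot thT UT).
have [dth dw] := mot.
have [|||||||||h|h|[t h1 h2]] := @no_turning_Phi_pos (fun x => - A (- x)) (fun x => - C (- x))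
  (fun x => beta (- x)) (fun x => - beta' (- x)) (fun t => - mu t)
  (fun t => - th t) w (- c).
- by move=> x; apply: cvgN; apply: continuous_comp; [exact: continuousN|exact: cA].
- by move=> x; apply: cvgN; apply: continuous_comp; [exact: continuousN|exact: cC].
- exact: der_reverse.
- by move=> x; rewrite -opprD oppr_gt0.
- by case: mu0 => mu0; [right|left] => t; rewrite ?oppr_lt0 ?oppr_gt0.
- exact: w0.
- split=> t; first by apply: (derE _ (derN (dth t))); rewrite opprK; ring.
  by apply: (derE _ (dw t)); rewrite !opprK; ring.
- by move=> t; rewrite thT opprD.
- by move=> t; rewrite !opprK.
- by apply: Or31 => t; have := h t; rewrite opprK.
- by apply: Or32 => t; have := h t; rewrite opprK.
- by apply: Or33; exists t; [rewrite -h1 opprK|apply: oppr_inj; rewrite oppr0 -h2 !opprK; ring].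
Qed.

End NoTurning.

End ClosedTrajectories.

(** * The scalar equation *)

Section ScalarEquation.
Variable R : realType.
Implicit Types (f g : R -> R) (a b c x y t T l : R).

Lemma const_sign_neq0 (X : Type) (f : X -> R) :
  (forall u, 0 < f u) \/ (forall u, f u < 0) -> forall u, f u != 0.
Proof. by case=> h x; [rewrite gt_eqF|rewrite lt_eqF]. Qed.

(* The equation of [polar_motion] with the angle as time; the last clause says
   that the angular velocity does not vanish. *)
Definition scalar_solution (A C beta w : R -> R) :=
  [/\ forall x, 0 < w x,
      forall x, is_derive x 1 w (- w x * (A x * w x + C x) / (1 + beta x * w x)) &
      (forall x, 0 < 1 + beta x * w x) \/ (forall x, 1 + beta x * w x < 0)].

(** A positive derivative at one point would make [f] gain over a period. *)
Lemma der_ge0_periodic f (f' : R -> R) T : 0 < T -> (forall x, is_derive x 1 f (f' x)) ->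
  (forall x, 0 <= f' x) -> (forall x, f (x + T) = f x) -> forall x, f' x = 0.
Proof.
move=> T0 df f0 fT x; apply/eqP; apply: contraT => fx.
have {}fx : 0 < f' x by rewrite lt_neqAle eq_sym fx f0.
have [e e0 he] := der_gt0_local (df x) fx.
pose y := Num.min (x + e / 2) (x + T).
have xy : x < y by rewrite lt_min !ltrDl T0 andbT; lra.
have yT : y <= x + T by rewrite ge_min lexx orbT.
have ye : y <= x + e / 2 by rewrite ge_min lexx.
have [|h _] := he y; first by rewrite ltr_norml; lra.
have := h xy; rewrite -(fT x) ltNge.
by rewrite (der_ge0_le yT (fun x _ => df x)).
Qed.

Lemma der_le0_periodic f (f' : R -> R) T : 0 < T -> (forall x, is_derive x 1 f (f' x)) ->
  (forall x, f' x <= 0) -> (forall x, f (x + T) = f x) -> forall x, f' x = 0.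
Proof.
move=> T0 df f0 fT x; apply: oppr_inj; rewrite oppr0.
apply: (@der_ge0_periodic (fun x => - f x) (fun x => - f' x) _ T0 (fun z => derN (df z))).
- by move=> z; rewrite oppr_ge0.
- by move=> z; rewrite fT.
Qed.

Lemma ln_affine_mvt b (u v : R) : 0 < u -> 0 < v ->
  exists2 z, Num.min u v <= z <= Num.max u v &
    ln v - ln u + b * (v - u) = (1 + b * z) / z * (v - u).
Proof.
wlog uv : u v / u < v.
  move=> H u0 v0; case: (ltgtP u v) => [uv|vu|->].
  - by have := H u v uv u0 v0; rewrite (min_idPl (ltW uv)) (max_idPr (ltW uv)).
  - have := H v u vu v0 u0; rewrite (min_idPl (ltW vu)) (max_idPr (ltW vu)).
    move=> [z hz e]; exists z => //.
    by apply: oppr_inj; rewrite -mulrN opprB -e; ring.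
  - by exists v; rewrite ?ge_min ?le_max ?lexx // !subrr !mulr0 addr0.
move=> u0 v0.
rewrite (min_idPl (ltW uv)) (max_idPr (ltW uv)).
have [|z /andP[uz zv] e] := @mvt R (fun z => ln z + b * z) (fun z => (1 + b * z) / z) u v uv.
  move=> x /andP[ux xv]; have x0 : 0 < x := lt_le_trans u0 ux.
  apply: (derE _ (derD (@derln R id x _ x0 (derX x)) (derM (derC b x) (derX x)))).
  by field; rewrite gt_eqF.
exists z; first by rewrite !ltW.
by rewrite -e; ring.
Qed.

(** By the mean value form the sign is that of [1 + b z] for some [z] between [u] and [v], and an
    affine function with one sign at both ends keeps it in between. *)
Lemma ln_affine_sign b (u v : R) : 0 < u -> 0 < v -> u != v ->
  (0 < 1 + b * u -> 0 < 1 + b * v -> 0 < (ln v - ln u + b * (v - u)) * (v - u)) /\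
  (1 + b * u < 0 -> 1 + b * v < 0 -> (ln v - ln u + b * (v - u)) * (v - u) < 0).
Proof.
move=> u0 v0 uv; have [z /andP[z1 z2] ->] := ln_affine_mvt b u0 v0.
have z0 : 0 < z by apply: lt_le_trans z1; rewrite lt_min u0.
have sq : 0 < z^-1 * (v - u) ^+ 2.
  by rewrite mulr_gt0 ?invr_gt0 // lt_neqAle sqr_ge0 eq_sym sqrf_eq0 subr_eq0 eq_sym uv.
have -> : (1 + b * z) / z * (v - u) * (v - u) = (1 + b * z) * (z^-1 * (v - u) ^+ 2) by ring.
have zuv : u <= z <= v \/ v <= z <= u.
  by move: z1 z2; case: (leP u v) => _ h1 h2; [left|right]; rewrite h1.
split=> h1 h2.
  by rewrite pmulr_lgt0 //; case: zuv => /andP[]; case: (leP 0 b) => h; nra.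
by rewrite pmulr_llt0 //; case: zuv => /andP[]; case: (leP 0 b) => h; nra.
Qed.

Section Comparison.
Variables (A C beta beta' : R -> R).
Hypothesis dbeta : forall x, is_derive x 1 beta (beta' x).

(* [ln w + beta w] is the line integral of the Dulac-rescaled field
   [(beta + 1/w) dw + (A w + C) dx], so the difference over two solutions
   evolves by [- (A - beta')] times the gap between them. *)
Lemma der_ln_affine_gap (w1 w2 : R -> R) x : 0 < w1 x -> 0 < w2 x ->
  1 + beta x * w1 x != 0 -> 1 + beta x * w2 x != 0 ->
  is_derive x 1 w1 (- w1 x * (A x * w1 x + C x) / (1 + beta x * w1 x)) ->
  is_derive x 1 w2 (- w2 x * (A x * w2 x + C x) / (1 + beta x * w2 x)) ->
  is_derive x 1 (fun x => ln (w2 x) - ln (w1 x) + beta x * (w2 x - w1 x))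
    (- (A x - beta' x) * (w2 x - w1 x)).
Proof.
move=> w10 w20 u1 u2 d1 d2.
apply: (derE _ (derD (derB (derln w20 d2) (derln w10 d1))
                     (derM (dbeta x) (derB d2 d1)))).
have n1 : w1 x != 0 by rewrite gt_eqF.
have n2 : w2 x != 0 by rewrite gt_eqF.
by field; rewrite u1 u2 n1 n2.
Qed.

Hypothesis Phi0 : (forall x, 0 < A x - beta' x) \/ (forall x, A x - beta' x < 0).

(** The period [T] is left free because a closed orbit is first known to close after an angle that
    may be several full turns. *)
Lemma scalar_solution_unique (w1 w2 : R -> R) T : 0 < T ->
  (forall x, beta (x + T) = beta x) ->
  (forall x, w1 (x + T) = w1 x) -> (forall x, w2 (x + T) = w2 x) ->
  scalar_solution A C beta w1 -> scalar_solution A C beta w2 -> w1 = w2.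
Proof.
move=> T0 bT w1T w2T [w10 dw1 s1] [w20 dw2 s2].
have n1 := const_sign_neq0 s1.
have n2 := const_sign_neq0 s2.
pose g x := ln (w2 x) - ln (w1 x) + beta x * (w2 x - w1 x).
have dg x : is_derive x 1 g (- (A x - beta' x) * (w2 x - w1 x)).
  exact: der_ln_affine_gap.
have gT x : g (x + T) = g x by rewrite /g w1T w2T bT.
(* Same sign of [1 + beta w1] and [1 + beta w2]: then [g * (w2 - w1)] has a fixed sign, and the
   square of [g] is monotone and periodic, hence constant. *)
have same : (forall x, w1 x != w2 x -> 0 < g x * (w2 x - w1 x)) \/
    (forall x, w1 x != w2 x -> g x * (w2 x - w1 x) < 0) -> w1 = w2.
  move=> sg; apply: funext => x; apply/eqP; apply: contraT => nx; exfalso.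
  have dgg y : is_derive y 1 (fun y => g y * g y)
      (- 2 * (A y - beta' y) * (g y * (w2 y - w1 y))).
    by apply: (derE _ (derM (dg y) (dg y))); ring.
  have ggT y : g (y + T) * g (y + T) = g y * g y by rewrite gT.
  have sg' : (forall x, 0 <= g x * (w2 x - w1 x)) \/ (forall x, g x * (w2 x - w1 x) <= 0).
    case: sg => sg; [left|right] => y;
    by have [->|ny] := eqVneq (w1 y) (w2 y); rewrite ?subrr ?mulr0 // ltW // sg.
  have Z : - 2 * (A x - beta' x) * (g x * (w2 x - w1 x)) = 0.
    have nPhi : (forall x, - 2 * (A x - beta' x) <= 0) \/ (forall x, 0 <= - 2 * (A x - beta' x)).
      by case: Phi0 => h; [left|right] => y; have := h y; lra.
    case: nPhi sg' => hP [] hs.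
    - by apply: (der_le0_periodic T0 dgg) => // y; rewrite mulr_le0_ge0.
    - by apply: (der_ge0_periodic T0 dgg) => // y; rewrite mulr_le0.
    - by apply: (der_ge0_periodic T0 dgg) => // y; rewrite mulr_ge0.
    - by apply: (der_le0_periodic T0 dgg) => // y; rewrite mulr_ge0_le0.
  have P0 := const_sign_neq0 Phi0 x.
  have G0 : g x * (w2 x - w1 x) != 0.
    by case: sg => h; [rewrite gt_eqF ?h|rewrite lt_eqF ?h].
  by move/eqP: Z; rewrite !mulf_eq0 (negbTE P0) orbF -mulf_eq0 (negbTE G0) orbF oppr_eq0 pnatr_eq0.
(* Opposite signs: then [beta < 0] and the solutions lie on the two sides of [- 1 / beta], so
   [w2 - w1] keeps its sign and [g] itself is monotone. *)
have diff : (forall x, 0 < w2 x - w1 x) \/ (forall x, w2 x - w1 x < 0) -> False.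
  move=> hs; have Z : - (A 0 - beta' 0) * (w2 0 - w1 0) = 0.
    case: Phi0 hs => hP [] hs.
    - by apply: (der_le0_periodic T0 dg) => // y; have := hP y; have := hs y; nra.
    - by apply: (der_ge0_periodic T0 dg) => // y; have := hP y; have := hs y; nra.
    - by apply: (der_ge0_periodic T0 dg) => // y; have := hP y; have := hs y; nra.
    - by apply: (der_le0_periodic T0 dg) => // y; have := hP y; have := hs y; nra.
  move/eqP: Z; rewrite mulf_eq0 oppr_eq0.
  by rewrite (negbTE (const_sign_neq0 Phi0 0)) (negbTE (const_sign_neq0 hs 0)).
case: s1 s2 => s1 [] s2.
- by apply: same; left => x nx; exact: (ln_affine_sign (beta x) (w10 x) (w20 x) nx).1.
- exfalso; apply: diff; left => x; have := s1 x; have := s2 x; have := w10 x; have := w20 x; nra.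
- exfalso; apply: diff; right => x; have := s1 x; have := s2 x; have := w10 x; have := w20 x; nra.
- by apply: same; right => x nx; exact: (ln_affine_sign (beta x) (w10 x) (w20 x) nx).2.
Qed.

End Comparison.

Lemma shift_surjective f T c : continuous f -> (forall t, f (t + T) = f t + c) -> c != 0 ->
  0 < T -> forall y, exists t, f t = y.
Proof.
move=> cf fT c0 T0 y; have c0' : 0 < `|c| by rewrite normr_gt0.
have [n hn] := archimedean_mul `|y - f 0| c0'.
have nT : 0 <= n%:R * T by rewrite mulr_ge0 // ltW.
have e1 := shift_iter 0 n fT; have e2 := shift_iter (- (n%:R * T)) n fT.
rewrite add0r in e1; rewrite addNr in e2.
have [||t _ ft] := @ivt R f (- (n%:R * T)) (n%:R * T) y cf; last by exists t.
  by rewrite (le_trans _ nT) // oppr_le0.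
move: hn; rewrite ltr_norml => /andP[h1 h2]; rewrite e1.
have -> : f (- (n%:R * T)) = f 0 - n%:R * c by rewrite e2; ring.
move: c0; rewrite neq_lt => /orP[c0|c0].
  by right; rewrite ltr0_norm // in h1 h2; lra.
by left; rewrite gtr0_norm // in h1 h2; lra.
Qed.

(** A nonvanishing angular velocity makes the angle strictly monotone and, by [c != 0], onto the
    line, so the angle can replace time. *)
Lemma motion_graph (A C beta mu th w : R -> R) T c : 0 < T ->
  polar_motion A C beta mu th w -> (forall t, 0 < w t) ->
  (forall t, 0 < mu t) \/ (forall t, mu t < 0) ->
  (forall t, 0 < 1 + beta (th t) * w t) \/ (forall t, 1 + beta (th t) * w t < 0) ->
  (forall t, th (t + T) = th t + c) -> (forall t, w (t + T) = w t) ->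
  exists W : R -> R, [/\ c != 0, scalar_solution A C beta W,
    (forall x, W (x + c) = W x), (forall t, w t = W (th t)) & (forall y, exists t, th t = y)].
Proof.
move=> T0 [dth dw] w0 mu0 U0 thT wT.
pose v t := mu t * (1 + beta (th t) * w t).
have vs : (forall t, 0 < v t) \/ (forall t, v t < 0).
  case: mu0 U0 => hm [] hU; [left|right|right|left] => t;
  have := hm t; have := hU t; rewrite /v; nra.
have v0 := const_sign_neq0 vs.
have c0 : c != 0.
  have E : th (0 + T) - th 0 = c by rewrite thT; ring.
  have [|z _ e] := @mvt R th v 0 (0 + T) _ (fun x _ => dth x); first by rewrite add0r.
  by rewrite -E e mulf_neq0 // add0r subr0 gt_eqF.
have sth := shift_surjective (der_continuous dth) thT c0 T0.
have [psi [psiK thK dpsi]] := der_neq0_inverse dth vs sth.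
exists (fun x => w (psi x)); split=> //.
- split=> [x|x|]; first exact: w0.
    apply: (derE _ (der_comp (dw (psi x)) (dpsi x))); rewrite psiK.
    have := v0 (psi x); rewrite /v mulf_eq0 negb_or psiK => /andP[m0 u0].
    by field; rewrite m0 u0.
  by case: U0 => h; [left|right] => x; have := h (psi x); rewrite psiK.
- move=> x; rewrite -(wT (psi x)); congr (w _).
  by rewrite -[RHS]thK thT psiK.
- by move=> t; rewrite thK.
Qed.

End ScalarEquation.

(** * Polynomial fields and weighted polar coordinates *)

Section Polynomials.
Variable R : realType.
Implicit Types (F G : {poly {poly R}}) (x y t : R).

Lemma eval2D F G x y : eval2 (F + G) x y = eval2 F x y + eval2 G x y.
Proof. by rewrite /eval2 !hornerD. Qed.

Lemma eval2N F x y : eval2 (- F) x y = - eval2 F x y.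
Proof. by rewrite /eval2 !hornerN. Qed.

Lemma eval2M F G x y : eval2 (F * G) x y = eval2 F x y * eval2 G x y.
Proof. by rewrite /eval2 !hornerM. Qed.

Lemma eval2X x y : eval2 'X x y = x.
Proof. by rewrite /eval2 hornerX hornerC. Qed.

Lemma eval2C (u : {poly R}) x y : eval2 u%:P x y = u.[y].
Proof. by rewrite /eval2 hornerC. Qed.

Definition eval2E := (eval2D, eval2N, eval2M, eval2X, eval2C).

Lemma vfPD (X Y : polyvf R) x y : vfP (X + Y) x y = vfP X x y + vfP Y x y.
Proof. exact: eval2D. Qed.

Lemma vfQD (X Y : polyvf R) x y : vfQ (X + Y) x y = vfQ X x y + vfQ Y x y.
Proof. exact: eval2D. Qed.

Lemma vfPN (X : polyvf R) x y : vfP (- X) x y = - vfP X x y.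
Proof. exact: eval2N. Qed.

Lemma vfQN (X : polyvf R) x y : vfQ (- X) x y = - vfQ X x y.
Proof. exact: eval2N. Qed.

(** [Fx] and [Fy] are the partial derivatives, obtained by recursion on [F] as a polynomial in [x];
    it is enough to know that they are polynomials again. *)
Lemma eval2_chain F : exists Fx Fy, forall (x y : R -> R) t a b,
  is_derive t 1 x a -> is_derive t 1 y b ->
  is_derive t 1 (fun t => eval2 F (x t) (y t))
    (eval2 Fx (x t) (y t) * a + eval2 Fy (x t) (y t) * b).
Proof.
elim/poly_ind: F => [|F u [Fx [Fy ih]]].
  exists 0, 0 => x y t a b _ _.
  rewrite /eval2 !horner0; under eq_fun do rewrite !horner0.
  by apply: (derE _ (derC 0 t)); ring.
exists (Fx * 'X + F), (Fy * 'X + (u^`())%:P) => x y t a b dx dy.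
have -> : (fun t => eval2 (F * 'X + u%:P) (x t) (y t)) =
    (fun t => eval2 F (x t) (y t) * x t + u.[y t]).
  by apply: funext => s; rewrite !eval2E.
have du := der_comp (is_derive_poly u (y t)) dy.
apply: (derE _ (derD (derM (ih _ _ _ _ _ dx dy) dx) du)).
by rewrite !eval2E; ring.
Qed.

Lemma horner_lipschitz (u : {poly R}) (M y0 : R) :
  exists2 K, 0 <= K & forall y, `|y| <= M -> `|u.[y] - u.[y0]| <= K * `|y - y0|.
Proof.
elim/poly_ind: u => [|u k [K K0 ih]].
  by exists 0 => // y _; rewrite !horner0 subrr normr0 mul0r.
exists (K * `|M| + `|u.[y0]|) => [|y yM].
  by rewrite addr_ge0 // mulr_ge0.
rewrite !hornerE.
have -> : u.[y] * y + k - (u.[y0] * y0 + k) = (u.[y] - u.[y0]) * y + u.[y0] * (y - y0) by ring.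
apply: le_trans (ler_normD _ _) _; rewrite !normrM mulrDl lerD // mulrAC.
by rewrite ler_pM // ?ih // (le_trans yM) // ler_norm.
Qed.

(** One of the points stays fixed; it will be an equilibrium, near which the field is then at most
    linear. *)
Lemma eval2_lipschitz F (M x0 y0 : R) :
  exists2 K, 0 <= K & forall x y, `|x| <= M -> `|y| <= M ->
    `|eval2 F x y - eval2 F x0 y0| <= K * (`|x - x0| + `|y - y0|).
Proof.
elim/poly_ind: F => [|F u [K K0 ih]].
  by exists 0 => // x y _ _; rewrite /eval2 !horner0 subrr normr0 mul0r.
have [K' K'0 hu] := horner_lipschitz u M y0.
exists (K * `|M| + `|eval2 F x0 y0| + K') => [|x y xM yM].
  by rewrite !addr_ge0 // mulr_ge0.
rewrite !eval2E.
have -> : eval2 F x y * x + u.[y] - (eval2 F x0 y0 * x0 + u.[y0]) =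
  (eval2 F x y - eval2 F x0 y0) * x + eval2 F x0 y0 * (x - x0) + (u.[y] - u.[y0]) by ring.
apply: le_trans (ler_normD _ _) _; rewrite [leRHS]mulrDl; apply: lerD; last first.
  by apply: le_trans (hu _ yM) _; rewrite ler_wpM2l // lerDr.
apply: le_trans (ler_normD _ _) _; rewrite !normrM mulrDl; apply: lerD; last first.
  by rewrite ler_wpM2l // lerDl.
by rewrite mulrAC ler_pM // ?ih // (le_trans xM) // ler_norm.
Qed.

(** A class closed under derivation that contains every [a_fun] and [b_fun]; continuity,
    differentiability and the period [2 pi] follow at once. *)
Definition trig_poly (f : R -> R) :=
  exists F, forall t, f t = eval2 F (cos t) (sin t).

Lemma trig_poly_der f : trig_poly f ->
  exists2 f', trig_poly f' & forall t, is_derive t 1 f (f' t).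
Proof.
move=> [F fE]; have [Fx [Fy h]] := eval2_chain F.
exists (fun t => eval2 Fx (cos t) (sin t) * (- sin t) + eval2 Fy (cos t) (sin t) * cos t).
  by exists (Fx * (- ('X)%:P) + Fy * 'X) => t; rewrite !eval2E hornerX.
move=> t; rewrite (_ : f = fun t => eval2 F (cos t) (sin t)); last exact: funext.
exact: h.
Qed.

Lemma trig_poly_continuous f : trig_poly f -> continuous f.
Proof. by move=> /trig_poly_der[f' _ /der_continuous]. Qed.

Lemma cos_period t : cos (t + 2 * pi) = cos t.
Proof. by rewrite mulr_natl cosD2pi. Qed.

Lemma sin_period t : sin (t + 2 * pi) = sin t.
Proof. by rewrite mulr_natl sinD2pi. Qed.

Lemma trig_poly_periodic f : trig_poly f -> forall t, f (t + 2 * pi) = f t.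
Proof. by move=> [F fE] t; rewrite !fE cos_period sin_period. Qed.

Lemma trig_poly_a n m (X : polyvf R) : trig_poly (a_fun n m X).
Proof.
exists ((m%:R - n%:R)%:P%:P * ('X * X.1 + ('X)%:P * X.2)) => t.
by rewrite /a_fun !eval2E hornerC hornerX.
Qed.

Lemma trig_poly_b p q (X : polyvf R) : trig_poly (b_fun p q X).
Proof.
exists ((p%:R)%:P%:P * 'X * X.2 - (q%:R)%:P%:P * ('X)%:P * X.1) => t.
by rewrite /b_fun !eval2E !hornerC hornerX.
Qed.

Lemma const_sign (f : R -> R) : continuous f -> (forall t, f t != 0) ->
  (forall t, 0 < f t) \/ (forall t, f t < 0).
Proof.
move=> cf f0; have [h|h] := ltP 0 (f 0).
  left=> t; rewrite ltNge; apply/negP => ft.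
  have [||z _ fz] := @ivt R f (Num.min 0 t) (Num.max 0 t) 0 cf.
  - by rewrite ge_min le_max lexx.
  - case: (leP 0 t) => _; [right|left]; by rewrite ft ltW.
  by have := f0 z; rewrite fz eqxx.
right=> t; rewrite ltNge; apply/negP => ft.
have [||z _ fz] := @ivt R f (Num.min 0 t) (Num.max 0 t) 0 cf.
- by rewrite ge_min le_max lexx.
- by case: (leP 0 t) => _; [left|right]; rewrite ft h.
by have := f0 z; rewrite fz eqxx.
Qed.

Lemma cos_eq1 (c : R) : cos c = 1 -> exists k : nat, `|c| = k%:R * (2 * pi).
Proof.
move=> cc; have p0 : 0 < 2 * pi :> R by rewrite mulr_gt0 // pi_gt0.
pose k := Num.truncn (`|c| / (2 * pi)).
have /andP[k1 k2] : k%:R <= `|c| / (2 * pi) < k.+1%:R.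
  by apply: truncn_itv; rewrite divr_ge0 // ltW.
exists k; pose x := `|c| - k%:R * (2 * pi).
suff : x = 0 by rewrite /x; lra.
have x0 : 0 <= x by rewrite subr_ge0 -ler_pdivlMr.
have x2 : x < 2 * pi.
  by move: k2; rewrite ltr_pdivrMr // -natr1 /x; lra.
have cx : cos x = 1.
  have := @shift_iter R cos (2 * pi) 0 x k; rewrite mulr0 addr0 => <-.
    by rewrite /x subrK cos_norm.
  by move=> t; rewrite cos_period addr0.
have [xp|xp] := leP x pi.
  apply: cos_inj; rewrite ?cos0 ?in_itv //=; first by rewrite x0.
  by rewrite lexx pi_ge0.
have : 2 * pi - x = 0.
  apply: cos_inj; rewrite ?cos0 ?in_itv //=.
  - by apply/andP; split; lra.
  - by rewrite lexx pi_ge0.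
  - by rewrite addrC cos_period cosN.
by lra.
Qed.

Lemma same_angle (a b : R) : cos a = cos b -> sin a = sin b ->
  exists k : nat, `|a - b| = k%:R * (2 * pi).
Proof.
by move=> hc hs; apply: cos_eq1; rewrite cosB hc hs -!expr2 cos2Dsin2.
Qed.

Lemma unit_circle_angle (c s : R) : c ^+ 2 + s ^+ 2 = 1 ->
  exists t, cos t = c /\ sin t = s.
Proof.
move=> cs; have c1 : -1 <= c <= 1.
  by rewrite -ler_norml -(@expr_le1 _ 2) // real_normK ?num_real // -cs lerDl sqr_ge0.
have sE : sin (acos c) = `|s|.
  by rewrite sin_acos // -sqrtr_sqr; congr Num.sqrt; rewrite -cs; ring.
have [s0|s0] := leP 0 s.
  by exists (acos c); rewrite acosK // sE ger0_norm.
by exists (- acos c); rewrite cosN sinN acosK // sE ltr0_norm // opprK.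
Qed.

End Polynomials.

(** * Weighted polar coordinates *)

Section PolarCoordinates.
Variable R : realType.
Variables p q : nat.
Hypotheses (p0 : (0 < p)%N) (q0 : (0 < q)%N).
Implicit Types (x y t l th : R).

Let p0R : 0 < p%:R :> R. Proof. by rewrite ltr0n. Qed.
Let q0R : 0 < q%:R :> R. Proof. by rewrite ltr0n. Qed.

(** The logarithm [l] of the weighted radius is the coordinate, so that it ranges over the whole
    line. *)
Definition polar (l th : R) : R * R :=
  (expR (p%:R * l) * cos th, expR (q%:R * l) * sin th).

(** Equal to 1 exactly when [expR l] is the weighted radius of [(x, y)], which has no closed formula
    for general weights. *)
Definition sphere (x y l : R) : R :=
  (x * expR (- p%:R * l)) ^+ 2 + (y * expR (- q%:R * l)) ^+ 2.

(** The Jacobian determinant of [polar] up to a positive exponential. *)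
Definition slope_form (th : R) : R := p%:R * cos th ^+ 2 + q%:R * sin th ^+ 2.

Lemma slope_form_gt0 th : 0 < slope_form th.
Proof.
have p1 : 1 <= p%:R :> R by rewrite ler1n.
have q1 : 1 <= q%:R :> R by rewrite ler1n.
have := cos2Dsin2 th; have := sqr_ge0 (cos th); have := sqr_ge0 (sin th).
by rewrite /slope_form; nra.
Qed.

Lemma sphere_polar l th : sphere (polar l th).1 (polar l th).2 l = 1.
Proof.
rewrite /sphere /= -[RHS](cos2Dsin2 th); congr (_ ^+ 2 + _ ^+ 2);
by rewrite mulrAC mulNr expRN divff ?mul1r // gt_eqF // expR_gt0.
Qed.

Lemma sphere_nincr x y l l' : l <= l' -> sphere x y l' <= sphere x y l.
Proof.
move=> ll; rewrite /sphere !exprMn; apply: lerD; apply: ler_wpM2l; rewrite ?sqr_ge0 //;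
by rewrite lerXn2r ?nnegrE ?expR_ge0 // ler_expR !mulNr lerN2 ler_wpM2l // ltW.
Qed.

Lemma sphere_decr x y l l' : (x, y) != (0, 0) -> l < l' -> sphere x y l' < sphere x y l.
Proof.
move=> xy ll; have lt1 (k u : R) : 0 < k -> u != 0 ->
    (u * expR (- k * l')) ^+ 2 < (u * expR (- k * l)) ^+ 2.
  move=> k0 u0; rewrite !exprMn ltr_pM2l; last by rewrite lt_neqAle sqr_ge0 eq_sym sqrf_eq0 u0.
  by rewrite ltrXn2r // ?nnegrE ?expR_ge0 // ltr_expR !mulNr ltrN2 ltr_pM2l.
have le1 (k u : R) : 0 < k -> (u * expR (- k * l')) ^+ 2 <= (u * expR (- k * l)) ^+ 2.
  move=> k0; have [->|u0] := eqVneq u 0; first by rewrite !mul0r.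
  exact/ltW/lt1.
have [x0|x0] := eqVneq x 0.
  have y0 : y != 0 by move: xy; apply: contraNneq => y0; rewrite x0 y0.
  by rewrite /sphere ler_ltD ?le1 ?lt1.
by rewrite /sphere ltr_leD ?le1 ?lt1.
Qed.

Lemma sphere_inj x y l l' : sphere x y l = 1 -> sphere x y l' = 1 -> l = l'.
Proof.
move=> h h'; have xy : (x, y) != (0, 0).
  by apply/eqP => -[x0 y0]; move: h; rewrite /sphere x0 y0 !mul0r; lra.
apply/eqP; apply: contraT; rewrite neq_lt => /orP[] /(sphere_decr xy);
by rewrite h h' ltxx.
Qed.

Let dlin (k l : R) : is_derive l 1 (fun l => k * l) k.
Proof. by apply: (derE _ (derM (derC k l) (derX l))); ring. Qed.

Lemma sphere_exists x y : (x, y) != (0, 0) -> exists l, sphere x y l = 1.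
Proof.
move=> xy; pose M := x ^+ 2 + y ^+ 2.
have M0 : 0 < M.
  rewrite lt_neqAle addr_ge0 ?sqr_ge0 // andbT eq_sym paddr_eq0 ?sqr_ge0 // !sqrf_eq0.
  by apply: contra xy => /andP[/eqP-> /eqP->].
have hexp (k : R) l : 1 <= k -> 0 <= l -> 1 + l <= expR (k * l).
  by move=> k1 l0; apply: le_trans (expR_ge1Dx _); rewrite lerD2l ler_peMl.
have p1 : 1 <= p%:R :> R by rewrite ler1n.
have q1 : 1 <= q%:R :> R by rewrite ler1n.
have sq1 (z : R) : 1 <= z -> z <= z ^+ 2 by move=> h; rewrite expr2 ler_peMl // (le_trans ler01).
(* The end points [- M^-1] and [M] are such that [expR z >= 1 + z] suffices for both bounds. *)
have big : exists2 l, l <= 0 & 1 <= sphere x y l.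
  exists (- M^-1); first by rewrite oppr_le0 invr_ge0 ltW.
  have M1 : 0 <= M^-1 by rewrite invr_ge0 ltW.
  have bd (k : R) : 1 <= k -> M^-1 <= expR (- k * - M^-1) ^+ 2.
    move=> k1; rewrite mulrNN; apply: le_trans (sq1 _ _).
      by apply: le_trans (hexp _ _ k1 M1); rewrite lerDr.
    by apply: le_trans (hexp _ _ k1 M1); rewrite lerDl.
  have -> : 1 = x ^+ 2 * M^-1 + y ^+ 2 * M^-1 by rewrite -mulrDl divff // gt_eqF.
  by rewrite /sphere !exprMn; apply: lerD; apply: ler_wpM2l; rewrite ?sqr_ge0 ?bd.
have small : exists2 l, 0 <= l & sphere x y l <= 1.
  exists M; first exact: ltW.
  have bd (k : R) : 1 <= k -> expR (- k * M) ^+ 2 <= M^-1.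
    move=> k1; rewrite mulNr expRN exprVn lef_pV2 ?posrE ?exprn_gt0 ?expR_gt0 //.
    apply: le_trans (sq1 _ _).
      by apply: le_trans (hexp _ _ k1 (ltW M0)); rewrite lerDr.
    by apply: le_trans (hexp _ _ k1 (ltW M0)); rewrite lerDl ltW.
  have -> : 1 = x ^+ 2 * M^-1 + y ^+ 2 * M^-1 by rewrite -mulrDl divff // gt_eqF.
  by rewrite /sphere !exprMn; apply: lerD; apply: ler_wpM2l; rewrite ?sqr_ge0 ?bd.
have [a a0 ha] := big; have [b b0 hb] := small.
have cs : continuous (sphere x y).
  apply: (@der_continuous _ _ (fun l => _)) => l; rewrite /sphere.
  have d (k u : R) : is_derive l 1 (fun l => (u * expR (k * l)) ^+ 2)
      (2%:R * (u * expR (k * l)) ^+ 1 * (0 * expR (k * l) + u * (expR (k * l) * k))).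
    exact: derXn 2 (derM (derC u l) (derexp (dlin k l))).
  exact: derD (d _ _) (d _ _).
have [||l _ e] := @ivt R (sphere x y) a b 1 cs; last by exists l.
  exact: le_trans b0.
by right; rewrite ha hb.
Qed.

Lemma polar_neq0 l th : polar l th != (0, 0).
Proof.
apply/eqP => -[h1 h2]; have := sphere_polar l th.
by rewrite /= h1 h2 /sphere !mul0r; lra.
Qed.

Lemma sphere_polarP x y l : sphere x y l = 1 -> exists th, (x, y) = polar l th.
Proof.
move=> h; have [th [hc hs]] := unit_circle_angle h.
exists th; rewrite /polar hc hs !mulNr !expRN.
by congr pair; rewrite mulrC divfK // gt_eqF // expR_gt0.
Qed.

Lemma polar_surj (z : R * R) : z != (0, 0) -> exists l th, z = polar l th.
Proof.
case: z => x y xy; have [l hl] := sphere_exists xy.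
by have [th e] := sphere_polarP hl; exists l, th.
Qed.

Lemma polar_inj l l' th th' : polar l th = polar l' th' ->
  l = l' /\ exists k : nat, `|th - th'| = k%:R * (2 * pi).
Proof.
move=> e; have ll : l = l'.
  by apply: (@sphere_inj (polar l th).1 (polar l th).2); rewrite ?sphere_polar // e sphere_polar.
split=> //; move: e; rewrite -ll => -[/mulfI hc /mulfI hs].
by apply: same_angle; [apply: hc|apply: hs]; rewrite gt_eqF // expR_gt0.
Qed.

Lemma polar_periodic l th : polar l (th + 2 * pi) = polar l th.
Proof. by rewrite /polar cos_period sin_period. Qed.

Lemma sphere_continuous (T : topologicalType) (t0 : T) (x y : T -> R) l :
  {for t0, continuous x} -> {for t0, continuous y} ->
  {for t0, continuous (fun s : T => sphere (x s) (y s) l)}.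
Proof.
move=> cx cy; rewrite /sphere.
have h (u : T -> R) (k : R) : {for t0, continuous u} ->
    {for t0, continuous (fun s : T => (u s * k) ^+ 2)}.
  move=> cu; have cuk : {for t0, continuous (fun s : T => u s * k)}.
    by apply: cvgM; [exact: cu|exact: cvg_cst].
  by apply: cvgM.
by apply: cvgD; apply: h.
Qed.

(** [sphere] decreases strictly in [l], so the strict inequalities at [l t0 + e] and [l t0 - e]
    persist nearby and trap the radius. *)
Lemma radius_continuous (T : topologicalType) (t0 : T) (x y l : T -> R) :
  {for t0, continuous x} -> {for t0, continuous y} ->
  (\forall s \near t0, sphere (x s) (y s) (l s) = 1) -> {for t0, continuous l}.
Proof.
move=> cx cy hl; apply/cvgrPdist_lt => e e0.
have xy : (x t0, y t0) != (0, 0).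
  apply/eqP => -[x0 y0]; have := nbhs_singleton hl.
  by rewrite x0 y0 /sphere !mul0r; lra.
have l0 := nbhs_singleton hl.
have h1 : sphere (x t0) (y t0) (l t0 + e) < 1.
  by rewrite -[ltRHS]l0 sphere_decr // ltrDl.
have h2 : 1 < sphere (x t0) (y t0) (l t0 - e).
  by rewrite -[ltLHS]l0 sphere_decr // gtrBl.
have n1 : \forall s \near t0, sphere (x s) (y s) (l t0 + e) < 1.
  exact: (@cvgr_lt R T (nbhs t0) _ _ _ (@sphere_continuous T t0 x y (l t0 + e) cx cy) _ h1).
have n2 : \forall s \near t0, 1 < sphere (x s) (y s) (l t0 - e).
  exact: (@cvgr_gt R T (nbhs t0) _ _ _ (@sphere_continuous T t0 x y (l t0 - e) cx cy) _ h2).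
move: hl n1 n2; apply: filterS3 => t s1 s2 s3.
rewrite ltr_distlC; apply/andP; split; rewrite ltNge; apply/negP => h.
  by have := sphere_nincr (x t) (y t) h; rewrite s1 leNgt s3.
by have := sphere_nincr (x t) (y t) h; rewrite s1 leNgt s2.
Qed.

Lemma caratheodory_exp (k l : R) : exists phi : R -> R,
  [/\ forall l', expR (- k * l') ^+ 2 - expR (- k * l) ^+ 2 = phi l' * (l' - l),
      {for l, continuous phi} & phi l = - 2 * k * expR (- k * l) ^+ 2].
Proof.
apply/is_derive1_caratheodory.
apply: (derE _ (derXn 2 (derexp (dlin (- k) l)))).
by rewrite /= expr1; ring.
Qed.

(** Implicit differentiation by Caratheodory slopes: subtracting the equation at [t] from that at
    [s] gives the exact identity [den * (l s - l t) = - num * (s - t)], and [den] vanishes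
    nowhere. *)
Lemma radius_der (x y l : R -> R) t (dx dy : R) :
  is_derive t 1 x dx -> is_derive t 1 y dy ->
  (forall t, sphere (x t) (y t) (l t) = 1) ->
  is_derive t 1 l
    ((x t * expR (- p%:R * l t) * (dx * expR (- p%:R * l t)) +
      y t * expR (- q%:R * l t) * (dy * expR (- q%:R * l t))) /
     (p%:R * (x t * expR (- p%:R * l t)) ^+ 2 + q%:R * (y t * expR (- q%:R * l t)) ^+ 2)).
Proof.
move=> hx hy hl.
have cl : {for t, continuous l}.
  apply: (radius_continuous (der_cont hx) (der_cont hy)).
  by near=> s; exact: hl.
have xy s : (x s, y s) != (0, 0).
  by apply/eqP => -[x0 y0]; have := hl s; rewrite /sphere x0 y0 !mul0r; lra.
have [xi [xiE cxi xi0]] := (is_derive1_caratheodory _ _ _).1 (derXn 2 hx).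
have [eta [etaE ceta eta0]] := (is_derive1_caratheodory _ _ _).1 (derXn 2 hy).
have [phi [phiE cphi phi0]] := caratheodory_exp p%:R (l t).
have [psi [psiE cpsi psi0]] := caratheodory_exp q%:R (l t).
pose den l' := x t ^+ 2 * phi l' + y t ^+ 2 * psi l'.
pose num s := xi s * expR (- p%:R * l s) ^+ 2 + eta s * expR (- q%:R * l s) ^+ 2.
have den0 : den (l t) != 0.
  rewrite /den phi0 psi0 lt_eqF //.
  have := hl t; rewrite /sphere !exprMn.
  have := sqr_ge0 (x t); have := sqr_ge0 (y t).
  have := sqr_ge0 (expR (- p%:R * l t)); have := sqr_ge0 (expR (- q%:R * l t)).
  set a := expR (- p%:R * l t) ^+ 2; set b := expR (- q%:R * l t) ^+ 2.
  set u := x t ^+ 2; set v := y t ^+ 2 => b0 a0 v0 u0 E.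
  have p1 : 1 <= p%:R :> R by rewrite ler1n.
  have q1 : 1 <= q%:R :> R by rewrite ler1n.
  have ua0 : 0 <= u * a by rewrite mulr_ge0.
  have vb0 : 0 <= v * b by rewrite mulr_ge0.
  have -> : u * (- 2 * p%:R * a) + v * (- 2 * q%:R * b) =
     - (2 * (p%:R * (u * a) + q%:R * (v * b))) by ring.
  rewrite oppr_lt0 mulr_gt0 //.
  have : u * a <= p%:R * (u * a) by rewrite ler_peMl.
  have : v * b <= q%:R * (v * b) by rewrite ler_peMl.
  by lra.
have E s : den (l s) * (l s - l t) = - num s * (s - t).
  have := hl s; have := hl t; rewrite /sphere !exprMn => E1 E2.
  have := xiE s; have := etaE s; have := phiE (l s); have := psiE (l s).
  rewrite /den /num mulrDl -!mulrA => <- <- e1 e2.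
  have -> : - (xi s * expR (- p%:R * l s) ^+ 2 + eta s * expR (- q%:R * l s) ^+ 2) * (s - t) =
    - ((xi s * (s - t)) * expR (- p%:R * l s) ^+ 2 + (eta s * (s - t)) * expR (- q%:R * l s) ^+ 2) by ring.
  rewrite -e1 -e2.
  by move: E1 E2; lra.
have dens s : den (l s) != 0.
  have [e|ns] := eqVneq (l s) (l t); first by rewrite e.
  rewrite lt_eqF // /den.
  have neg (k : R) (f : R -> R) : 0 < k ->
      (forall l', expR (- k * l') ^+ 2 - expR (- k * l t) ^+ 2 = f l' * (l' - l t)) ->
      f (l s) < 0.
    move=> k0 /(_ (l s)) e.
    move: ns; rewrite neq_lt => /orP[h|h].
      have : 0 < expR (- k * l s) ^+ 2 - expR (- k * l t) ^+ 2.
        by rewrite subr_gt0 ltrXn2r ?nnegrE ?expR_ge0 // ltr_expR !mulNr ltrN2 ltr_pM2l.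
      by rewrite e; move: h; rewrite -subr_lt0 => h; rewrite nmulr_lgt0.
    have : expR (- k * l s) ^+ 2 - expR (- k * l t) ^+ 2 < 0.
      by rewrite subr_lt0 ltrXn2r ?nnegrE ?expR_ge0 // ltr_expR !mulNr ltrN2 ltr_pM2l.
    by rewrite e; move: h; rewrite -subr_gt0 => h; rewrite pmulr_llt0.
  have f1 := neg _ _ p0R phiE; have f2 := neg _ _ q0R psiE.
  have := xy t; rewrite -pair_eqE /= negb_and => /orP[h|h].
    have h' : 0 < x t ^+ 2 by rewrite lt_neqAle sqr_ge0 eq_sym sqrf_eq0 h.
    by have := sqr_ge0 (y t); nra.
  have h' : 0 < y t ^+ 2 by rewrite lt_neqAle sqr_ge0 eq_sym sqrf_eq0 h.
  by have := sqr_ge0 (x t); nra.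
apply/is_derive1_caratheodory; exists (fun s => - num s / den (l s)); split.
- by move=> s; rewrite mulrAC -E mulrAC divff // mul1r.
- have cexp (k : R) : {for t, continuous (fun s => expR (k * l s) ^+ 2)}.
    apply: (@continuous_comp _ _ _ l (fun l => expR (k * l) ^+ 2)) => //.
    exact: der_cont (derXn 2 (derexp (dlin k (l t)))).
  apply: cvgM.
    by apply: cvgN; apply: cvgD; apply: cvgM => //; exact: cexp.
  apply: cvgV => //; apply: cvgD; apply: cvgM; try exact: cvg_cst.
    by apply: (continuous_comp cl).
  by apply: (continuous_comp cl).
- rewrite /num xi0 eta0 /den phi0 psi0 /= !expr1.
  move: den0; rewrite /den phi0 psi0 => den0.
  have D0 : p%:R * (x t * expR (- p%:R * l t)) ^+ 2 + q%:R * (y t * expR (- q%:R * l t)) ^+ 2 != 0.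
    by apply: contraNneq den0 => e; rewrite -[0](mulr0 (-2)) -e; apply/eqP; ring.
  have -> : x t ^+ 2 * (- 2 * p%:R * expR (- p%:R * l t) ^+ 2) + y t ^+ 2 * (- 2 * q%:R * expR (- q%:R * l t) ^+ 2)
    = -2 * (p%:R * (x t * expR (- p%:R * l t)) ^+ 2 + q%:R * (y t * expR (- q%:R * l t)) ^+ 2) by ring.
  by field.
Unshelve. all: by end_near. Qed.

End PolarCoordinates.

Section QuasiHomogeneousPair.
Variable R : realType.
Variables (p q n m : nat) (Xn Xm : polyvf R).
Hypothesis hyp : hypotheses p q n m Xn Xm.
Implicit Types (t x : R).

Definition ratA t := a_fun n m Xn t / b_fun p q Xm t.
Definition ratC t := a_fun n m Xm t / b_fun p q Xm t.
Definition ratB t := b_fun p q Xn t / b_fun p q Xm t.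
Definition ratB' := derive1 ratB.

Lemma PhiE t : Phi p q n m Xn Xm t = ratA t - ratB' t.
Proof. by []. Qed.

Lemma bm_neq0 t : b_fun p q Xm t != 0.
Proof. by case: hyp => _ [_ _ h _]; apply/eqP. Qed.

Lemma bm_sign : (forall t, 0 < b_fun p q Xm t) \/ (forall t, b_fun p q Xm t < 0).
Proof. apply: const_sign bm_neq0; exact: trig_poly_continuous (trig_poly_b _ _ _). Qed.

Lemma trig_quotient (f g : R -> R) : trig_poly f -> trig_poly g -> (forall t, g t != 0) ->
  [/\ continuous (fun t => f t / g t), (forall t, f (t + 2 * pi) / g (t + 2 * pi) = f t / g t),
      (forall t, is_derive t 1 (fun t => f t / g t) (derive1 (fun t => f t / g t) t)) &
      continuous (derive1 (fun t => f t / g t))].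
Proof.
move=> tf tg g0.
have [f' tf' df] := trig_poly_der tf; have [g' tg' dg] := trig_poly_der tg.
have d t := derdiv (g0 t) (df t) (dg t).
have dE : derive1 (fun t => f t / g t) = (fun t => (f' t * g t - f t * g' t) / g t ^+ 2).
  by apply: funext => t; have [_ ->] := der_val (d t).
split.
- exact: der_continuous d.
- by move=> t; rewrite !trig_poly_periodic.
- by move=> t; rewrite dE.
rewrite dE => t.
have cf : {for t, continuous f} by exact: trig_poly_continuous.
have cg : {for t, continuous g} by exact: trig_poly_continuous.
have cf' : {for t, continuous f'} by exact: trig_poly_continuous.
have cg' : {for t, continuous g'} by exact: trig_poly_continuous.
apply: cvgM; first by apply: cvgB; apply: cvgM.
apply: cvgV; first by rewrite expf_neq0.
by apply: cvgM.
Qed.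

Lemma ratA_continuous : continuous ratA.
Proof. have [h _ _ _] := trig_quotient (trig_poly_a n m Xn) (trig_poly_b p q Xm) bm_neq0; exact: h. Qed.

Lemma ratC_continuous : continuous ratC.
Proof. have [h _ _ _] := trig_quotient (trig_poly_a n m Xm) (trig_poly_b p q Xm) bm_neq0; exact: h. Qed.

Lemma ratB_der t : is_derive t 1 ratB (ratB' t).
Proof. have [_ _ h _] := trig_quotient (trig_poly_b p q Xn) (trig_poly_b p q Xm) bm_neq0; exact: h. Qed.

Lemma ratB'_continuous : continuous ratB'.
Proof. have [_ _ _ h] := trig_quotient (trig_poly_b p q Xn) (trig_poly_b p q Xm) bm_neq0; exact: h. Qed.

Lemma ratA_periodic t : ratA (t + 2 * pi) = ratA t.
Proof. have [_ h _ _] := trig_quotient (trig_poly_a n m Xn) (trig_poly_b p q Xm) bm_neq0; exact: h. Qed.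

Lemma ratC_periodic t : ratC (t + 2 * pi) = ratC t.
Proof. have [_ h _ _] := trig_quotient (trig_poly_a n m Xm) (trig_poly_b p q Xm) bm_neq0; exact: h. Qed.

Lemma ratB_periodic t : ratB (t + 2 * pi) = ratB t.
Proof. have [_ h _ _] := trig_quotient (trig_poly_b p q Xn) (trig_poly_b p q Xm) bm_neq0; exact: h. Qed.

Lemma periodic_representative (f : R -> R) t : (forall t, f (t + 2 * pi) = f t) ->
  exists2 s, 0 <= s <= 2 * pi & f t = f s.
Proof.
move=> fT; have p0 : 0 < 2 * pi :> R by rewrite mulr_gt0 // pi_gt0.
have fN s (k : nat) : f (s + k%:R * (2 * pi)) = f s.
  by rewrite (@shift_iter R f (2 * pi) 0) ?mulr0 ?addr0 // => u; rewrite addr0.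
have pos s : 0 <= s -> exists2 s', 0 <= s' <= 2 * pi & f s = f s'.
  move=> s0; have /andP[k1 k2] := truncn_itv (divr_ge0 s0 (ltW p0)).
  exists (s - (Num.truncn (s / (2 * pi)))%:R * (2 * pi)).
    rewrite subr_ge0 -ler_pdivlMr // k1 /=.
    by move: k2; rewrite ltr_pdivrMr // -natr1; lra.
  by rewrite -[RHS](fN _ (Num.truncn (s / (2 * pi)))) subrK.
have [k hk] := archimedean_mul (- t) p0.
have [|s hs e] := pos (t + k%:R * (2 * pi)); first by lra.
by exists s => //; rewrite -e fN.
Qed.

Lemma ratB'_periodic t : ratB' (t + 2 * pi) = ratB' t.
Proof.
have := @der_comp R ratB (fun t => t + 2 * pi) t _ _ (ratB_der (t + 2 * pi))
  (derD (derX t) (derC (2 * pi) t)).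
have -> : (fun t => ratB (t + 2 * pi)) = ratB by apply: funext => s; rewrite ratB_periodic.
by rewrite addr0 mulr1 => /der_uniq; apply; exact: ratB_der.
Qed.

Lemma Phi_sign : (forall t, 0 < ratA t - ratB' t) \/ (forall t, ratA t - ratB' t < 0).
Proof.
apply: const_sign => t; first by apply: cvgB; [exact: ratA_continuous|exact: ratB'_continuous].
have [|s hs ->] := @periodic_representative (fun t => ratA t - ratB' t) t.
  by move=> u; rewrite ratA_periodic ratB'_periodic.
by case: hyp => _ [_ _ _ h]; apply/eqP; exact: h.
Qed.

(** * The symmetry [lambda = -1] and the parity of [n] *)

Section Involution.

(** The angle of [((-1)^p cos t, (-1)^q sin t)], the image of a point of the unit circle under the
    symmetry. *)
Let turn t : R := (-1) ^+ (p + q) * t + pi *+ odd p.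

Let cos_turn t : cos (turn t) = (-1) ^+ p * cos t.
Proof.
rewrite /turn exprD -(signr_odd _ p) -(signr_odd _ q).
case: (odd p); case: (odd q); rewrite ?expr1 ?expr0 ?mulr1n ?mulr0n ?addr0 ?mulrNN ?mulr1 ?mul1r ?mulN1r //.
- by rewrite cosDpi.
- by rewrite cosDpi cosN.
- by rewrite cosN.
Qed.

Let sin_turn t : sin (turn t) = (-1) ^+ q * sin t.
Proof.
rewrite /turn exprD -(signr_odd _ p) -(signr_odd _ q).
case: (odd p); case: (odd q); rewrite ?expr1 ?expr0 ?mulr1n ?mulr0n ?addr0 ?mulrNN ?mulr1 ?mul1r ?mulN1r //.
- by rewrite sinDpi.
- by rewrite sinDpi sinN opprK.
- by rewrite sinN.
Qed.

Let sgnE (i j : nat) : odd i = odd j -> (-1) ^+ i = (-1) ^+ j :> R.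
Proof. by rewrite -(signr_odd _ i) -(signr_odd _ j) => ->. Qed.

Let pq0 : (0 < p)%N /\ (0 < q)%N.
Proof. by case: hyp => [[]]. Qed.

Let a_turn s X t : quasi_homogeneous p q s X ->
  a_fun n m X (turn t) = (-1) ^+ s.+1 * a_fun n m X t.
Proof.
move=> /(_ (-1) (cos t) (sin t))[hP hQ].
rewrite /a_fun cos_turn sin_turn hP hQ.
have e1 : (-1) ^+ p * (-1) ^+ (p + s - 1) = (-1) ^+ s.+1 :> R.
  by rewrite -exprD; apply: sgnE; have [] := pq0; lia.
have e2 : (-1) ^+ q * (-1) ^+ (q + s - 1) = (-1) ^+ s.+1 :> R.
  by rewrite -exprD; apply: sgnE; have [] := pq0; lia.
have -> u v : (-1) ^+ p * cos t * ((-1) ^+ (p + s - 1) * u) +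
    (-1) ^+ q * sin t * ((-1) ^+ (q + s - 1) * v) =
    ((-1) ^+ p * (-1) ^+ (p + s - 1)) * (cos t * u) +
    ((-1) ^+ q * (-1) ^+ (q + s - 1)) * (sin t * v) by ring.
by rewrite e1 e2; ring.
Qed.

Let b_turn s X t : quasi_homogeneous p q s X ->
  b_fun p q X (turn t) = (-1) ^+ (p + q + s).+1 * b_fun p q X t.
Proof.
move=> /(_ (-1) (cos t) (sin t))[hP hQ].
rewrite /b_fun cos_turn sin_turn hP hQ.
have e1 : (-1) ^+ p * (-1) ^+ (q + s - 1) = (-1) ^+ (p + q + s).+1 :> R.
  by rewrite -exprD; apply: sgnE; have [] := pq0; lia.
have e2 : (-1) ^+ q * (-1) ^+ (p + s - 1) = (-1) ^+ (p + q + s).+1 :> R.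
  by rewrite -exprD; apply: sgnE; have [] := pq0; lia.
have -> u v : p%:R * ((-1) ^+ p * cos t) * ((-1) ^+ (q + s - 1) * u) -
    q%:R * ((-1) ^+ q * sin t) * ((-1) ^+ (p + s - 1) * v) =
    ((-1) ^+ p * (-1) ^+ (q + s - 1)) * (p%:R * cos t * u) -
    ((-1) ^+ q * (-1) ^+ (p + s - 1)) * (q%:R * sin t * v) by ring.
by rewrite e1 e2; ring.
Qed.

Let even_of_sign (f : R -> R) k : (forall t, 0 < f t) \/ (forall t, f t < 0) ->
  (forall t, f (turn t) = (-1) ^+ k * f t) -> ~~ odd k.
Proof.
move=> fs /(_ 0); rewrite -signr_odd; case: (odd k) => //; rewrite expr1 mulN1r => e.
by case: fs => h; have := h (turn 0); have := h 0; rewrite e; lra.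
Qed.

(* The symmetry [lambda = -1] maps [Phi] and [b_m] to plus or minus themselves;
   as neither changes sign, both signs are [+], which is possible only for [n] odd. *)
Lemma degree_odd : odd n.
Proof.
have [_ [hn hm _ _]] := hyp.
have hb := even_of_sign bm_sign (fun t => b_turn t hm).
have bE t : b_fun p q Xm (turn t) = b_fun p q Xm t.
  by rewrite (b_turn _ hm) -signr_odd (negbTE hb) expr0 mul1r.
have AE t : ratA (turn t) = (-1) ^+ n.+1 * ratA t.
  by rewrite /ratA bE (a_turn _ hn); ring.
have BE t : ratB (turn t) = (-1) ^+ (p + q + n).+1 * ratB t.
  by rewrite /ratB bE (b_turn _ hn); ring.
(* The chain rule contributes a second factor [(-1) ^+ (p + q)], which cancels the one of [ratB] and
   leaves the sign of [ratA]. *)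
have B'E t : ratB' (turn t) = (-1) ^+ n.+1 * ratB' t.
  have dturn : is_derive t 1 turn ((-1) ^+ (p + q)).
    by apply: (derE _ (derD (derM (derC _ t) (derX t)) (derC _ t))); ring.
  have d1 := der_comp (ratB_der (turn t)) dturn.
  have d2 := derM (derC ((-1) ^+ (p + q + n).+1) t) (ratB_der t).
  have E : (fun t => ratB (turn t)) = (fun t => (-1) ^+ (p + q + n).+1 * ratB t).
    by apply: funext => s; rewrite BE.
  rewrite E in d1; have := der_uniq d1 d2; rewrite mul0r add0r.
  have sq : (-1) ^+ (p + q) * (-1) ^+ (p + q) = 1 :> R.
    by rewrite -exprD -signr_odd addnn odd_double.
  move=> e; rewrite -[LHS]mulr1 -sq mulrA e -addnS exprD.
  have -> u v w : u * v * w * u = (u * u) * v * w :> R by ring.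
  by rewrite sq mul1r.
have := even_of_sign Phi_sign (k := n.+1) _; rewrite /= negbK; apply => t.
by rewrite AE B'E; ring.
Qed.

End Involution.

End QuasiHomogeneousPair.

(** * Periodic orbits as periodic graphs *)

Section AngleLift.
Variable R : realType.

(** The angle is a primitive of [c s' - s c']. The coordinates [u], [v] of [(c, s)] in the frame
    rotated by that angle have derivative 0, hence stay at [(1, 0)]. *)
Lemma angle_lift (c s c' s' : R -> R) :
  (forall t : R, is_derive t 1 c (c' t)) -> (forall t : R, is_derive t 1 s (s' t)) ->
  continuous c' -> continuous s' -> (forall t, c t ^+ 2 + s t ^+ 2 = 1) ->
  exists th : R -> R, [/\ forall t, cos (th t) = c t, forall t, sin (th t) = s t &
    forall t : R, is_derive t 1 th (c t * s' t - s t * c' t)].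
Proof.
move=> dc ds cc' cs' cs1.
have cc := der_continuous dc; have cs := der_continuous ds.
have [th0 dth0] : exists th0 : R -> R, forall t : R, is_derive t 1 th0 (c t * s' t - s t * c' t).
  by apply: antiderivative => t; apply: cvgB; apply: cvgM;
    [exact: cc|exact: cs'|exact: cs|exact: cc'].
have [a [ca sa]] := unit_circle_angle (cs1 0).
pose th t := th0 t + (a - th0 0).
have dth (t : R) : is_derive t 1 th (c t * s' t - s t * c' t).
  by apply: (derE _ (derD (dth0 t) (derC (a - th0 0) t))); rewrite addr0.
have tha : th 0 = a by rewrite /th; ring.
have orth t : c t * c' t + s t * s' t = 0.
  have d := derD (derXn 2 (dc t)) (derXn 2 (ds t)).
  have e : (fun t => c t ^+ 2 + s t ^+ 2) = (fun=> 1) by apply: funext.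
  by rewrite e in d; have := der_uniq d (derC 1 t); rewrite /= !expr1; lra.
have c'E t : c' t = - s t * (c t * s' t - s t * c' t).
  have -> : - s t * (c t * s' t - s t * c' t) =
    (c t ^+ 2 + s t ^+ 2) * c' t - c t * (c t * c' t + s t * s' t) by ring.
  by rewrite cs1 orth; ring.
have s'E t : s' t = c t * (c t * s' t - s t * c' t).
  have -> : c t * (c t * s' t - s t * c' t) =
    (c t ^+ 2 + s t ^+ 2) * s' t - s t * (c t * c' t + s t * s' t) by ring.
  by rewrite cs1 orth; ring.
pose u t := c t * cos (th t) + s t * sin (th t).
pose v t := s t * cos (th t) - c t * sin (th t).
have u1 t : u t = 1.
  have -> : u t = u 0.
    apply: der_0_cst => z.
    apply: (derE _ (derD (derM (dc z) (dercos (dth z))) (derM (ds z) (dersin (dth z))))).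
    move: (c'E z) (s'E z); set D := c z * s' z - s z * c' z; clearbody D => -> ->; ring.
  by rewrite /u tha ca sa -!expr2.
have v0 t : v t = 0.
  have -> : v t = v 0.
    apply: der_0_cst => z.
    apply: (derE _ (derB (derM (ds z) (dercos (dth z))) (derM (dc z) (dersin (dth z))))).
    move: (c'E z) (s'E z); set D := c z * s' z - s z * c' z; clearbody D => -> ->; ring.
  by rewrite /v tha ca sa; ring.
exists th; split=> // t.
- have -> : c t = u t * cos (th t) - v t * sin (th t).
    transitivity (c t * (cos (th t) ^+ 2 + sin (th t) ^+ 2)); last by rewrite /u /v; ring.
    by rewrite cos2Dsin2 mulr1.
  by rewrite u1 v0; ring.
- have -> : s t = u t * sin (th t) + v t * cos (th t).
    transitivity (s t * (cos (th t) ^+ 2 + sin (th t) ^+ 2)); last by rewrite /u /v; ring.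
    by rewrite cos2Dsin2 mulr1.
  by rewrite u1 v0; ring.
Qed.

End AngleLift.

Section Equilibrium.
Variable R : realType.

Lemma gronwall_zero (E E' : R -> R) (K a b : R) :
  (forall t : R, is_derive t 1 E (E' t)) -> (forall t, 0 <= E t) ->
  (forall t, Num.min a b <= t <= Num.max a b -> `|E' t| <= K * E t) ->
  E a = 0 -> E b = 0.
Proof.
move=> dE E0 h Ea; apply/eqP; rewrite eq_le E0 andbT.
have dexp (k t : R) : is_derive t 1 (fun t => expR (k * t)) (expR (k * t) * k).
  by apply: derexp; apply: (derE _ (derM (derC k t) (derX t))); ring.
case: (leP a b) h => [ab|/ltW ba] h.
  have := @der_ge0_le _ (fun t => - (E t * expR (- K * t)))
    (fun t => - (E' t * expR (- K * t) + E t * (expR (- K * t) * - K))) a b ab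
    (fun t _ => derN (derM (dE t) (dexp (- K) t))) _.
  rewrite Ea mul0r oppr0 => H; have {H} : 0 <= - (E b * expR (- K * b)).
    apply: H => t /andP[at_ tb].
    have -> : - (E' t * expR (- K * t) + E t * (expR (- K * t) * - K)) =
      (K * E t - E' t) * expR (- K * t) by ring.
    rewrite mulr_ge0 ?expR_ge0 // subr_ge0; apply: le_trans (ler_norm _) _.
    by apply: h; rewrite !ltW.
  by rewrite oppr_ge0 pmulr_lle0 // expR_gt0.
have := @der_ge0_le _ (fun t => E t * expR (K * t))
  (fun t => E' t * expR (K * t) + E t * (expR (K * t) * K)) b a ba
  (fun t _ => derM (dE t) (dexp K t)) _.
rewrite Ea mul0r => H; have {H} : E b * expR (K * b) <= 0.
  apply: H => t /andP[at_ tb].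
  have -> : E' t * expR (K * t) + E t * (expR (K * t) * K) =
    (K * E t + E' t) * expR (K * t) by ring.
  rewrite mulr_ge0 ?expR_ge0 //.
  have tab : b <= t <= a by rewrite !ltW.
  by have := h t tab; rewrite ler_norml => /andP[]; lra.
by rewrite pmulr_lle0 // expR_gt0.
Qed.

(** The field is Lipschitz at the equilibrium, so the squared distance [E] satisfies [|E'| <= K E].
    A nonconstant periodic orbit therefore meets no equilibrium. *)
Lemma solution_at_equilibrium (X : polyvf R) (f : R -> R * R) a :
  solution_on X setT f -> vfP X (f a).1 (f a).2 = 0 -> vfQ X (f a).1 (f a).2 = 0 ->
  forall b, f b = f a.
Proof.
move=> sol Pa Qa b; set x0 := (f a).1 in Pa Qa *; set y0 := (f a).2 in Pa Qa *.
have dx t := (sol t Logic.I).1; have dy t := (sol t Logic.I).2.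
pose N t := (f t).1 ^+ 2 + (f t).2 ^+ 2.
have cN : continuous N by apply: der_continuous (fun t => derD (derXn 2 (dx t)) (derXn 2 (dy t))).
have [|z _ hz] := @EVT_max R N (Num.min a b) (Num.max a b) _ (continuous_subspaceT cN).
  by rewrite ge_min le_max lexx.
(* [|u| <= u ^+ 2 + 1] bounds the coordinates without a square root. *)
pose M := N z + 1.
have N0 t : 0 <= N t by rewrite addr_ge0 // sqr_ge0.
have bnd t : Num.min a b <= t <= Num.max a b -> `|(f t).1| <= M /\ `|(f t).2| <= M.
  move=> /hz; have := sqr_ge0 (f t).1; have := sqr_ge0 (f t).2 => h1 h2 h3.
  have le_sq (u : R) : u ^+ 2 <= N z -> `|u| <= M.
    move=> hu; have := sqr_ge0 (`|u| - 1); rewrite sqrrB1 real_normK ?num_real //.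
    rewrite /M; have := normr_ge0 u; lra.
  by split; apply: le_sq; rewrite /N in h3 *; lra.
have [KP KP0 hP] := eval2_lipschitz X.1 M x0 y0.
have [KQ KQ0 hQ] := eval2_lipschitz X.2 M x0 y0.
pose E t := ((f t).1 - x0) ^+ 2 + ((f t).2 - y0) ^+ 2.
pose E' t := 2 * ((f t).1 - x0) * vfP X (f t).1 (f t).2 + 2 * ((f t).2 - y0) * vfQ X (f t).1 (f t).2.
have dE (t : R) : is_derive t 1 E (E' t).
  apply: (derE _ (derD (derXn 2 (derB (dx t) (derC x0 t))) (derXn 2 (derB (dy t) (derC y0 t))))).
  by rewrite /= !expr1 /E'; ring.
have E0 : E b = 0.
  (* The factor 4 is the 2 from differentiating squares times the 2 in
     [a1 (a1 + a2) <= 2 (a1 ^+ 2 + a2 ^+ 2)]. *)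
  apply: (@gronwall_zero E E' (4 * (KP + KQ)) a b dE).
  - by move=> t; rewrite addr_ge0 // sqr_ge0.
  - move=> t /bnd[b1 b2].
    have := hP _ _ b1 b2; have := hQ _ _ b1 b2.
    rewrite -/(vfP X (f t).1 (f t).2) -/(vfQ X (f t).1 (f t).2).
    rewrite -[eval2 X.1 x0 y0]/(vfP X x0 y0) -[eval2 X.2 x0 y0]/(vfQ X x0 y0) Pa Qa !subr0.
    rewrite /E' /E; set u := (f t).1 - x0; set v := (f t).2 - y0.
    set P := vfP X _ _; set Q := vfQ X _ _ => hQ' hP'.
    apply: le_trans (ler_normD _ _) _; rewrite !normrM (ger0_norm (ler0n R 2)).
    rewrite -[u ^+ 2]real_normK ?num_real // -[v ^+ 2]real_normK ?num_real //.
    have := normr_ge0 u; have := normr_ge0 v; have := normr_ge0 P; have := normr_ge0 Q.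
    move: hQ' hP'; set a1 := `|u|; set a2 := `|v|; set a3 := `|P|; set a4 := `|Q|.
    move=> h1 h2 p4 p3 p2 p1.
    have k1 : a1 * a3 <= a1 * (KP * (a1 + a2)) by rewrite ler_wpM2l.
    have k2 : a2 * a4 <= a2 * (KQ * (a1 + a2)) by rewrite ler_wpM2l.
    have s1 : a1 * (a1 + a2) <= 2 * (a1 ^+ 2 + a2 ^+ 2).
      by have := sqr_ge0 (a1 - a2); have := sqr_ge0 a1; have := sqr_ge0 a2; rewrite sqrrB; lra.
    have s2 : a2 * (a1 + a2) <= 2 * (a1 ^+ 2 + a2 ^+ 2).
      by have := sqr_ge0 (a1 - a2); have := sqr_ge0 a1; have := sqr_ge0 a2; rewrite sqrrB; lra.
    have k3 : KP * (a1 * (a1 + a2)) <= KP * (2 * (a1 ^+ 2 + a2 ^+ 2)) by rewrite ler_wpM2l.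
    have k4 : KQ * (a2 * (a1 + a2)) <= KQ * (2 * (a1 ^+ 2 + a2 ^+ 2)) by rewrite ler_wpM2l.
    by lra.
  - by rewrite /E -/x0 -/y0 !subrr expr0n addr0.
move/eqP: E0; rewrite /E paddr_eq0 ?sqr_ge0 // !sqrf_eq0 !subr_eq0 => /andP[/eqP e1 /eqP e2].
by rewrite [LHS]surjective_pairing e1 e2 /x0 /y0 -surjective_pairing.
Qed.

End Equilibrium.

Section PeriodicOrbits.
Variable R : realType.
Variables (p q n m : nat) (Xn Xm : polyvf R).
Hypothesis hyp : hypotheses p q n m Xn Xm.
Implicit Types (t x l th : R).

Notation A := (ratA p q n m Xn Xm).
Notation C := (ratC p q n m Xm).
Notation B := (ratB p q Xn Xm).

Let X := Xn + Xm.
Let p0 : (0 < p)%N. Proof. by case: hyp => [[]]. Qed.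
Let q0 : (0 < q)%N. Proof. by case: hyp => [[]]. Qed.
Let nm : (n < m)%N. Proof. by case: hyp => [[]]. Qed.
Let n0 : (0 < n)%N. Proof. by have := degree_odd hyp; case: n. Qed.
Let m0 : (0 < m)%N. Proof. exact: leq_ltn_trans nm. Qed.

Definition deg_gap : R := m%:R - n%:R.

Lemma deg_gap_gt0 : 0 < deg_gap.
Proof. by rewrite subr_gt0 ltr_nat. Qed.

(* [w = r^(n-m)], where [r = exp l] is the weighted radius. *)
Definition w_of l := expR (- deg_gap * l).
Definition l_of (w : R) := - ln w / deg_gap.

Lemma w_of_gt0 l : 0 < w_of l. Proof. exact: expR_gt0. Qed.

Lemma l_ofK w : 0 < w -> w_of (l_of w) = w.
Proof.
move=> w0; have d0 : deg_gap != 0 by rewrite gt_eqF // deg_gap_gt0.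
by rewrite /w_of /l_of (_ : - deg_gap * _ = ln w) ?lnK //; field.
Qed.

Lemma w_ofK l : l_of (w_of l) = l.
Proof.
have d0 : deg_gap != 0 by rewrite gt_eqF // deg_gap_gt0.
by rewrite /l_of /w_of expRK; field.
Qed.

(** The factor [mu] of the angular motion; its sign is that of [b_m]. *)
Definition ang_speed l th := b_fun p q Xm th * expR l ^+ m.-1 / slope_form p q th.

Lemma ang_speed_sign (l th : R -> R) :
  (forall t, 0 < ang_speed (l t) (th t)) \/ (forall t, ang_speed (l t) (th t) < 0).
Proof.
have pos t : 0 < expR (l t) ^+ m.-1 / slope_form p q (th t).
  by rewrite divr_gt0 ?exprn_gt0 ?expR_gt0 // slope_form_gt0.
by case: (bm_sign hyp) => h; [left|right] => t; rewrite /ang_speed -mulrA;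
  [rewrite mulr_gt0|rewrite pmulr_llt0].
Qed.

(** Turns the factor of degree [m] into that of degree [n]. The predecessors are exact since [n] is
    odd, hence positive. *)
Lemma pow_w l : expR l ^+ m.-1 * w_of l = expR l ^+ n.-1.
Proof.
rewrite /w_of -!expRM_natl -expRD /deg_gap; congr expR.
have -> : m = (m.-1).+1 by rewrite prednK.
have -> : n = (n.-1).+1 by rewrite prednK.
by rewrite /= -!natr1; ring.
Qed.

Lemma field_polar l th :
  vfP X (polar p q l th).1 (polar p q l th).2 = expR (p%:R * l) *
    (expR l ^+ n.-1 * vfP Xn (cos th) (sin th) + expR l ^+ m.-1 * vfP Xm (cos th) (sin th)) /\
  vfQ X (polar p q l th).1 (polar p q l th).2 = expR (q%:R * l) *
    (expR l ^+ n.-1 * vfQ Xn (cos th) (sin th) + expR l ^+ m.-1 * vfQ Xm (cos th) (sin th)).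
Proof.
have [_ [hn hm _ _]] := hyp.
have [Pn Qn] := hn (expR l) (cos th) (sin th).
have [Pm Qm] := hm (expR l) (cos th) (sin th).
have e k s : (0 < s)%N -> (k + s - 1 = k + s.-1)%N by case: s => // s; lia.
rewrite /polar /= !expRM_natl vfPD vfQD Pn Qn Pm Qm !(e _ _ n0) !(e _ _ m0) !exprD.
by split; ring.
Qed.

(* The two left-hand sides are [l'] and [th'] along a trajectory [polar (l t) (th t)]. *)
Lemma field_polar_ode l th : let mu := ang_speed l th in
  let c := cos th in let s := sin th in
  let P := vfP X (polar p q l th).1 (polar p q l th).2 * expR (- p%:R * l) in
  let Q := vfQ X (polar p q l th).1 (polar p q l th).2 * expR (- q%:R * l) in
  (c * P + s * Q) / slope_form p q th = mu * (A th * w_of l + C th) / deg_gap /\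
  (p%:R * c * Q - q%:R * s * P) / slope_form p q th = mu * (1 + B th * w_of l).
Proof.
move=> mu c s P Q.
have [hP hQ] := field_polar l th.
have PE : P = expR l ^+ n.-1 * vfP Xn c s + expR l ^+ m.-1 * vfP Xm c s.
  by rewrite /P hP mulNr expRN mulrAC divff ?mul1r // gt_eqF // expR_gt0.
have QE : Q = expR l ^+ n.-1 * vfQ Xn c s + expR l ^+ m.-1 * vfQ Xm c s.
  by rewrite /Q hQ mulNr expRN mulrAC divff ?mul1r // gt_eqF // expR_gt0.
have D0 : slope_form p q th != 0 by rewrite gt_eqF // slope_form_gt0.
have d0 : deg_gap != 0 by rewrite gt_eqF // deg_gap_gt0.
have b0 := bm_neq0 hyp th.
have an : a_fun n m Xn th = deg_gap * (c * vfP Xn c s + s * vfQ Xn c s) by [].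
have am : a_fun n m Xm th = deg_gap * (c * vfP Xm c s + s * vfQ Xm c s) by [].
have bn : b_fun p q Xn th = p%:R * c * vfQ Xn c s - q%:R * s * vfP Xn c s by [].
have bm : b_fun p q Xm th = p%:R * c * vfQ Xm c s - q%:R * s * vfP Xm c s by [].
rewrite /mu /ang_speed /ratA /ratC /ratB; split.
  have -> : b_fun p q Xm th * expR l ^+ m.-1 / slope_form p q th *
     (a_fun n m Xn th / b_fun p q Xm th * w_of l + a_fun n m Xm th / b_fun p q Xm th) / deg_gap =
     (a_fun n m Xn th * (expR l ^+ m.-1 * w_of l) + a_fun n m Xm th * expR l ^+ m.-1) /
     deg_gap / slope_form p q th by field; rewrite D0 d0 b0.
  by rewrite pow_w an am PE QE; field; rewrite d0 D0.
have -> : b_fun p q Xm th * expR l ^+ m.-1 / slope_form p q th *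
   (1 + b_fun p q Xn th / b_fun p q Xm th * w_of l) =
   (b_fun p q Xm th * expR l ^+ m.-1 + b_fun p q Xn th * (expR l ^+ m.-1 * w_of l)) /
   slope_form p q th by field; rewrite D0 b0.
by rewrite pow_w bn bm PE QE; field.
Qed.

Lemma polar_motion_solution (l th : R -> R) t :
  is_derive t 1 th (ang_speed (l t) (th t) * (1 + B (th t) * w_of (l t))) ->
  is_derive t 1 l (ang_speed (l t) (th t) * (A (th t) * w_of (l t) + C (th t)) / deg_gap) ->
  let z t := polar p q (l t) (th t) in
  is_derive t 1 (fun t => (z t).1) (vfP X (z t).1 (z t).2) /\
  is_derive t 1 (fun t => (z t).2) (vfQ X (z t).1 (z t).2).
Proof.
move=> dth dl z.
have [e1 e2] := field_polar_ode (l t) (th t).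
rewrite -e1 in dl; rewrite -e2 in dth.
have dk (k : R) := derM (derC k t) dl.
have D0 : slope_form p q (th t) != 0 by rewrite gt_eqF // slope_form_gt0.
have P0 : expR (p%:R * l t) != 0 by rewrite gt_eqF // expR_gt0.
have Q0 : expR (q%:R * l t) != 0 by rewrite gt_eqF // expR_gt0.
(* Multiplying the right-hand side by this 1 gives it the [slope_form] denominator of the left-hand
   side. *)
have D1 : (p%:R * cos (th t) ^+ 2 + q%:R * sin (th t) ^+ 2) / slope_form p q (th t) = 1.
  by rewrite divff.
split.
- apply: (derE _ (derM (derexp (dk p%:R)) (dercos dth))).
  set PP := vfP X _ _; set QQ := vfQ X _ _.
  rewrite !mulNr !expRN /=.
  rewrite -[RHS]mulr1 -[X in _ = _ * X]D1; field.
  by rewrite D0 P0 Q0.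
- apply: (derE _ (derM (derexp (dk q%:R)) (dersin dth))).
  set PP := vfP X _ _; set QQ := vfQ X _ _.
  rewrite !mulNr !expRN /=.
  rewrite -[RHS]mulr1 -[X in _ = _ * X]D1; field.
  by rewrite D0 P0 Q0.
Qed.

(** The radius is defined implicitly at each time; dividing it out gives a motion on the unit
    circle, whose angle can be lifted. *)
Lemma solution_polar (f : R -> R * R) : solution_on X setT f -> (forall t, f t != (0, 0)) ->
  exists l th : R -> R, [/\ forall t, f t = polar p q (l t) (th t),
    forall t, is_derive t 1 th (ang_speed (l t) (th t) * (1 + B (th t) * w_of (l t))) &
    forall t, is_derive t 1 l (ang_speed (l t) (th t) * (A (th t) * w_of (l t) + C (th t)) / deg_gap)].
Proof.
move=> sol f0.
have dx t := (sol t Logic.I).1; have dy t := (sol t Logic.I).2.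
pose x t := (f t).1; pose y t := (f t).2.
pose P t := vfP X (x t) (y t); pose Q t := vfQ X (x t) (y t).
have cP : continuous P.
  have [Fx [Fy h]] := eval2_chain X.1.
  exact: der_continuous (fun t => h _ _ _ _ _ (dx t) (dy t)).
have cQ : continuous Q.
  have [Fx [Fy h]] := eval2_chain X.2.
  exact: der_continuous (fun t => h _ _ _ _ _ (dx t) (dy t)).
have /choice[l hl] : forall t, exists l, sphere p q (x t) (y t) l = 1.
  by move=> t; apply: sphere_exists => //; rewrite /x /y -surjective_pairing.
pose ep t := expR (- p%:R * l t); pose eq t := expR (- q%:R * l t).
pose c t := x t * ep t; pose s t := y t * eq t.
pose D t := p%:R * c t ^+ 2 + q%:R * s t ^+ 2.
pose l' t := (c t * (P t * ep t) + s t * (Q t * eq t)) / D t.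
have dl t : is_derive t 1 l (l' t) := radius_der p0 q0 (dx t) (dy t) hl.
have dep t : is_derive t 1 ep (ep t * (- p%:R * l' t)).
  by apply: (derE _ (derexp (derM (derC (- p%:R) t) (dl t)))); rewrite /ep; ring.
have deq t : is_derive t 1 eq (eq t * (- q%:R * l' t)).
  by apply: (derE _ (derexp (derM (derC (- q%:R) t) (dl t)))); rewrite /eq; ring.
have dc t : is_derive t 1 c _ := derM (dx t) (dep t).
have ds t : is_derive t 1 s _ := derM (dy t) (deq t).
have cx : continuous x := der_continuous dx.
have cy : continuous y := der_continuous dy.
have cep := der_continuous dep; have ceq := der_continuous deq.
have cc := der_continuous dc; have cs := der_continuous ds.
have cs1 t : c t ^+ 2 + s t ^+ 2 = 1 := hl t.
have D0 t : D t != 0.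
  have [th0 [e1 e2]] := unit_circle_angle (cs1 t).
  by rewrite /D -e1 -e2 gt_eqF // (slope_form_gt0 p0 q0 th0).
have cl' : continuous l'.
  move=> t; apply: cvgM.
    apply: cvgD; apply: cvgM; [exact: cc| |exact: cs|].
      by apply: cvgM; [exact: cP|exact: cep].
    by apply: cvgM; [exact: cQ|exact: ceq].
  apply: cvgV => //; apply: cvgD; apply: cvgM; try exact: cvg_cst.
    by apply: cvgM; exact: cc.
  by apply: cvgM; exact: cs.
have cc' : continuous (fun t => vfP X (f t).1 (f t).2 * ep t + (f t).1 * (ep t * (- p%:R * l' t))).
  move=> t; apply: cvgD.
    by apply: cvgM; [exact: cP|exact: cep].
  apply: cvgM; first exact: cx.
  apply: cvgM; first exact: cep.
  by apply: cvgM; [exact: cvg_cst|exact: cl'].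
have cs' : continuous (fun t => vfQ X (f t).1 (f t).2 * eq t + (f t).2 * (eq t * (- q%:R * l' t))).
  move=> t; apply: cvgD.
    by apply: cvgM; [exact: cQ|exact: ceq].
  apply: cvgM; first exact: cy.
  apply: cvgM; first exact: ceq.
  by apply: cvgM; [exact: cvg_cst|exact: cl'].
have [th [hc hs dth]] := angle_lift dc ds cc' cs' cs1.
have epK t : expR (p%:R * l t) * ep t = 1.
  by rewrite /ep mulNr expRN divff // gt_eqF // expR_gt0.
have eqK t : expR (q%:R * l t) * eq t = 1.
  by rewrite /eq mulNr expRN divff // gt_eqF // expR_gt0.
have fE t : f t = polar p q (l t) (th t).
  rewrite /polar hc hs [LHS]surjective_pairing; congr pair.
    by rewrite /c mulrCA epK mulr1.
  by rewrite /s mulrCA eqK mulr1.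
have DE t : slope_form p q (th t) = D t by rewrite /slope_form hc hs.
exists l, th; split=> // t.
- have [_ e2] := field_polar_ode (l t) (th t).
  rewrite -e2 -fE hc hs DE; apply: (derE _ (dth t)).
  rewrite -/(x t) -/(y t) -/(P t) -/(Q t) -/(ep t) -/(eq t) -/(c t) -/(s t).
  have -> : x t * (ep t * (- p%:R * l' t)) = - p%:R * l' t * c t by rewrite /c; ring.
  have -> : y t * (eq t * (- q%:R * l' t)) = - q%:R * l' t * s t by rewrite /s; ring.
  rewrite /l' -[LHS]mulr1; move: (D0 t) (cs1 t); rewrite /D.
  move: (P t * ep t) (Q t * eq t) (c t) (s t) => a b u v d0 e.
  (* The relation [c ^+ 2 + s ^+ 2 = 1] turns the radial terms of [c s' - s c'] into the numerator
     of the angular equation. *)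
  have -> : u * (b + - q%:R * ((u * a + v * b) / (p%:R * u ^+ 2 + q%:R * v ^+ 2)) * v) -
    v * (a + - p%:R * ((u * a + v * b) / (p%:R * u ^+ 2 + q%:R * v ^+ 2)) * u) =
    (u ^+ 2 + v ^+ 2) * (p%:R * u * b - q%:R * v * a) / (p%:R * u ^+ 2 + q%:R * v ^+ 2).
    by field.
  by rewrite e; ring.
- have [e1 _] := field_polar_ode (l t) (th t).
  by rewrite -e1 -fE hc hs DE.
Qed.

End PeriodicOrbits.

Section PeriodicOrbitGraph.
Variable R : realType.
Variables (p q n m : nat) (Xn Xm : polyvf R).
Hypothesis hyp : hypotheses p q n m Xn Xm.
Implicit Types (t x l th : R).

Notation A := (ratA p q n m Xn Xm).
Notation C := (ratC p q n m Xm).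
Notation B := (ratB p q Xn Xm).

Let X := Xn + Xm.
Let p0 : (0 < p)%N. Proof. by case: hyp => [[]]. Qed.
Let q0 : (0 < q)%N. Proof. by case: hyp => [[]]. Qed.
Let nm : (n < m)%N. Proof. by case: hyp => [[]]. Qed.

Definition graph_curve (W : R -> R) : set (R * R) :=
  range (fun th => polar p q (l_of n m (W th)) th).

(** Homogeneity with [lambda = 0] kills both components, because [n >= 1] makes the exponents
    positive; and [n] is odd. *)
Lemma origin_equilibrium : vfP X 0 0 = 0 /\ vfQ X 0 0 = 0.
Proof.
have n0 : (0 < n)%N by have := degree_odd hyp; case: (n).
have [_ [/(_ 0 0 0)[Pn Qn] /(_ 0 0 0)[Pm Qm] _ _]] := hyp.
rewrite !mulr0 in Pn Qn Pm Qm; rewrite vfPD vfQD Pn Qn Pm Qm !expr0n.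
have -> : (p + n - 1 == 0)%N = false by apply/eqP; lia.
have -> : (q + n - 1 == 0)%N = false by apply/eqP; lia.
have -> : (p + m - 1 == 0)%N = false by apply/eqP; lia.
have -> : (q + m - 1 == 0)%N = false by apply/eqP; lia.
by rewrite !mul0r addr0.
Qed.

Lemma multiple_period (f : R -> R) c (k : nat) : (forall x, f (x + 2 * pi) = f x) ->
  `|c| = k%:R * (2 * pi) -> forall x, f (x + c) = f x.
Proof.
move=> fT ck; have fabs x : f (x + `|c|) = f x.
  by rewrite ck (@shift_iter R f (2 * pi) 0) ?mulr0 ?addr0 // => u; rewrite addr0.
move=> x; have [c0|c0] := leP 0 c; first by rewrite -[in LHS](ger0_norm c0).
by rewrite -(fabs (x + c)) ltr0_norm // addrK.
Qed.

Lemma scalar_solution_shift c (W : R -> R) :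
  (forall x, A (x + c) = A x) -> (forall x, C (x + c) = C x) -> (forall x, B (x + c) = B x) ->
  scalar_solution A C B W -> scalar_solution A C B (fun x => W (x + c)).
Proof.
move=> Ac Cc Bc [W0 dW sW]; split=> [x|x|]; first exact: W0.
  apply: (derE _ (@der_comp R W (fun x => x + c) x _ _ (dW (x + c)) (derD (derX x) (derC c x)))).
  by rewrite Ac Cc Bc addr0 mulr1.
by case: sW => h; [left|right] => x; rewrite -Bc.
Qed.

Lemma periodic_orbit_graph G : periodic_orbit X G ->
  exists W : R -> R, [/\ scalar_solution A C B W, forall x, W (x + 2 * pi) = W x &
    G = graph_curve W].
Proof.
move=> [f [sol [T T0 fT] [t1 ft1] GE]].
have nonconst t : ~ (vfP X (f t).1 (f t).2 = 0 /\ vfQ X (f t).1 (f t).2 = 0).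
  move=> [e1 e2]; have h := solution_at_equilibrium sol e1 e2.
  by apply: ft1; rewrite (h t1) (h 0).
have f0 t : f t != (0, 0).
  by apply/eqP => e; apply: (nonconst t); rewrite e; exact: origin_equilibrium.
have [l [th [fE dth dl]]] := solution_polar hyp sol f0.
pose w t := w_of n m (l t); pose mu t := ang_speed p q m Xm (l t) (th t).
have lT t : l (t + T) = l t.
  by have := fT t; rewrite !fE => /(polar_inj p0 q0)[].
have wT t : w (t + T) = w t by rewrite /w lT.
have perP t : exists k : nat, `|th (t + T) - th t| = k%:R * (2 * pi).
  by have := fT t; rewrite !fE => /(polar_inj p0 q0)[].
have Bper := ratB_periodic hyp; have Aper := ratA_periodic hyp; have Cper := ratC_periodic hyp.
have per t (g : R -> R) : (forall x, g (x + 2 * pi) = g x) -> g (th (t + T)) = g (th t).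
  move=> gT; have [k hk] := perP t.
  by rewrite -(multiple_period gT hk (th t)) subrKC.
pose c := th T - th 0.
have thT t : th (t + T) = th t + c.
  have bper u : b_fun p q Xm (u + 2 * pi) = b_fun p q Xm u.
    exact: trig_poly_periodic (trig_poly_b _ _ _) u.
  (* The angle increment over a period has derivative 0: it is a multiple of [2 pi] at each time,
     and the angular equation is [2 pi]-periodic in the angle. *)
  have E : th (t + T) - th t = th (0 + T) - th 0; last by rewrite add0r -/c in E; lra.
  apply: (@der_0_cst R (fun t => th (t + T) - th t)) => u.
  have d1 := @der_comp R th (fun t => t + T) u _ _ (dth (u + T)) (derD (derX u) (derC T u)).
  apply: (derE _ (derB d1 (dth u))).
  rewrite lT /ang_speed (per u _ Bper) (per u _ bper) /slope_form.
  rewrite (per u _ (@cos_period R)) (per u _ (@sin_period R)); ring.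
have dmot : polar_motion A C B mu th w.
  split=> t; first exact: dth.
  have d0 : deg_gap R n m != 0 by rewrite gt_eqF // (deg_gap_gt0 hyp).
  apply: (derE _ (derexp (derM (derC (- deg_gap R n m) t) (dl t)))).
  by rewrite /w /mu /w_of; field.
have w0 t : 0 < w t := w_of_gt0 _ _ _.
have mus := ang_speed_sign hyp l th.
have [k hk] := perP 0; rewrite add0r -/c in hk.
have Us : (forall t, 0 < 1 + B (th t) * w t) \/ (forall t, 1 + B (th t) * w t < 0).
  have [|h|h|[t e1 e2]] := no_turning T0 (ratA_continuous hyp) (ratC_continuous hyp)
    (ratB_der hyp) (Phi_sign hyp) mus w0 dmot thT.
  - by move=> t; rewrite wT (per t _ Bper).
  - by left.
  - by right.
  (* The remaining alternative gives [th' = l' = 0], an equilibrium on the orbit. *)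
  exfalso; apply: (nonconst t).
  have := sol t Logic.I => -[s1 s2].
  have zP : vfP X (f t).1 (f t).2 = 0.
    have := dl t; rewrite -/(w t) e2 mulr0 mul0r => dl0.
    have := dth t; rewrite -/(w t) e1 mulr0 => dth0.
    have d := derM (derexp (derM (derC p%:R t) dl0)) (dercos dth0).
    have E : (fun u => (f u).1) = (fun u => expR (p%:R * l u) * cos (th u)).
      by apply: funext => u; rewrite fE.
    by rewrite E in s1; rewrite (der_uniq s1 d); ring.
  split=> //.
  have := dl t; rewrite -/(w t) e2 mulr0 mul0r => dl0.
  have := dth t; rewrite -/(w t) e1 mulr0 => dth0.
  have d := derM (derexp (derM (derC q%:R t) dl0)) (dersin dth0).
  have E : (fun u => (f u).2) = (fun u => expR (q%:R * l u) * sin (th u)).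
    by apply: funext => u; rewrite fE.
  by rewrite E in s2; rewrite (der_uniq s2 d); ring.
have [W [c0 solW Wc wW sth]] := motion_graph T0 dmot w0 mus Us thT wT.
have cpos : 0 < `|c| by rewrite normr_gt0.
have Wabs x : W (x + `|c|) = W x.
  have [cp|cn] := leP 0 c; first by rewrite ger0_norm.
  by rewrite -(Wc (x + `|c|)) ltr0_norm // subrK.
have Babs x : B (x + `|c|) = B x.
  by apply: (multiple_period (k := k)) Bper _ _; rewrite normr_id.
(* [W] and its translate by a full turn are both solutions of period [|c|], so uniqueness identifies
   them: the orbit closes after one turn. *)
have W2 : forall x, W (x + 2 * pi) = W x.
  have E := scalar_solution_unique (ratB_der hyp) (Phi_sign hyp) cpos Babs _ Wabs
    (scalar_solution_shift Aper Cper Bper solW) solW.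
  move=> x; rewrite -[in RHS]E // => y.
  by rewrite addrAC Wabs.
exists W; split=> //; rewrite GE /graph_curve.
apply/seteqP; split=> [_ [t _ <-]|_ [y _ <-]].
  by exists (th t) => //; rewrite -wW (w_ofK hyp) // fE.
have [t ht] := sth y; exists t => //.
by rewrite fE -ht -wW (w_ofK hyp).
Qed.

Lemma graph_unique (W1 W2 : R -> R) :
  scalar_solution A C B W1 -> (forall x, W1 (x + 2 * pi) = W1 x) ->
  scalar_solution A C B W2 -> (forall x, W2 (x + 2 * pi) = W2 x) -> W1 = W2.
Proof.
move=> s1 p1 s2 p2.
apply: (scalar_solution_unique (ratB_der hyp) (Phi_sign hyp) _ (ratB_periodic hyp) p1 p2 s1 s2).
by rewrite mulr_gt0 // pi_gt0.
Qed.

Lemma periodic_orbit_unique G1 G2 : periodic_orbit X G1 -> periodic_orbit X G2 -> G1 = G2.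
Proof.
move=> /periodic_orbit_graph[W1 [s1 t1 ->]] /periodic_orbit_graph[W2 [s2 t2 ->]].
by rewrite (graph_unique s1 t1 s2 t2).
Qed.

End PeriodicOrbitGraph.

(** * Topology of the plane in polar coordinates *)

Section Compactness.
Variable R : realType.

(** The tube lemma for a segment: compactness makes the admissible size of [d] uniform. *)
Lemma uniform_near (P : R -> R -> Prop) (a b : R) :
  (forall x, a <= x <= b -> \forall u \near (x, (0 : R)), P u.1 u.2) ->
  exists2 e : R, 0 < e & forall x d, a <= x <= b -> `|d| < e -> P x d.
Proof.
move=> h.
have /compact_near_coveringP/(_ R (nbhs (0 : R)) (fun d x => P x d)) := @segment_compact R a b.
case=> [x /=|e /= e0 he].
  rewrite in_itv /= => /h; rewrite /prop_near1 => -[[U V] /= [Ux V0] UV].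
  by exists (U, V) => // -[x' d] /= [Ux' Vd]; exact: (UV (x', d)).
exists e => // x d xab de.
by apply: (he d) => //=; rewrite ?in_itv // sub0r normrN.
Qed.

Lemma periodic_bounded (f : R -> R) : continuous f -> (forall x, f (x + 2 * pi) = f x) ->
  exists2 M : R, 0 < M & forall x, `|f x| <= M.
Proof.
move=> cf fT; have cn : continuous (fun x => `|f x|) by move=> x; apply: cvg_norm; exact: cf.
have p0 : 0 <= 2 * pi :> R by rewrite mulr_ge0 // pi_ge0.
have [c _ hc] := EVT_max p0 (continuous_subspaceT cn).
exists (`|f c| + 1) => [|x]; first by rewrite ltr_wpDl.
have [s hs ->] := periodic_representative x fT.
by rewrite (le_trans (hc s _)) ?lerDl // in_itv.
Qed.

Lemma periodic_pos_bounded (f : R -> R) : continuous f -> (forall x, f (x + 2 * pi) = f x) ->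
  (forall x, 0 < f x) -> exists2 e : R, 0 < e & forall x, e <= f x.
Proof.
move=> cf fT f0.
have p0 : 0 <= 2 * pi :> R by rewrite mulr_ge0 // pi_ge0.
have [c _ hc] := EVT_min p0 (continuous_subspaceT cf).
exists (f c) => // x; have [s hs ->] := periodic_representative x fT.
by apply: hc; rewrite in_itv.
Qed.

End Compactness.

Section Pairs.
Variables (R : realType) (T : topologicalType).

Lemma continuous_pair (t0 : T) (f g : T -> R) : {for t0, continuous f} ->
  {for t0, continuous g} -> {for t0, continuous (fun t => (f t, g t))}.
Proof.
move=> cf cg; rewrite /prop_for /continuous_at.
exact: (@cvg_pair _ _ _ (nbhs t0) (nbhs (f t0)) (nbhs (g t0)) _ _ _ f g cf cg).
Qed.

End Pairs.

(** * Polar coordinates as a continuous open map *)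

Section PolarTopology.
Variable R : realType.
Variables p q : nat.
Hypotheses (p0 : (0 < p)%N) (q0 : (0 < q)%N).

Lemma polar_continuous (T : topologicalType) (t0 : T) (l th : T -> R) :
  {for t0, continuous l} -> {for t0, continuous th} ->
  {for t0, continuous (fun t => polar p q (l t) (th t))}.
Proof.
move=> cl cth.
have ce (k : R) : {for t0, continuous (fun t => expR (k * l t))}.
  apply: continuous_comp; last exact: continuous_expR.
  by apply: cvgM; [exact: cvg_cst|exact: cl].
have cc : {for t0, continuous (fun t => cos (th t))}.
  by apply: continuous_comp => //; exact: continuous_cos.
have cs : {for t0, continuous (fun t => sin (th t))}.
  by apply: continuous_comp => //; exact: continuous_sin.
by apply: continuous_pair; apply: cvgM; [exact: ce|exact: cc|exact: ce|exact: cs].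
Qed.

(** A local inverse of [polar] is continuous: the radius is the implicit one and the angle is
    [th0 + asin a], where [a] and [b] are the sine and cosine of the angle measured from [th0]. *)
Lemma open_polar (O : set (R * R)) : open O -> open [set polar p q u.1 u.2 | u in O].
Proof.
move=> oO; rewrite openE => z0 [[l0 th0] O0 /= <-].
set z := polar p q l0 th0.
have /choice[l hl] : forall z : R * R, exists l, z != (0, 0) -> sphere p q z.1 z.2 l = 1.
  move=> [x y]; have [e|ne] := eqVneq (x, y) (0, 0); first by exists 0.
  by have [l hl] := sphere_exists p0 q0 ne; exists l.
have z0n : z != (0, 0) by exact: polar_neq0.
have cx : {for z, continuous (fun u : R * R => u.1)} by exact: cvg_fst.
have cy : {for z, continuous (fun u : R * R => u.2)} by exact: cvg_snd.
have near_neq : \forall u \near z, u != (0, 0).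
  have : open [set u : R * R | u != (0, 0)].
    have -> : [set u : R * R | u != (0, 0)] = ~` [set (0, 0)].
      by apply/seteqP; split=> u /= /eqP.
    apply: closed_openC; exact: accessible_closed_set1 (hausdorff_accessible _) _.
  by rewrite openE => /(_ z z0n).
have near_sph : \forall u \near z, sphere p q u.1 u.2 (l u) = 1.
  by move: near_neq; apply: filterS => u; exact: hl.
have cl : {for z, continuous l} := radius_continuous p0 q0 cx cy near_sph.
have lz : l z = l0.
  apply: (sphere_inj p0 q0 (hl z z0n)); exact: sphere_polar.
pose c (u : R * R) := u.1 * expR (- p%:R * l u).
pose s (u : R * R) := u.2 * expR (- q%:R * l u).
have ce (k : R) : {for z, continuous (fun u => expR (k * l u))}.
  apply: continuous_comp; last exact: continuous_expR.
  by apply: cvgM; [exact: cvg_cst|exact: cl].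
have cc : {for z, continuous c} by apply: cvgM; [exact: cx|exact: ce].
have cs : {for z, continuous s} by apply: cvgM; [exact: cy|exact: ce].
have cz : c z = cos th0.
  by rewrite /c lz /z /polar /= mulrAC mulNr expRN divff ?mul1r // gt_eqF // expR_gt0.
have sz : s z = sin th0.
  by rewrite /s lz /z /polar /= mulrAC mulNr expRN divff ?mul1r // gt_eqF // expR_gt0.
pose a u := s u * cos th0 - c u * sin th0.
pose b u := c u * cos th0 + s u * sin th0.
have ca : {for z, continuous a}.
  by apply: cvgB; apply: cvgM; [exact: cs|exact: cvg_cst|exact: cc|exact: cvg_cst].
have cb : {for z, continuous b}.
  by apply: cvgD; apply: cvgM; [exact: cc|exact: cvg_cst|exact: cs|exact: cvg_cst].
have az : a z = 0 by rewrite /a cz sz; ring.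
have bz : b z = 1 by rewrite /b cz sz -!expr2 cos2Dsin2.
pose th u := th0 + asin (a u).
have asin0 : asin 0 = 0 :> R.
  have := @sinK R 0; rewrite sin0; apply; rewrite in_itv /=.
  by have := @pi_ge0 R; rewrite oppr_le0 => h; rewrite divr_ge0.
have cth : {for z, continuous th}.
  apply: cvgD; first exact: cvg_cst.
  by apply: (continuous_comp ca); apply: continuous_asin; rewrite az; lra.
have thz : th z = th0 by rewrite /th az asin0 addr0.
have near_b : \forall u \near z, 0 < b u.
  apply: (@cvgr_gt R _ (nbhs z) _ b (b z) cb); rewrite bz; lra.
have near_O : \forall u \near z, O (l u, th u).
  have cpair : (fun u => (l u, th u)) u @[u --> z] --> (l z, th z).
    by apply: continuous_pair; [exact: cl|exact: cth].
  apply: cpair; rewrite lz thz; exact: open_nbhs_nbhs.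
have near_all : nbhs z [set u | [/\ sphere p q u.1 u.2 (l u) = 1, 0 < b u & O (l u, th u)]].
  by move: near_sph near_b near_O; apply: filterS3.
move: near_all; apply: filterS => u [h1 h2 h3].
exists (l u, th u) => //=.
have cs1 : c u ^+ 2 + s u ^+ 2 = 1 := h1.
have ab1 : b u ^+ 2 = 1 - a u ^+ 2.
  have : a u ^+ 2 + b u ^+ 2 = (c u ^+ 2 + s u ^+ 2) * (cos th0 ^+ 2 + sin th0 ^+ 2).
    by rewrite /a /b; ring.
  by rewrite cs1 cos2Dsin2; lra.
have a1 : -1 <= a u <= 1.
  rewrite -ler_norml -(@expr_le1 _ 2) // real_normK ?num_real //.
  by have := sqr_ge0 (b u); lra.
have cosa : cos (asin (a u)) = b u.
  by rewrite cos_asin // -ab1 sqrtr_sqr gtr0_norm.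
have sina : sin (asin (a u)) = a u by rewrite asinK // in_itv.
have hc : cos (th u) = c u.
  rewrite /th cosD cosa sina /a /b.
  transitivity (c u * (cos th0 ^+ 2 + sin th0 ^+ 2)); first by ring.
  by rewrite cos2Dsin2 mulr1.
have hs : sin (th u) = s u.
  rewrite /th sinD cosa sina /a /b.
  transitivity (s u * (cos th0 ^+ 2 + sin th0 ^+ 2)); first by ring.
  by rewrite cos2Dsin2 mulr1.
rewrite [RHS]surjective_pairing /polar hc hs /c /s !mulNr !expRN.
by congr pair; rewrite mulrC divfK // gt_eqF // expR_gt0.
Qed.

Lemma open_lt_fun (T : topologicalType) (f g : T -> R) : continuous f -> continuous g ->
  open [set t | f t < g t].
Proof.
move=> cf cg; rewrite openE => t /= ft.
have cfg : {for t, continuous (fun t => g t - f t)} by apply: cvgB; [exact: cg|exact: cf].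
have gf0 : 0 < g t - f t by rewrite subr_gt0.
have : \forall s \near t, 0 < g s - f s by apply: (@cvgr_gt R _ (nbhs t) _ _ _ cfg).
by apply: filterS => s; rewrite subr_gt0.
Qed.

(** The inside [In] and the outside [Out] are disjoint open sets covering the complement of the
    curve; the component of the origin lies in [In], which is bounded. *)
Lemma polar_graph_surrounds (ls : R -> R) : continuous ls ->
  (forall th, ls (th + 2 * pi) = ls th) ->
  surrounds (range (fun th => polar p q (ls th) th)) (0, 0).
Proof.
move=> cls lsT; set G := range _.
have G0 : ~ G (0, 0).
  by move=> [th _ /eqP]; apply/negP; exact: polar_neq0.
split=> //.
have [M M0 hM] := periodic_bounded cls lsT.
have lsper (k : nat) th th' : `|th - th'| = k%:R * (2 * pi) -> ls th = ls th'.
  by move=> e; rewrite -(multiple_period lsT e th') subrKC.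
(* [polar] misses the origin, so the points of weighted radius below [expR (- M)] and the origin
   itself are added. *)
pose In := [set polar p q u.1 u.2 | u in [set u : R * R | u.1 < ls u.2]] `|`
           [set z : R * R | sphere p q z.1 z.2 (- M) < 1].
pose Out := [set polar p q u.1 u.2 | u in [set u : R * R | ls u.2 < u.1]].
have c1 : continuous (fun u : R * R => u.1) by move=> u; exact: cvg_fst.
have c2 : continuous (fun u : R * R => u.2) by move=> u; exact: cvg_snd.
have cls2 : continuous (fun u : R * R => ls u.2).
  by move=> u; apply: continuous_comp; [exact: c2|exact: cls].
have oIn : open In.
  apply: openU; first by apply: open_polar; exact: open_lt_fun.
  apply: open_lt_fun; last by move=> u; exact: cvg_cst.
  by move=> u; apply: sphere_continuous; [exact: c1|exact: c2].
have oOut : open Out by apply: open_polar; exact: open_lt_fun.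
have sphlt l th : sphere p q (polar p q l th).1 (polar p q l th).2 (- M) < 1 -> l < ls th.
  move=> h; have : l < - M.
    rewrite ltNge; apply/negP => /(sphere_nincr p q (polar p q l th).1 (polar p q l th).2).
    by rewrite sphere_polar // leNgt h.
  by have := hM th; rewrite ler_norml => /andP[h1 _] h2; apply: lt_le_trans h2 h1.
have InP l th : In (polar p q l th) -> l < ls th.
  case=> [[[l' th'] /= h /(polar_inj p0 q0)[e [k hk]]]|/sphlt //].
  by rewrite -e (lsper k th th') // distrC.
have cover z : ~ G z -> In z \/ Out z.
  move=> nG; have [->|z0] := eqVneq z (0, 0).
    by left; right; rewrite /= /sphere !mul0r expr0n addr0.
  have [l [th zE]] := polar_surj p0 q0 z0.
  case: (ltgtP l (ls th)) => h.
  - by left; left; exists (l, th).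
  - by right; exists (l, th).
  - by exfalso; apply: nG; rewrite zE h; exists th.
have disj z : In z -> Out z -> False.
  move=> Iz [[l th] /= h zE]; move: Iz; rewrite -zE => /InP.
  by rewrite ltNge (ltW h).
set K := connected_component (~` G) (0, 0).
have KG : K `<=` ~` G by exact: connected_component_sub.
have KIn : K `<=` In.
  (* [In] is open and closed relative to the connected set [K], since [Out] is its complement
     there. *)
  have KE : K `&` In = K.
    apply: (@component_connected _ (~` G) (0, 0)).
    - exists (0, 0); split; first exact: connected_component_refl.
      by right; rewrite /= /sphere !mul0r expr0n addr0.
    - by exists In.
    - exists (~` Out); first exact: open_closedC.
      apply/seteqP; split=> z [Kz h]; split=> //.
        by move=> hO; exact: disj h hO.
      by have [//|/h] := cover z (KG z Kz).
  by rewrite -KE => z [].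
have [E E0 hE] : exists2 E : R, 0 < E & forall z, In z -> `|z| <= E.
  pose k : R := p%:R + q%:R.
  exists (expR (k * M)); first exact: expR_gt0.
  have bnd l th : l <= M -> `|polar p q l th| <= expR (k * M).
    move=> lM; rewrite prod_normE /= ge_max /polar /= !normrM.
    rewrite !(ger0_norm (expR_ge0 _)).
    have b (j : R) : 0 <= j -> j <= k -> expR (j * l) <= expR (k * M).
      move=> j0 jk; rewrite ler_expR; apply: (@le_trans _ _ (j * M)).
        exact: ler_wpM2l.
      by rewrite ler_wpM2r // ltW.
    apply/andP; split.
      apply: (@le_trans _ _ (expR (p%:R * l) * 1)); first by rewrite ler_wpM2l ?expR_ge0 // cos_max.
      by rewrite mulr1 b // /k lerDl.
    apply: (@le_trans _ _ (expR (q%:R * l) * 1)); first by rewrite ler_wpM2l ?expR_ge0 // sin_max.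
    by rewrite mulr1 b // /k lerDr.
  move=> z Iz; have [->|z0] := eqVneq z (0, 0).
    by rewrite normr0 expR_ge0.
  have [l [th zE]] := polar_surj p0 q0 z0.
  rewrite zE in Iz *; apply: bnd; apply: le_trans (ltW (InP _ _ Iz)) _.
  by apply: le_trans (hM th); exact: ler_norm.
exists E; split; first exact: num_real.
by move=> N EN z /KIn/hE h; exact: le_trans h (ltW EN).
Qed.

End PolarTopology.

(** * Solutions near the cycle *)

Section Clamp.
Variable R : realType.
Implicit Types e u v : R.

(* Truncation of [u] to the interval from [-e] to [e]. *)
Definition clamp e u : R := (`|u + e| - `|u - e|) / 2.

Lemma clamp_le e u : 0 <= e -> `|clamp e u| <= e.
Proof.
by move=> e0; rewrite ler_norml /clamp; case: (ger0P (u + e)); case: (ger0P (u - e)); lra.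
Qed.

Lemma clamp_id e u : `|u| <= e -> clamp e u = u.
Proof.
rewrite ler_norml /clamp => /andP[h1 h2].
by rewrite ger0_norm ?ler0_norm; lra.
Qed.

Lemma clamp_lipschitz e u v : 0 <= e -> `|clamp e u - clamp e v| <= `|u - v|.
Proof.
move=> e0; wlog uv : u v / v <= u.
  move=> H; case: (leP v u) => [/H //|/ltW/H h].
  by rewrite distrC [`|u - v|]distrC.
rewrite [leRHS]ger0_norm ?subr_ge0 // ler_norml /clamp.
case: (ger0P (u + e)); case: (ger0P (u - e)); case: (ger0P (v + e)); case: (ger0P (v - e));
by move=> *; apply/andP; split; lra.
Qed.

Lemma clamp_continuous e : continuous (clamp e).
Proof.
move=> u; apply: cvgM; last exact: cvg_cst.
by apply: cvgB; apply: cvg_norm; [apply: cvgD|apply: cvgB]; (exact: cvg_id || exact: cvg_cst).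
Qed.

End Clamp.

Section Gronwall.
Variable R : realType.

(** Proved on the square of [f], which is differentiable where the absolute value need not be. *)
Lemma gronwall (f f' : R -> R) (L a b : R) : 0 <= L ->
  (forall t : R, is_derive t 1 f (f' t)) -> (forall t, `|f' t| <= L * `|f t|) ->
  `|f b| <= `|f a| * expR (L * `|b - a|).
Proof.
move=> L0 df h.
have dexp (k t : R) : is_derive t 1 (fun t => expR (k * t)) (expR (k * t) * k).
  by apply: derexp; apply: (derE _ (derM (derC k t) (derX t))); ring.
have dsq (t : R) : is_derive t 1 (fun t => f t ^+ 2) (2 * f t * f' t).
  by apply: (derE _ (derXn 2 (df t))); rewrite /= expr1.
have bnd t : `|2 * f t * f' t| <= 2 * L * f t ^+ 2.
  rewrite !normrM (ger0_norm (ler0n R 2)) -[f t ^+ 2]real_normK ?num_real // expr2.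
  have := ler_wpM2l (normr_ge0 (f t)) (h t); lra.
have sq : f b ^+ 2 <= f a ^+ 2 * expR (2 * L * `|b - a|).
  case: (leP a b) => [ab|/ltW ba].
    have := @der_ge0_le _ (fun t => - (f t ^+ 2 * expR (- (2 * L) * t)))
      (fun t => - (2 * f t * f' t * expR (- (2 * L) * t) + f t ^+ 2 * (expR (- (2 * L) * t) * - (2 * L))))
      a b ab (fun t _ => derN (derM (dsq t) (dexp (- (2 * L)) t))) _.
    move=> H; have {H} : - (f a ^+ 2 * expR (- (2 * L) * a)) <= - (f b ^+ 2 * expR (- (2 * L) * b)).
      apply: H => t _.
      have -> : - (2 * f t * f' t * expR (- (2 * L) * t) + f t ^+ 2 * (expR (- (2 * L) * t) * - (2 * L))) =
        (2 * L * f t ^+ 2 - 2 * f t * f' t) * expR (- (2 * L) * t) by ring.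
      by rewrite mulr_ge0 ?expR_ge0 // subr_ge0 (le_trans (ler_norm _)).
    rewrite lerN2 => H; rewrite ger0_norm ?subr_ge0 //.
    have -> : 2 * L * (b - a) = - (2 * L) * a + 2 * L * b by ring.
    have -> : f b ^+ 2 = f b ^+ 2 * expR (- (2 * L) * b) * expR (2 * L * b).
      by rewrite -mulrA -expRD (_ : _ + _ = 0) ?expR0 ?mulr1 //; ring.
    by rewrite expRD [leRHS]mulrA ler_wpM2r ?expR_ge0.
  have := @der_ge0_le _ (fun t => f t ^+ 2 * expR (2 * L * t))
    (fun t => 2 * f t * f' t * expR (2 * L * t) + f t ^+ 2 * (expR (2 * L * t) * (2 * L)))
    b a ba (fun t _ => derM (dsq t) (dexp (2 * L) t)) _.
  move=> H; have {H} : f b ^+ 2 * expR (2 * L * b) <= f a ^+ 2 * expR (2 * L * a).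
    apply: H => t _.
    have -> : 2 * f t * f' t * expR (2 * L * t) + f t ^+ 2 * (expR (2 * L * t) * (2 * L)) =
      (2 * L * f t ^+ 2 + 2 * f t * f' t) * expR (2 * L * t) by ring.
    rewrite mulr_ge0 ?expR_ge0 //.
    by have := bnd t; rewrite ler_norml => /andP[]; lra.
  move=> H; rewrite ler0_norm ?subr_le0 //.
  have -> : 2 * L * - (b - a) = 2 * L * a + - (2 * L * b) by ring.
  have -> : f b ^+ 2 = f b ^+ 2 * expR (2 * L * b) * expR (- (2 * L * b)).
    by rewrite -mulrA -expRD (_ : _ + _ = 0) ?expR0 ?mulr1 //; ring.
  by rewrite expRD [leRHS]mulrA ler_wpM2r ?expR_ge0.
have E : expR (2 * L * `|b - a|) = expR (L * `|b - a|) ^+ 2.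
  by rewrite expr2 -expRD; congr expR; ring.
rewrite -ler_sqr ?nnegrE ?mulr_ge0 ?expR_ge0 // exprMn -E.
by rewrite !real_normK ?num_real.
Qed.

End Gronwall.

(** * The clamped scalar equation in a band around the cycle *)

Section Perturbation.
Variable R : realType.
Variables (A C B B' : R -> R).
Hypotheses (cA : continuous A) (cC : continuous C).
Hypothesis dB : forall x : R, is_derive x 1 B (B' x).
Hypotheses (perA : forall x, A (x + 2 * pi) = A x) (perC : forall x, C (x + 2 * pi) = C x)
  (perB : forall x, B (x + 2 * pi) = B x).
Variable W : R -> R.
Hypotheses (solW : scalar_solution A C B W) (perW : forall x, W (x + 2 * pi) = W x).
Implicit Types (x w : R).

Let cB : continuous B. Proof. exact: der_continuous dB. Qed.

Lemma scalar_solution_continuous : continuous W.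
Proof. by case: solW => _ dW _; exact: der_continuous dW. Qed.

Definition scalar_rhs x w : R := - w * (A x * w + C x) / (1 + B x * w).

(** A band of half-width [e] around the cycle on which the scalar equation is uniformly regular. The
    alternative stands outside the quantifiers, so [1 + B w] has one sign on the whole band. *)
Definition strip (e lo hi nu : R) :=
  [/\ [/\ 0 < e, 0 < lo, 0 < hi & 0 < nu],
      forall x w, `|w - W x| <= e -> lo <= w <= hi &
      (forall x w, `|w - W x| <= e -> nu <= 1 + B x * w) \/
      (forall x w, `|w - W x| <= e -> 1 + B x * w <= - nu)].

Lemma strip_exists : exists e lo hi nu, strip e lo hi nu.
Proof.
have cW := scalar_solution_continuous.
have [W0 _ sW] := solW.
have [lo lo0 hlo] := periodic_pos_bounded cW perW W0.
have [hi hi0 hhi] := periodic_bounded cW perW.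
have [b b0 hb] := periodic_bounded cB perB.
pose U x := 1 + B x * W x.
have cU : continuous U.
  by move=> x; apply: cvgD; [exact: cvg_cst|apply: cvgM; [exact: cB|exact: cW]].
have perU x : U (x + 2 * pi) = U x by rewrite /U perB perW.
have [nu nu0 hnu] : exists2 nu, 0 < nu & (forall x, nu <= U x) \/ (forall x, U x <= - nu).
  case: sW => sW.
    by have [nu nu0 h] := periodic_pos_bounded cU perU sW; exists nu => //; left.
  have [|||nu nu0 h] := @periodic_pos_bounded R (fun x => - U x).
  - by move=> x; apply: cvgN; exact: cU.
  - by move=> x; rewrite /= perU.
  - by move=> x; rewrite oppr_gt0; exact: sW.
  by exists nu => //; right => x; have := h x; lra.
(* Half of the lower bounds of [W] and of [|1 + B W|] is given up for the width of the band. *)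
pose e := Num.min (lo / 2) (nu / 2 / b).
have e1 : e <= lo / 2 by rewrite ge_min lexx.
have e2 : b * e <= nu / 2 by rewrite mulrC -ler_pdivlMr // ge_min lexx orbT.
have e0 : 0 < e by rewrite lt_min !divr_gt0.
have dev x w : `|w - W x| <= e -> `|B x * (w - W x)| <= nu / 2.
  by move=> h; rewrite normrM; apply: le_trans e2; rewrite ler_pM.
exists e, (lo / 2), (hi + e), (nu / 2); split.
- by split; rewrite ?divr_gt0 ?addr_gt0.
- move=> x w; rewrite ler_norml => /andP[h1 h2].
  by have := hlo x; have := hhi x; rewrite ler_norml => /andP[_ h3] h4; lra.
- case: hnu => hnu; [left|right] => x w /dev; rewrite ler_norml => /andP[h1 h2];
  by have := hnu x; rewrite /U; lra.
Qed.

Section Strip.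
Variables (e lo hi nu : R).
Hypothesis hs : strip e lo hi nu.

Let e0 : 0 < e. Proof. by case: hs => [[]]. Qed.
Let lo0 : 0 < lo. Proof. by case: hs => [[]]. Qed.
Let hi0 : 0 < hi. Proof. by case: hs => [[]]. Qed.
Let nu0 : 0 < nu. Proof. by case: hs => [[]]. Qed.

Lemma strip_bounds x w : `|w - W x| <= e -> lo <= w <= hi.
Proof. by case: hs => _ h _; exact: h. Qed.

Lemma strip_pos x w : `|w - W x| <= e -> 0 < w.
Proof. by move=> /strip_bounds/andP[h _]; exact: lt_le_trans h. Qed.

Lemma strip_U x w : `|w - W x| <= e -> nu <= `|1 + B x * w|.
Proof.
case: hs => _ _ [] h /h h1; last rewrite -normrN.
  exact: le_trans (ler_norm _).
by apply: le_trans (ler_norm _); lra.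
Qed.

Lemma strip_U_neq0 x w : `|w - W x| <= e -> 1 + B x * w != 0.
Proof. by move=> /strip_U h; rewrite -normr_gt0; exact: lt_le_trans h. Qed.

Lemma strip_center x : `|W x - W x| <= e.
Proof. by rewrite subrr normr0 ltW. Qed.

Lemma clamped_strip x w : `|W x + clamp e (w - W x) - W x| <= e.
Proof. by rewrite addrAC subrr add0r clamp_le // ltW. Qed.

Lemma unclamp x w : `|w - W x| <= e -> W x + clamp e (w - W x) = w.
Proof. by move=> h; rewrite clamp_id // subrKC. Qed.

Lemma scalar_rhs_bounds : exists Bd L, [/\ 0 < L,
  forall x w, `|w - W x| <= e -> `|scalar_rhs x w| <= Bd &
  forall x w1 w2, `|w1 - W x| <= e -> `|w2 - W x| <= e ->
    `|scalar_rhs x w1 - scalar_rhs x w2| <= L * `|w1 - w2|].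
Proof.
have [a a0 ha] := periodic_bounded cA perA.
have [c c0 hc] := periodic_bounded cC perC.
have [b b0 hb] := periodic_bounded cB perB.
pose N x w := - w * (A x * w + C x).
have wle x w : `|w - W x| <= e -> `|w| <= hi.
  by move=> h; have /andP[_ h2] := strip_bounds h; rewrite gtr0_norm // (strip_pos h).
have affine x w : `|w| <= hi -> `|A x * w + C x| <= a * hi + c.
  by move=> h; apply: le_trans (ler_normD _ _) _; rewrite lerD // normrM ler_pM.
have Nle x w : `|w| <= hi -> `|N x w| <= hi * (a * hi + c).
  by move=> h; rewrite normrM normrN ler_pM // affine.
have Uinv x w : `|w - W x| <= e -> `|(1 + B x * w)^-1| <= nu^-1.
  by move=> h; rewrite normfV lef_pV2 ?posrE ?normr_gt0 ?strip_U ?strip_U_neq0.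
exists (hi * (a * hi + c) / nu), ((2 * a * hi + c) / nu + hi * (a * hi + c) * b / nu ^+ 2).
split.
- by rewrite addr_gt0 // divr_gt0 ?exprn_gt0 ?mulr_gt0 ?addr_gt0 ?mulr_gt0.
- by move=> x w h; rewrite normrM ler_pM // ?Uinv // Nle // (wle x).
move=> x w1 w2 h1 h2.
have u1 := strip_U_neq0 h1; have u2 := strip_U_neq0 h2.
(* Separates the change of the numerator from that of the denominator, so that each term has one
   factor [w1 - w2]. *)
have -> : scalar_rhs x w1 - scalar_rhs x w2 =
  - ((w1 - w2) * (A x * (w1 + w2) + C x)) * (1 + B x * w1)^-1
  - N x w2 * (B x * (w1 - w2)) * ((1 + B x * w1)^-1 * (1 + B x * w2)^-1).
  by rewrite /scalar_rhs /N; field; rewrite u1 u2.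
apply: le_trans (ler_normB _ _) _; rewrite [leRHS]mulrDl; apply: lerD.
  rewrite normrM normrN normrM -mulrA [leRHS]mulrC; apply: ler_wpM2l => //.
  apply: ler_pM; rewrite ?Uinv //; apply: le_trans (ler_normD _ _) _; apply: lerD => //.
  have -> : 2 * a * hi = a * (2 * hi) by ring.
  rewrite normrM; apply: ler_pM => //; apply: le_trans (ler_normD _ _) _.
  by have := wle _ _ h1; have := wle _ _ h2; lra.
rewrite !normrM -[leRHS]mulrA.
have -> : hi * (a * hi + c) * b * (nu ^- 2 * `|w1 - w2|) =
  hi * (a * hi + c) * (b * `|w1 - w2|) * (nu^-1 * nu^-1).
  by rewrite expr2 invfM; ring.
apply: ler_pM; rewrite ?mulr_ge0 //.
  apply: ler_pM; rewrite ?mulr_ge0 //.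
    by rewrite -normrM; apply: Nle; apply: wle h2.
  by rewrite ler_wpM2r.
by rewrite ler_pM // Uinv.
Qed.

(** The clamped equation is globally bounded and Lipschitz, so it has solutions for all angles; they
    solve the true equation while they stay in the band. [W] solves both, and Gronwall controls the
    distance to it. *)
Lemma perturbed_solution : exists2 L : R, 0 < L & forall x0 w0, exists y : R -> R,
  [/\ y x0 = w0,
      forall x, is_derive x 1 y (scalar_rhs x (W x + clamp e (y x - W x))) &
      forall x, `|y x - W x| <= `|w0 - W x0| * expR (L * `|x - x0|)].
Proof.
have [Bd [L [L0 hB hL]]] := scalar_rhs_bounds.
have cW := scalar_solution_continuous.
exists L => // x0 w0.
pose F x w := scalar_rhs x (W x + clamp e (w - W x)).
have hF x w1 w2 : `|F x w1 - F x w2| <= L * `|w1 - w2|.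
  apply: le_trans (hL _ _ _ (clamped_strip _ _) (clamped_strip _ _)) _.
  rewrite ler_pM2l // (_ : _ - _ = clamp e (w1 - W x) - clamp e (w2 - W x)); last by ring.
  apply: le_trans (clamp_lipschitz _ _ (ltW e0)) _.
  by rewrite (_ : w1 - W x - (w2 - W x) = w1 - w2) //; ring.
have [|||y [y0 dy]] := @picard R F Bd L x0 w0 L0.
- move=> y cy x; rewrite /F /scalar_rhs.
  have cv : {for x, continuous (fun x => W x + clamp e (y x - W x))}.
    apply: cvgD; first exact: cW.
    apply: (@continuous_comp _ _ _ (fun x => y x - W x) (clamp e)); last exact: clamp_continuous.
    by apply: cvgB; [exact: cy|exact: cW].
  apply: cvgM.
    apply: cvgM; first by apply: cvgN.
    by apply: cvgD; [apply: cvgM; [exact: cA|]|exact: cC].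
  apply: cvgV; first exact: strip_U_neq0 (clamped_strip _ _).
  by apply: cvgD; [exact: cvg_cst|apply: cvgM; [exact: cB|]].
- by move=> x w; apply: hB; exact: clamped_strip.
- exact: hF.
- exists y; split=> // x; rewrite -y0.
  have [_ dW _] := solW.
  apply: (@gronwall R (fun x => y x - W x) (fun x => F x (y x) - F x (W x)) L x0 x (ltW L0)).
    move=> t; apply: (derE _ (derB (dy t) (dW t))).
    by congr (_ - _); rewrite /F unclamp // strip_center.
  by move=> t; exact: hF.
Qed.

End Strip.
End Perturbation.
Arguments strip_U {R B W e lo hi nu} _ {x w}.
Arguments strip_U_neq0 {R B W e lo hi nu} _ {x w}.
Arguments strip_bounds {R B W e lo hi nu} _ {x w}.
Arguments strip_pos {R B W e lo hi nu} _ {x w}.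

Section QuadraticRemainder.
Variable R : realType.

(** Gives the derivative of the return map at its fixed point from an estimate at that point
    alone. *)
Lemma der_quadratic (f : R -> R) (a l M rho : R) : 0 < rho ->
  (forall x, `|x - a| < rho -> `|f x - f a - l * (x - a)| <= M * (x - a) ^+ 2) ->
  is_derive a 1 f l.
Proof.
move=> rho0 h; apply/is_derive1_caratheodory.
exists (fun x => if x == a then l else (f x - f a) / (x - a)); split.
- move=> z; case: eqVneq => [->|za]; first by rewrite !subrr mulr0.
  by rewrite divfK // subr_eq0.
- apply/cvgrPdist_lt => e e0; rewrite eqxx.
  pose r := Num.min rho (e / (`|M| + 1)).
  have M1 : 0 < `|M| + 1 by rewrite ltr_wpDl.
  have r0 : 0 < r by rewrite lt_min rho0 divr_gt0.
  apply/nbhs_ballP; exists r => // x; rewrite /ball /= distrC => xr.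
  case: eqVneq => [_|xa]; first by rewrite subrr normr0.
  have xrho : `|x - a| < rho by apply: lt_le_trans xr _; rewrite ge_min lexx.
  have xe : `|x - a| * (`|M| + 1) < e.
    by rewrite -ltr_pdivlMr //; apply: lt_le_trans xr _; rewrite ge_min lexx orbT.
  have xa0 : x - a != 0 by rewrite subr_eq0.
  have -> : l - (f x - f a) / (x - a) = - (f x - f a - l * (x - a)) / (x - a) by field.
  rewrite normrM normrN normfV ltr_pdivrMr ?normr_gt0 //.
  apply: le_lt_trans (h x xrho) _; rewrite -real_normK ?num_real // expr2 mulrA.
  rewrite ltr_pM2r ?normr_gt0 //; apply: le_lt_trans xe.
  by rewrite mulrC ler_wpM2l // (le_trans (ler_norm M)) // lerDl.
- by rewrite eqxx.
Qed.

End QuadraticRemainder.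

Section TimeChange.
Variable R : realType.

(** The autonomous equation is solved by quadrature: [phi] inverts a primitive [tau] of [1 / v], and
    the bound [V] makes [tau] onto the line. *)
Lemma time_change (v : R -> R) (V x0 : R) : continuous v ->
  (forall x, 0 < v x) \/ (forall x, v x < 0) -> (forall x, `|v x| <= V) ->
  exists phi tau : R -> R, [/\ cancel phi tau, cancel tau phi, phi 0 = x0,
    forall t : R, is_derive t 1 phi (v (phi t)) &
    forall x : R, is_derive x 1 tau (v x)^-1].
Proof.
move=> cv sv vV; have v0 := const_sign_neq0 sv.
have V0 : 0 < V by apply: lt_le_trans (vV 0); rewrite normr_gt0.
have [tau0 dtau0] : exists tau0 : R -> R, forall x : R, is_derive x 1 tau0 (v x)^-1.
  by apply: antiderivative => x; apply: cvgV => //; exact: cv.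
pose tau x := tau0 x - tau0 x0.
have dtau (x : R) : is_derive x 1 tau (v x)^-1.
  by apply: (derE _ (derB (dtau0 x) (derC (tau0 x0) x))); rewrite subr0.
have tau00 : tau x0 = 0 by rewrite /tau subrr.
have sv' : (forall x, 0 < (v x)^-1) \/ (forall x, (v x)^-1 < 0).
  by case: sv => h; [left|right] => x; rewrite ?invr_gt0 ?invr_lt0.
have ctau := der_continuous dtau.
have inc (a b : R) : a < b -> V^-1 * (b - a) <= `|tau b - tau a| /\
    ((forall x, 0 < v x) -> 0 < tau b - tau a) /\ ((forall x, v x < 0) -> tau b - tau a < 0).
  move=> ab; have [c _ ->] := mvt ab (fun x _ => dtau x).
  have ba : 0 < b - a by rewrite subr_gt0.
  split; [|split] => [|h|h].
  - rewrite normrM (gtr0_norm ba) ler_pM2r // normfV lef_pV2 ?posrE ?normr_gt0 //.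
  - by rewrite mulr_gt0 // invr_gt0.
  - by rewrite pmulr_llt0 // invr_lt0.
have stau y : exists x, tau x = y.
  pose D := V * (`|y| + 1).
  have D0 : 0 < D by rewrite mulr_gt0 // ltr_wpDl.
  have DV : V^-1 * D = `|y| + 1 by rewrite /D mulKf // gt_eqF.
  have [] := inc (x0 - D) x0; first by rewrite gtrBl.
  rewrite subKr DV tau00 sub0r normrN => h1 s1.
  have [] := inc x0 (x0 + D); first by rewrite ltrDl.
  rewrite [x0 + D]addrC addrK DV tau00 subr0 => h2 s2.
  have := ler_norm y; have := ler_norm (- y); rewrite normrN => n1 n2.
  have [||x _ e] := @ivt R tau (x0 - D) (D + x0) y ctau; last by exists x.
    by rewrite lerBlDr addrAC lerDr addr_ge0 // ltW.
  case: sv => h; [left|right].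
    have p1 := s1.1 h; have p2 := s2.1 h; rewrite oppr_gt0 in p1.
    by rewrite (gtr0_norm p2) in h2; rewrite (ltr0_norm p1) in h1; lra.
  have p1 := s1.2 h; have p2 := s2.2 h; rewrite oppr_lt0 in p1.
  by rewrite (ltr0_norm p2) in h2; rewrite (gtr0_norm p1) in h1; lra.
have [phi [pK tK dphi]] := der_neq0_inverse dtau sv' stau.
exists phi, tau; split=> //.
- by rewrite -tau00 tK.
- by move=> t; apply: (derE _ (dphi t)); rewrite invrK.
Qed.

End TimeChange.

(** * The gap between a solution and the cycle *)

Section Gap.
Variable R : realType.
Variables (A C B B' : R -> R).
Hypotheses (cA : continuous A) (cC : continuous C) (cB' : continuous B').
Hypothesis dB : forall x : R, is_derive x 1 B (B' x).
Hypotheses (perA : forall x, A (x + 2 * pi) = A x) (perC : forall x, C (x + 2 * pi) = C x)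
  (perB : forall x, B (x + 2 * pi) = B x) (perB' : forall x, B' (x + 2 * pi) = B' x).
Variable W : R -> R.
Hypotheses (solW : scalar_solution A C B W) (perW : forall x, W (x + 2 * pi) = W x).
Variables (e lo hi nu : R).
Hypothesis hs : strip B W e lo hi nu.
Implicit Types (x w : R).

Let cB : continuous B. Proof. exact: der_continuous dB. Qed.
Let e0 : 0 < e. Proof. by case: hs => [[]]. Qed.
Let lo0 : 0 < lo. Proof. by case: hs => [[]]. Qed.
Let hi0 : 0 < hi. Proof. by case: hs => [[]]. Qed.
Let nu0 : 0 < nu. Proof. by case: hs => [[]]. Qed.
Let W0 x : 0 < W x. Proof. by case: solW. Qed.

Definition gap x w : R := ln w - ln (W x) + B x * (w - W x).
(** Reciprocal of the slope of [gap x] at [W x]. *)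
Definition inv_speed x : R := W x / (1 + B x * W x).

Lemma gap_mvt x w : `|w - W x| <= e ->
  exists z : R, [/\ `|z - W x| <= `|w - W x|, `|z - W x| <= e & gap x w = (1 + B x * z) / z * (w - W x)].
Proof.
move=> h; have w0 := strip_pos hs h.
have [z zb zE] := ln_affine_mvt (B x) (W0 x) w0.
suff zw : `|z - W x| <= `|w - W x| by exists z; split=> //; exact: le_trans h.
move: zb; case: (leP (W x) w) => hw /andP[z1 z2].
  by rewrite !ger0_norm ?subr_ge0 // lerB.
by have hw' := ltW hw; rewrite !ler0_norm ?subr_le0 //; lra.
Qed.

(** Together with [gap_ge]: on the band the gap is comparable to the deviation, with constants that
    bound [|1 + B z| / z]. *)
Lemma gap_le : exists2 K : R, 0 < K & forall x w, `|w - W x| <= e -> `|gap x w| <= K * `|w - W x|.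
Proof.
have [b b0 hb] := periodic_bounded cB perB.
exists ((1 + b * hi) / lo) => [|x w h].
  by rewrite divr_gt0 // addr_gt0 // mulr_gt0.
have [z [_ ze ->]] := gap_mvt h; rewrite normrM ler_wpM2r //.
have z0 := strip_pos hs ze; have /andP[z1 z2] := strip_bounds hs ze.
rewrite normrM; apply: ler_pM => //.
  apply: le_trans (ler_normD _ _) _; rewrite normr1 lerD2l normrM.
  by apply: ler_pM => //; rewrite gtr0_norm.
by rewrite normfV gtr0_norm // lef_pV2 ?posrE.
Qed.

Lemma gap_ge x w : `|w - W x| <= e -> nu / hi * `|w - W x| <= `|gap x w|.
Proof.
move=> h; have [z [_ ze ->]] := gap_mvt h; rewrite normrM ler_wpM2r //.
have z0 := strip_pos hs ze; have /andP[z1 z2] := strip_bounds hs ze.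
have u := strip_U hs ze.
have i : hi^-1 <= `|z^-1| by rewrite normfV gtr0_norm // lef_pV2 ?posrE.
have hi'0 : 0 <= hi^-1 by rewrite invr_ge0 ltW.
by have := ler_pM (ltW nu0) hi'0 u i; rewrite -normrM.
Qed.

Lemma gap_expansion x w : `|w - W x| <= e ->
  `|(w - W x) - inv_speed x * gap x w| <= (lo * nu)^-1 * (w - W x) ^+ 2.
Proof.
move=> h; have [z [zw ze ->]] := gap_mvt h.
have z0 := strip_pos hs ze; have /andP[z1 z2] := strip_bounds hs ze.
have U0 := strip_U_neq0 hs (strip_center hs x).
have -> : (w - W x) - inv_speed x * ((1 + B x * z) / z * (w - W x)) =
  (z^-1 * (1 + B x * W x)^-1) * ((z - W x) * (w - W x)).
  by rewrite /inv_speed; field; rewrite U0 gt_eqF.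
rewrite -[(w - W x) ^+ 2]real_normK ?num_real // expr2 normrM invfM.
apply: ler_pM => //.
  rewrite normrM; apply: ler_pM => //.
    by rewrite normfV gtr0_norm // lef_pV2 ?posrE.
  by rewrite normfV lef_pV2 ?posrE ?normr_gt0 // (strip_U hs (strip_center hs x)).
by rewrite normrM ler_wpM2r.
Qed.

Lemma der_gap (y : R -> R) x : `|y x - W x| <= e ->
  is_derive x 1 y (scalar_rhs A C B x (W x + clamp e (y x - W x))) ->
  is_derive x 1 (fun x => gap x (y x)) (- (A x - B' x) * (y x - W x)).
Proof.
move=> h dy; rewrite (unclamp h) in dy.
have [_ dW _] := solW.
rewrite /scalar_rhs in dy; rewrite /gap.
have y0 := strip_pos hs h.
have u1 := strip_U_neq0 hs (strip_center hs x); have u2 := strip_U_neq0 hs h.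
exact: (der_ln_affine_gap dB (W0 x) y0 u1 u2 (dW x) dy).
Qed.

(* [gap x (y x) * expR (- Q x)] is constant up to the square of the initial
   deviation, because the gap is the deviation divided by [inv_speed], to first order. *)
Lemma return_expansion (L x1 : R) (Q : R -> R) : 0 < L -> W x1 = W 0 -> B x1 = B 0 ->
  (forall x, is_derive x 1 Q (- (A x - B' x) * inv_speed x)) ->
  exists M rho, 0 < rho /\ forall w (y : R -> R), `|w - W 0| < rho ->
    (forall x, is_derive x 1 y (scalar_rhs A C B x (W x + clamp e (y x - W x)))) ->
    (forall x, `|y x - W x| <= `|w - W 0| * expR (L * `|x - 0|)) -> y 0 = w ->
    `|y x1 - W x1 - expR (Q x1 - Q 0) * (w - W 0)| <= M * (w - W 0) ^+ 2.
Proof.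
move=> L0 Wx1 Bx1 dQ.
have cPhi : continuous (fun x => A x - B' x) by move=> x; apply: cvgB; [exact: cA|exact: cB'].
have perPhi x : A (x + 2 * pi) - B' (x + 2 * pi) = A x - B' x by rewrite perA perB'.
have [F F0 hF] := periodic_bounded cPhi perPhi.
have cQ := der_continuous dQ.
have cE : continuous (fun x => expR (- Q x)).
  by move=> x; apply: continuous_comp; [apply: cvgN; exact: cQ|exact: continuous_expR].
have mm : Num.min 0 x1 <= Num.max 0 x1 by rewrite ge_min le_max lexx.
have [c _ hc] := EVT_max mm (continuous_subspaceT cE).
pose S := expR (L * `|x1|); have S0 : 0 < S := expR_gt0 _.
pose E := expR (- Q c); have E0 : 0 < E := expR_gt0 _.
pose K := (lo * nu)^-1; have K0 : 0 < K by rewrite invr_gt0 mulr_gt0.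
pose M1 := F * E * K * S ^+ 2.
(* One term for each of three errors: the expansion of the gap at the end of the turn, the drift of
   [h] along it, and the expansion at its start. *)
pose M := K * S ^+ 2 + `|inv_speed 0| * expR (Q x1) * (M1 * `|x1|) + expR (Q x1 - Q 0) * K.
(* [S] bounds the growth of deviations during the turn, so smaller initial deviations stay in the
   band. *)
exists M, (e / S); split; first by rewrite divr_gt0.
move=> w y wr dy hy y0.
have inI x : Num.min 0 x1 <= x <= Num.max 0 x1 -> `|x| <= `|x1|.
  by case: (leP 0 x1) => h /andP[h1 h2]; [rewrite !ger0_norm|rewrite !ler0_norm]; lra.
have dS x : Num.min 0 x1 <= x <= Num.max 0 x1 -> `|y x - W x| <= `|w - W 0| * S.
  move=> /inI h; apply: le_trans (hy x) _; rewrite ler_wpM2l // ler_expR subr0.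
  by rewrite ler_pM2l.
have de x : Num.min 0 x1 <= x <= Num.max 0 x1 -> `|y x - W x| <= e.
  by move=> /dS h; apply: le_trans h _; rewrite -ler_pdivlMr // ltW.
have I0 : Num.min 0 x1 <= 0 <= Num.max 0 x1 by rewrite ge_min le_max lexx.
have I1 : Num.min 0 x1 <= x1 <= Num.max 0 x1 by rewrite ge_min le_max lexx !orbT.
pose g x := gap x (y x).
pose h x := g x * expR (- Q x).
pose h' x := - (A x - B' x) * expR (- Q x) * ((y x - W x) - inv_speed x * g x).
have dh x : Num.min 0 x1 <= x <= Num.max 0 x1 -> is_derive x 1 h (h' x).
  move=> xI; apply: (derE _ (derM (der_gap (de x xI) (dy x)) (derexp (derN (dQ x))))).
  by rewrite /h' /g; ring.
have h'le x : Num.min 0 x1 <= x <= Num.max 0 x1 -> `|h' x| <= M1 * (w - W 0) ^+ 2.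
  move=> xI; rewrite /h' normrM normrM normrN.
  have -> : M1 * (w - W 0) ^+ 2 = F * E * (K * (`|w - W 0| * S) ^+ 2).
    by rewrite /M1 exprMn real_normK ?num_real //; ring.
  apply: ler_pM; rewrite ?mulr_ge0 //.
    by apply: ler_pM => //; rewrite ger0_norm ?expR_ge0 // hc // in_itv.
  apply: le_trans (gap_expansion (de x xI)) _; rewrite ler_wpM2l ?(ltW K0) //.
  by rewrite -[(y x - W x) ^+ 2]real_normK ?num_real // ler_sqr ?nnegrE ?mulr_ge0 ?(ltW S0) // dS.
have hh := der_lipschitz dh h'le.
rewrite subr0 in hh.
have ex0 := gap_expansion (de 0 I0); have ex1 := gap_expansion (de x1 I1).
rewrite y0 -/K in ex0; rewrite -/K in ex1.
have q1 : inv_speed x1 = inv_speed 0 by rewrite /inv_speed Wx1 Bx1.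
have g0 : gap 0 w = h 0 * expR (Q 0).
  by rewrite /h /g y0 -mulrA -expRD addNr expR0 mulr1.
have g1 : gap x1 (y x1) = h x1 * expR (Q x1).
  by rewrite /h /g -mulrA -expRD addNr expR0 mulr1.
have -> : y x1 - W x1 - expR (Q x1 - Q 0) * (w - W 0) =
  ((y x1 - W x1) - inv_speed x1 * gap x1 (y x1)) +
  inv_speed 0 * expR (Q x1) * (h x1 - h 0) -
  expR (Q x1 - Q 0) * ((w - W 0) - inv_speed 0 * gap 0 w).
  have E1 : expR (Q x1) = expR (Q x1 - Q 0) * expR (Q 0) by rewrite -expRD subrK.
  by rewrite q1 g0 g1 E1; ring.
rewrite /M mulrDl; apply: le_trans (ler_normB _ _) _; apply: lerD; last first.
  by rewrite normrM ger0_norm ?expR_ge0 // -mulrA ler_wpM2l ?expR_ge0.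
rewrite mulrDl; apply: le_trans (ler_normD _ _) _; apply: lerD.
  apply: le_trans ex1 _; rewrite -mulrA ler_wpM2l ?(ltW K0) // mulrC -exprMn_comm //; last first.
    exact: mulrC.
  rewrite -real_normK ?num_real // -[X in _ <= X]real_normK ?num_real //.
  by rewrite ler_sqr ?nnegrE // normrM [`|S|]gtr0_norm // dS.
rewrite normrM normrM (ger0_norm (expR_ge0 (Q x1))) -[leRHS]mulrA.
apply: ler_wpM2l; first by rewrite mulr_ge0 ?expR_ge0.
by apply: le_trans hh _; apply: le_of_eq; ring.
Qed.

End Gap.

Section FlowNearCycle.
Variable R : realType.
Variables (p q n m : nat) (Xn Xm : polyvf R).
Hypothesis hyp : hypotheses p q n m Xn Xm.
Implicit Types (t x l th w : R).

Notation A := (ratA p q n m Xn Xm).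
Notation C := (ratC p q n m Xm).
Notation B := (ratB p q Xn Xm).

Let X := Xn + Xm.
Let p0 : (0 < p)%N. Proof. by case: hyp => [[]]. Qed.
Let q0 : (0 < q)%N. Proof. by case: hyp => [[]]. Qed.
Let d0 : deg_gap R n m != 0. Proof. by rewrite gt_eqF // (deg_gap_gt0 hyp). Qed.

Definition speed x w : R := ang_speed p q m Xm (l_of n m w) x * (1 + B x * w).

Lemma l_of_continuous (T : topologicalType) (t0 : T) (w : T -> R) :
  {for t0, continuous w} -> 0 < w t0 -> {for t0, continuous (fun s : T => l_of n m (w s))}.
Proof.
move=> cw w0; apply: cvgM; last exact: cvg_cst.
by apply: cvgN; apply: (continuous_comp cw); exact: continuous_ln.
Qed.

Lemma speed_continuous (T : topologicalType) (t0 : T) (x w : T -> R) :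
  {for t0, continuous x} -> {for t0, continuous w} -> 0 < w t0 ->
  {for t0, continuous (fun s : T => speed (x s) (w s))}.
Proof.
move=> cx cw w0; have cl := l_of_continuous cw w0.
have cpow (k : nat) (f : R -> R) : continuous f -> {for t0, continuous (fun s : T => f (x s) ^+ k)}.
  move=> cf; apply: (@continuous_comp _ _ _ (fun s : T => f (x s)) (fun u : R => u ^+ k)).
    by apply: (continuous_comp cx); exact: cf.
  exact: exprn_continuous.
apply: cvgM; last first.
  apply: cvgD; first exact: cvg_cst.
  by apply: cvgM => //; apply: (continuous_comp cx); exact: der_cont (ratB_der hyp _).
apply: cvgM.
  apply: cvgM.
    by apply: (continuous_comp cx); exact: trig_poly_continuous (trig_poly_b p q Xm) _.
  apply: (@continuous_comp _ _ _ (fun s : T => expR (l_of n m (w s))) (fun u : R => u ^+ m.-1)).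
    by apply: (continuous_comp cl); exact: continuous_expR.
  exact: exprn_continuous.
apply: cvgV; first by rewrite gt_eqF // slope_form_gt0.
apply: cvgD; apply: cvgM; try exact: cvg_cst.
  exact: cpow (@continuous_cos R).
exact: cpow (@continuous_sin R).
Qed.

Lemma ang_speed_pos_bm l th : exists2 k, 0 < k & ang_speed p q m Xm l th = b_fun p q Xm th * k.
Proof.
exists (expR l ^+ m.-1 / slope_form p q th); last by rewrite /ang_speed mulrA.
by rewrite divr_gt0 ?exprn_gt0 ?expR_gt0 // slope_form_gt0.
Qed.

Variable W : R -> R.
Hypotheses (solW : scalar_solution A C B W) (perW : forall x, W (x + 2 * pi) = W x).
Variables (e lo hi nu : R).
Hypothesis hs : strip B W e lo hi nu.

Let e0 : 0 < e. Proof. by case: hs => [[]]. Qed.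
Let lo0 : 0 < lo. Proof. by case: hs => [[]]. Qed.
Let hi0 : 0 < hi. Proof. by case: hs => [[]]. Qed.
Let nu0 : 0 < nu. Proof. by case: hs => [[]]. Qed.
Let cW : continuous W. Proof. exact: scalar_solution_continuous solW. Qed.

Lemma speed_sign : (forall x w, `|w - W x| <= e -> 0 < speed x w) \/
  (forall x w, `|w - W x| <= e -> speed x w < 0).
Proof.
have [_ _ hU] := hs.
case: (bm_sign hyp) hU => hb [] hU; [left|right|right|left] => x w /hU h;
have [k k0 kE] := ang_speed_pos_bm (l_of n m w) x; rewrite /speed kE.
- by rewrite mulr_gt0 ?mulr_gt0 // (lt_le_trans nu0).
- rewrite pmulr_rlt0 ?mulr_gt0 //; apply: le_lt_trans h _; by rewrite oppr_lt0.
- rewrite nmulr_rlt0 ?(lt_le_trans nu0) //; by rewrite pmulr_llt0.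
- rewrite nmulr_rgt0; last by rewrite pmulr_llt0.
  by apply: le_lt_trans h _; rewrite oppr_lt0.
Qed.

Lemma speed_neq0 x w : `|w - W x| <= e -> speed x w != 0.
Proof.
by move=> h; case: speed_sign => sg; [rewrite gt_eqF|rewrite lt_eqF] => //; exact: sg.
Qed.

Lemma speed_bounded : exists V : R, forall x w, `|w - W x| <= e -> `|speed x w| <= V.
Proof.
have [b b0 hb] := periodic_bounded (der_continuous (ratB_der hyp)) (ratB_periodic hyp).
have tb := trig_poly_b p q Xm.
have [bb bb0 hbb] := periodic_bounded (trig_poly_continuous tb) (trig_poly_periodic tb).
exists (bb * expR (l_of n m lo) ^+ m.-1 * (1 + b * hi)) => x w h.
have /andP[w1 w2] := strip_bounds hs h; have w0 := strip_pos hs h.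
have sl : 1 <= slope_form p q x.
  have p1 : 1 <= p%:R :> R by rewrite ler1n.
  have q1 : 1 <= q%:R :> R by rewrite ler1n.
  have := cos2Dsin2 x; have := sqr_ge0 (cos x); have := sqr_ge0 (sin x).
  by rewrite /slope_form; nra.
rewrite /speed /ang_speed normrM; apply: ler_pM => //.
  rewrite normrM normrM -[leRHS]mulr1; apply: ler_pM; rewrite ?mulr_ge0 //.
    apply: ler_pM => //; rewrite ger0_norm ?exprn_ge0 ?expR_ge0 //.
    rewrite lerXn2r ?nnegrE ?expR_ge0 // ler_expR /l_of.
    rewrite ler_pM2r ?invr_gt0 ?(deg_gap_gt0 hyp) // lerN2 ler_ln ?posrE //.
  by rewrite normfV ger0_norm ?(le_trans _ sl) // invf_le1 // (lt_le_trans _ sl).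
apply: le_trans (ler_normD _ _) _; rewrite normr1 lerD2l normrM.
by apply: ler_pM => //; rewrite gtr0_norm.
Qed.

Definition clamped (y : R -> R) x : R := W x + clamp e (y x - W x).

Definition flow_point (y phi : R -> R) t : R * R := polar p q (l_of n m (y (phi t))) (phi t).

(** A trajectory split into its graph [y] over the angle and its time law [phi], with inverse [tau].
    Both are global thanks to the clamping, whence the band condition in the last clause. *)
Definition flow_line (L x0 w0 : R) (y phi tau : R -> R) :=
  [/\ [/\ y x0 = w0,
      forall x, is_derive x 1 y (scalar_rhs A C B x (clamped y x)) &
      forall x, `|y x - W x| <= `|w0 - W x0| * expR (L * `|x - x0|)],
    [/\ cancel phi tau, cancel tau phi & phi 0 = x0],
    [/\ forall t, is_derive t 1 phi (speed (phi t) (clamped y (phi t))) &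
    forall x, is_derive x 1 tau (speed x (clamped y x))^-1] &
    forall t, `|y (phi t) - W (phi t)| <= e ->
      is_derive t 1 (fun t => (flow_point y phi t).1)
        (vfP X (flow_point y phi t).1 (flow_point y phi t).2) /\
      is_derive t 1 (fun t => (flow_point y phi t).2)
        (vfQ X (flow_point y phi t).1 (flow_point y phi t).2)].

Lemma clampedE (y : R -> R) x : `|y x - W x| <= e -> clamped y x = y x.
Proof. exact: unclamp. Qed.

Lemma clamped_in_strip (y : R -> R) x : `|clamped y x - W x| <= e.
Proof. exact: clamped_strip hs _ _. Qed.

Lemma flow_lines_exist : exists2 L : R, 0 < L &
  forall x0 w0, exists y phi tau, flow_line L x0 w0 y phi tau.
Proof.
have [L L0 hL] := perturbed_solution (ratA_continuous hyp) (ratC_continuous hyp)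
  (ratB_der hyp) (ratA_periodic hyp) (ratC_periodic hyp) (ratB_periodic hyp) solW hs.
have [V hV] := speed_bounded.
exists L => // x0 w0; have [y [y0 dy hy]] := hL x0 w0.
have cy := der_continuous dy.
have cv : continuous (fun x => speed x (clamped y x)).
  move=> x; apply: speed_continuous; first exact: cvg_id.
    apply: cvgD; first exact: cW.
    apply: (@continuous_comp _ _ _ (fun x => y x - W x) (clamp e)); last exact: clamp_continuous.
    by apply: cvgB; [exact: cy|exact: cW].
  have h := clamped_in_strip y x.
  exact (@strip_pos R B W e lo hi nu hs x (clamped y x) h).
have sv : (forall x, 0 < speed x (clamped y x)) \/ (forall x, speed x (clamped y x) < 0).
  by case: speed_sign => h; [left|right] => x; apply: h; exact: clamped_in_strip.
have vV x : `|speed x (clamped y x)| <= V by apply: hV; exact: clamped_in_strip.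
have [phi [tau [pK tK ph0 dphi dtau]]] := time_change x0 cv sv vV.
exists y, phi, tau; split=> // t ht.
have yp := strip_pos hs ht; have u0 := strip_U_neq0 hs ht.
have dphit := dphi t; rewrite (clampedE ht) in dphit.
have dyt := dy (phi t); rewrite -/(clamped y (phi t)) (clampedE ht) in dyt.
have dw := der_comp dyt dphit.
have lK : w_of n m (l_of n m (y (phi t))) = y (phi t) by exact: (l_ofK hyp).
apply: (@polar_motion_solution R p q n m Xn Xm hyp (fun t => l_of n m (y (phi t))) phi t).
  by rewrite lK.
have dl := derM (derN (derln yp dw)) (derC (deg_gap R n m)^-1 t).
apply: (derE _ dl); rewrite lK /speed /scalar_rhs.
by field; rewrite d0 u0 gt_eqF.
Qed.

Lemma flow_line_speed_sign (y : R -> R) x x' :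
  0 < speed x (W x) * speed x' (clamped y x').
Proof.
have h1 := strip_center hs x; have h2 := clamped_in_strip y x'.
case: speed_sign => h.
  by rewrite mulr_gt0 // h.
by rewrite nmulr_rgt0; apply: h.
Qed.

End FlowNearCycle.

(** * The return map *)

Section ReturnMap.
Variable R : realType.
Variables (p q n m : nat) (Xn Xm : polyvf R).
Hypothesis hyp : hypotheses p q n m Xn Xm.
Implicit Types (t x w s : R).

Notation A := (ratA p q n m Xn Xm).
Notation C := (ratC p q n m Xm).
Notation B := (ratB p q Xn Xm).
Notation B' := (ratB' p q Xn Xm).

Let X := Xn + Xm.
Let p0 : (0 < p)%N. Proof. by case: hyp => [[]]. Qed.
Let q0 : (0 < q)%N. Proof. by case: hyp => [[]]. Qed.
Let dg0 : 0 < deg_gap R n m. Proof. exact: deg_gap_gt0 hyp. Qed.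
Let pR0 : 0 < p%:R :> R. Proof. by rewrite ltr0n. Qed.

Variable W : R -> R.
Hypotheses (solW : scalar_solution A C B W) (perW : forall x, W (x + 2 * pi) = W x).

Let W0 x : 0 < W x. Proof. by case: solW. Qed.
Let cW : continuous W. Proof. exact: scalar_solution_continuous solW. Qed.

(** The section is the half-line of angle 0. [xi] is the abscissa of the point with coordinate [w],
    and [w_at] is its inverse, centered at the point [z1] of the cycle. *)
Let xi w : R := expR (p%:R * l_of n m w).
Let z1 : R := xi (W 0).
Let w_at s : R := w_of n m (ln (z1 + s) / p%:R).

Let z1_gt0 : 0 < z1. Proof. exact: expR_gt0. Qed.

Let xi_w_at s : 0 < z1 + s -> xi (w_at s) = z1 + s.
Proof.
move=> h; rewrite /xi /w_at (w_ofK hyp).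
by rewrite mulrC divfK ?lnK // gt_eqF.
Qed.

Let w_at0 : w_at 0 = W 0.
Proof.
rewrite /w_at addr0 /z1 /xi expRK mulrC mulKf ?gt_eqF //.
by rewrite (l_ofK hyp).
Qed.

Let dw_at : is_derive (0 : R) 1 w_at (- (deg_gap R n m) * W 0 / (p%:R * z1)).
Proof.
have z1s : 0 < z1 + 0 by rewrite addr0.
have dz := derD (derC z1 (0 : R)) (derX (0 : R)).
have dl := derM (@derln R (fun s => z1 + s) (0 : R) _ z1s dz) (derC (p%:R)^-1 (0 : R)).
have de := derexp (derM (derC (- (deg_gap R n m)) (0 : R)) dl).
apply: (derE _ de).
have -> : expR (- deg_gap R n m * (ln (z1 + 0) / p%:R)) = W 0 by rewrite -w_at0.
by rewrite addr0; field; rewrite !gt_eqF.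
Qed.

Let dxi : is_derive (W 0) 1 xi (- z1 * p%:R / (deg_gap R n m * W 0)).
Proof.
have dl := derM (derN (@derln R (fun w => w) (W 0) _ (W0 0) (derX (W 0))))
  (derC (deg_gap R n m)^-1 (W 0)).
apply: (derE _ (derexp (derM (derC p%:R (W 0)) dl))).
rewrite -/(xi (W 0)) -/z1; field.
by rewrite !gt_eqF.
Qed.

(** The return map is conjugate by [xi] to [Ret], one turn of the scalar equation, whose derivative
    [lam] at the cycle differs from 1. *)
Lemma cycle_multiplicity_one : cycle_multiplicity X (graph_curve p q n m W) 1.
Proof.
have [e [lo [hi [nu hs]]]] := strip_exists (ratB_der hyp) (ratB_periodic hyp) solW perW.
have [L L0 hfl] := flow_lines_exist hyp solW hs.
have e0 : 0 < e by case: hs => [[]].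
have pi2 : 0 < 2 * pi :> R by rewrite mulr_gt0 // pi_gt0.
have /choice[Y /choice[P /choice[T hT]]] : forall w, exists y phi tau,
  flow_line p q n m Xn Xm W e L 0 w y phi tau := hfl 0.
have ssgn := speed_sign hyp hs.
pose sg0 : R := speed p q n m Xn Xm 0 (W 0).
have sgc y x : 0 < sg0 * speed p q n m Xn Xm x (clamped W e y x).
  exact (flow_line_speed_sign hyp hs y 0 x).
(* One full turn, in the direction of the motion. *)
pose x1 : R := if 0 < sg0 then 2 * pi else - (2 * pi).
have sg0n : sg0 != 0 by exact: (speed_neq0 hyp hs (strip_center hs 0)).
have x1abs : `|x1| = 2 * pi.
  by rewrite /x1; case: ifP => _; rewrite ?normrN gtr0_norm.
have sgx1 : 0 < sg0 * x1.
  rewrite /x1; case: (ltP 0 sg0) => h; first by rewrite mulr_gt0.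
  by rewrite mulrN oppr_gt0 pmulr_llt0 // lt_neqAle sg0n.
have per1 (f : R -> R) : (forall x, f (x + 2 * pi) = f x) -> f x1 = f 0.
  move=> fT; rewrite -(@multiple_period R f x1 1 fT _ 0) ?add0r //.
  by rewrite mul1r.
have Wx1 : W x1 = W 0 by exact: per1.
have Bx1 : B x1 = B 0 by apply: per1; exact: ratB_periodic hyp.
have [Q dQ] : exists Q : R -> R, forall x, is_derive x 1 Q (- (A x - B' x) * inv_speed B W x).
  apply: antiderivative => x; apply: cvgM.
    by apply: cvgN; apply: cvgB; [exact: ratA_continuous hyp x|exact: ratB'_continuous hyp x].
  apply: cvgM; first exact: cW.
  apply: cvgV; first exact: (strip_U_neq0 hs (strip_center hs x)).
  apply: cvgD; first exact: cvg_cst.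
  by apply: cvgM; [exact: der_cont (ratB_der hyp x)|exact: cW].
pose lam : R := expR (Q x1 - Q 0).
(* The derivative of [Q] has a constant sign, so [Q] differs at the two ends of the turn. *)
have lam1 : lam != 1.
  have Qsg : (forall x, 0 < - (A x - B' x) * inv_speed B W x) \/
      (forall x, - (A x - B' x) * inv_speed B W x < 0).
    have [_ _ sW] := solW.
    case: (Phi_sign hyp) sW => hP [] hU; [right|left|left|right] => x;
    have hPx := hP x; have hUx := hU x; have Wx := W0 x.
    - by rewrite mulNr oppr_lt0 mulr_gt0 // divr_gt0.
    - by rewrite mulNr oppr_gt0 pmulr_rlt0 // pmulr_rlt0 // invr_lt0.
    - by rewrite mulNr oppr_gt0 pmulr_llt0 // divr_gt0.
    - by rewrite mulNr oppr_lt0 nmulr_rgt0 // pmulr_rlt0 // invr_lt0.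
  have Qn : Q x1 - Q 0 != 0.
    have [h|h] := leP 0 x1.
      have x1p : 0 < x1 by rewrite lt_neqAle h andbT eq_sym -normr_gt0 x1abs.
      have [c _ ->] := mvt x1p (fun x _ => dQ x).
      apply: mulf_neq0; first exact: (const_sign_neq0 Qsg).
      by rewrite subr0 gt_eqF.
    have [c _ E] := mvt h (fun x _ => dQ x).
    rewrite -oppr_eq0 opprB E; apply: mulf_neq0; first exact: (const_sign_neq0 Qsg).
    by rewrite sub0r oppr_eq0 lt_eqF.
  by apply: contra Qn => /eqP E; apply/eqP; apply: expR_inj; rewrite expR0.
have [M [rho [rho0 hexp]]] := return_expansion (ratA_continuous hyp) (ratB'_continuous hyp)
  (ratB_der hyp) (ratA_periodic hyp) (ratB'_periodic hyp) solW hs L0 Wx1 Bx1 dQ.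
pose Ret w : R := Y w x1.
have YW x : Y (W 0) x = W x.
  have [[_ _ h] _ _ _] := hT (W 0).
  by have := h x; rewrite subrr normr0 mul0r normr_le0 subr_eq0 => /eqP.
have dRet : is_derive (W 0) 1 Ret lam.
  apply: (@der_quadratic R Ret (W 0) lam M rho rho0) => w hw.
  have [[y0 dy hy] _ _ _] := hT w.
  by rewrite {2}/Ret YW; exact: (hexp w (Y w) hw dy hy y0).
pose h s : R := xi (Ret (w_at s)) - z1.
have RW : Ret (W 0) = W 0 by rewrite /Ret YW Wx1.
have dh : is_derive (0 : R) 1 h lam.
  have dxi' : is_derive (Ret (w_at 0)) 1 xi (- z1 * p%:R / (deg_gap R n m * W 0)).
    by rewrite w_at0 RW; exact: dxi.
  have dRet' : is_derive (w_at 0) 1 Ret lam by rewrite w_at0.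
  have d := derB (@der_comp R xi (fun s => Ret (w_at s)) 0 _ _ dxi' (der_comp dRet' dw_at)) (derC z1 (0 : R)).
  (* The slopes of [xi] and [w_at] are reciprocal, so the derivative stays [lam]. *)
  by apply: (derE _ d); field; rewrite !gt_eqF.
have h0 : h 0 = 0 by rewrite /h w_at0 RW /z1 subrr.
(* Starting values close to [W 0] keep the whole turn inside the strip. *)
pose S : R := expR (L * (2 * pi)); have S0 : 0 < S by exact: expR_gt0.
have turn_le w x : `|x| <= 2 * pi -> `|Y w x - W x| <= `|w - W 0| * S.
  move=> hx; have [[_ _ hy] _ _ _] := hT w.
  apply: le_trans (hy x) _; rewrite ler_wpM2l // ler_expR subr0.
  by rewrite ler_pM2l.
have near_w r : 0 < r -> \forall s \near (0 : R), `|w_at s - W 0| < r.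
  move=> r0; have := der_cont dw_at => /cvgrPdist_lt /(_ r r0).
  by rewrite w_at0; apply: filterS => s; rewrite distrC.
have near_pos : \forall s \near (0 : R), 0 < z1 + s.
  apply/nbhs_ballP; exists z1 => //= s; rewrite /ball /= sub0r normrN ltr_norml.
  by move=> /andP[h1 _]; lra.
have dtau w x : is_derive x 1 (T w) (speed p q n m Xn Xm x (clamped W e (Y w) x))^-1.
  by have [_ _ [_ d] _] := hT w; exact: d.
have dphi w t : is_derive t 1 (P w) (speed p q n m Xn Xm (P w t) (clamped W e (Y w) (P w t))).
  by have [_ _ [d _] _] := hT w; exact: d.
have T0 w : T w 0 = 0.
  by have [_ [pK _ ph0] _ _] := hT w; rewrite -ph0 pK.
have Tpos w x : 0 < sg0 * x -> 0 < T w x.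
  move=> hx; have xn : x != 0 by apply: contraTneq hx => ->; rewrite mulr0 ltxx.
  have inv_sg c : 0 < sg0 * (speed p q n m Xn Xm c (clamped W e (Y w) c))^-1.
    have := sgc (Y w) c; set v := speed _ _ _ _ _ _ _ _ => hv.
    have v0 : v != 0 by apply: contraTneq hv => ->; rewrite mulr0 ltxx.
    have -> : sg0 * v^-1 = (sg0 * v) * (v^-1) ^+ 2 by field.
    by rewrite mulr_gt0 // lt_neqAle sqr_ge0 eq_sym sqrf_eq0 invr_eq0 v0.
  have key c : 0 < (speed p q n m Xn Xm c (clamped W e (Y w) c))^-1 * x.
    have := mulr_gt0 (inv_sg c) hx; rewrite mulrACA pmulr_rgt0 //.
    by rewrite -expr2 lt_neqAle sqr_ge0 eq_sym sqrf_eq0 sg0n.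
  move: xn; rewrite neq_lt => /orP[xl|xg].
    have [c _ E] := mvt xl (fun x _ => dtau w x); rewrite T0 !sub0r in E.
    by have := key c; rewrite -oppr_lt0 -mulrN -E oppr_lt0.
  by have [c _ E] := mvt xg (fun x _ => dtau w x); rewrite T0 !subr0 in E; rewrite E.
(* Before the end of the turn the angle covered is strictly between 0 and a full turn, so there is
   no earlier return; this gives the least period. *)
have Pin w t : 0 < t < T w x1 -> 0 < sg0 * P w t /\ `|P w t| < 2 * pi.
  move=> /andP[t0 tT].
  have [_ [pK tK ph0] _ _] := hT w.
  have inc a b : a < b -> 0 < sg0 * P w b - sg0 * P w a.
    move=> ab; have [c _ E] := mvt ab (fun t _ => dphi w t).
    by rewrite -mulrBr E mulrA mulr_gt0 // subr_gt0.
  have i1 := inc 0 t t0; have i2 := inc t (T w x1) tT.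
  rewrite ph0 mulr0 subr0 in i1; rewrite tK in i2.
  split=> //; rewrite -x1abs.
  have a1 : `|sg0| * `|P w t| < `|sg0| * `|x1|.
    by rewrite -!normrM !gtr0_norm //; lra.
  by rewrite ltr_pM2l ?normr_gt0 // in a1.
pose tau s : R := T (w_at s) x1.
pose f s t : R * R := flow_point p q n m (Y (w_at s)) (P (w_at s)) t.
have cos1 : cos x1 = 1 by rewrite (per1 cos (@cos_period R)) cos0.
have sin1 : sin x1 = 0 by rewrite (per1 sin (@sin_period R)) sin0.
have start s : f s 0 = (xi (w_at s), 0).
  have [[y0 _ _] [_ _ ph0] _ _] := hT (w_at s).
  by rewrite /f /flow_point ph0 y0 /polar cos0 sin0 mulr1 mulr0.
have arrive s : f s (tau s) = (xi (Ret (w_at s)), 0).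
  have [_ [_ tK _] _ _] := hT (w_at s).
  by rewrite /f /flow_point /tau tK /polar cos1 sin1 mulr1 mulr0.
exists (z1, 0), (1, 0), h; split.
- by exists 0 => //; rewrite /polar cos0 sin0 mulr1 mulr0.
- rewrite /Defs.transversal /= mulr0 sub0r mulr1 => /eqP; rewrite oppr_eq0.
  have [_ E] := field_polar_ode hyp (l_of n m (W 0)) 0.
  have zE : polar p q (l_of n m (W 0)) 0 = (z1, 0).
    by rewrite /polar cos0 sin0 mulr1 mulr0.
  move: E; rewrite zE cos0 sin0 /= (l_ofK hyp) // => E /eqP Q0.
  have : speed p q n m Xn Xm 0 (W 0) = 0.
    by rewrite /speed -E Q0; ring.
  by move/eqP; rewrite (negbTE sg0n).
- exists (tau 0), tau, f; split.
  + split.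
    * exact: Tpos.
    * by rewrite start arrive w_at0 RW.
    * move=> t tT; have [P1 P2] := Pin _ _ tT.
      rewrite start /f /flow_point => E.
      have zE : (xi (w_at 0), 0) = polar p q (l_of n m (w_at 0)) 0.
        by rewrite /polar cos0 sin0 mulr1 mulr0.
      rewrite zE in E; have [_ [k]] := polar_inj p0 q0 E; rewrite subr0.
      have [-> H|k0 H] := posnP k.
        by move: H; rewrite mul0r => /normr0_eq0 H; move: P1; rewrite H mulr0 ltxx.
      have : 2 * pi <= k%:R * (2 * pi) :> R by rewrite ler_peMl ?(ltW pi2) // ler1n.
      by rewrite -H leNgt P2.
  + by [].
  (* Continuity of the return time: it integrates the reciprocal speed over a turn, and for small
     deviations this is uniformly close to its value on the cycle. *)
  + apply/cvgrPdist_le => eta eta0.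
    pose ext (d : R) x : R := (speed p q n m Xn Xm x (W x + d))^-1.
    have eta1 : 0 < eta / (2 * pi) by rewrite divr_gt0.
    have [r r0 hr] : exists2 r : R, 0 < r & forall x d, - (2 * pi) <= x <= 2 * pi -> `|d| < r ->
        `|(speed p q n m Xn Xm x (W x))^-1 - ext d x| < eta / (2 * pi).
      apply: uniform_near => x _.
      have cadd : {for (x, (0 : R)), continuous (fun u : R * R => W u.1 + u.2)}.
        apply: cvgD; last exact: cvg_snd.
        by apply: (@continuous_comp _ _ _ (fun u : R * R => u.1) W); [exact: cvg_fst|exact: cW].
      have Wadd : 0 < W (x, (0 : R)).1 + (x, (0 : R)).2 by rewrite /= addr0.
      have cx1 : {for (x, (0 : R)), continuous (fun u : R * R => u.1)} by exact: cvg_fst.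
      have cs := speed_continuous hyp cx1 cadd Wadd.
      have cx2 : {for (x, (0 : R)), continuous (fun u : R * R => W u.1)}.
        by apply: (@continuous_comp _ _ _ (fun u : R * R => u.1) W); [exact: cvg_fst|exact: cW].
      have cs0 := speed_continuous hyp cx1 cx2 (W0 x).
      have sn : speed p q n m Xn Xm x (W x) != 0 by exact: (speed_neq0 hyp hs (strip_center hs x)).
      have c1 : {for (x, (0 : R)), continuous
          (fun u : R * R => (speed p q n m Xn Xm u.1 (W u.1))^-1 - ext u.2 u.1)}.
        apply: cvgB; first by apply: cvgV; [exact: sn|exact: cs0].
        by apply: cvgV; [rewrite /= addr0|exact: cs].
      have := c1 => /cvgrPdist_lt /(_ _ eta1); apply: filterS => u /=.
      by rewrite /ext addr0 subrr sub0r normrN.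
    have small := near_w (Num.min e r / S).
    have m0 : 0 < Num.min e r / S by rewrite divr_gt0 // lt_min e0 r0.
    move: (small m0); apply: filterS => s hsm.
    have dsmall x : `|x| <= 2 * pi -> `|Y (w_at s) x - W x| < Num.min e r.
      move=> hx; apply: le_lt_trans (turn_le _ _ hx) _.
      by rewrite -ltr_pdivlMr.
    have dT x : is_derive x 1 (fun x => T (w_at 0) x - T (w_at s) x)
        ((speed p q n m Xn Xm x (W x))^-1 - ext (clamp e (Y (w_at s) x - W x)) x).
      have := derB (dtau (w_at 0) x) (dtau (w_at s) x).
      rewrite w_at0 /ext /clamped YW subrr.
      by rewrite (@clamp_id _ e 0) ?addr0 // normr0 ltW.
    have := @der_lipschitz R _ _ (eta / (2 * pi)) 0 x1 (fun x _ => dT x) _.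
    rewrite !T0 subrr subr0 subr0 x1abs divfK ?gt_eqF //; apply=> x xI.
    have xle : `|x| <= 2 * pi.
      rewrite -x1abs; move: xI; case: (leP 0 x1) => hx /andP[h1 h2].
        by rewrite !ger0_norm.
      by rewrite !ler0_norm ?(ltW hx) // lerN2.
    have := dsmall x xle; rewrite lt_min => /andP[de dr].
    apply/ltW/hr; first by rewrite -ler_norml.
    by rewrite clamp_id // ltW.
  + have m0 : 0 < e / S by rewrite divr_gt0.
    move: (near_w _ m0) near_pos; apply: filterS2 => s hsm hpos.
    split.
    * move=> t /= /andP[t0 tT].
      have [_ _ _ sol] := hT (w_at s).
      apply: sol.
      have Pt : `|P (w_at s) t| <= 2 * pi.
        have [_ [pK tK ph0] _ _] := hT (w_at s).
        move: t0; rewrite le_eqVlt => /predU1P[<-|t0]; first by rewrite ph0 normr0 ltW.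
        move: tT; rewrite le_eqVlt => /predU1P[->|tT]; first by rewrite /tau tK x1abs.
        by have [|_ /ltW] := Pin (w_at s) t; first by rewrite t0.
      apply: le_trans (turn_le _ _ Pt) _.
      by rewrite -ler_pdivlMr // ltW.
    * by rewrite start xi_w_at // /section_point /= mulr1 mulr0 addr0.
    * by rewrite arrive /section_point /= mulr1 mulr0 addr0 /h subrKC.
- have dd := derB dh (derX (0 : R)).
  have [D1 D2] := der_val dd.
  split.
    by move=> [|//] _; rewrite derive1n0 h0 subrr; split.
  rewrite derive1n1 => E; have : lam - 1 = 0 by rewrite -D2 E.
  by move/eqP; rewrite subr_eq0 (negbTE lam1).
Qed.

End ReturnMap.

(** * Asymptotic stability *)

Section Attraction.
Variable R : realType.
Variables (p q n m : nat) (Xn Xm : polyvf R).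
Hypothesis hyp : hypotheses p q n m Xn Xm.
Implicit Types (t x w l : R).

Notation A := (ratA p q n m Xn Xm).
Notation C := (ratC p q n m Xm).
Notation B := (ratB p q Xn Xm).
Notation B' := (ratB' p q Xn Xm).

Let X := Xn + Xm.
Let p0 : (0 < p)%N. Proof. by case: hyp => [[]]. Qed.
Let q0 : (0 < q)%N. Proof. by case: hyp => [[]]. Qed.
Let dg0 : 0 < deg_gap R n m. Proof. exact: deg_gap_gt0 hyp. Qed.

Variable W : R -> R.
Hypotheses (solW : scalar_solution A C B W) (perW : forall x, W (x + 2 * pi) = W x).

Let W0 x : 0 < W x. Proof. by case: solW. Qed.
Let cW : continuous W. Proof. exact: scalar_solution_continuous solW. Qed.

Definition tube (r : R) : set (R * R) :=
  [set polar p q u.1 u.2 | u in [set u : R * R | `|w_of n m u.1 - W u.2| < r]].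

Lemma open_tube r : open (tube r).
Proof.
apply: (open_polar p0 q0); apply: open_lt_fun; last by move=> u; exact: cvg_cst.
move=> u; apply: cvg_norm; apply: cvgB.
  apply: (@continuous_comp _ _ _ (fun u : R * R => - deg_gap R n m * u.1) expR).
    by apply: cvgM; [exact: cvg_cst|exact: cvg_fst].
  exact: continuous_expR.
by apply: (@continuous_comp _ _ _ (fun u : R * R => u.2) W); [exact: cvg_snd|exact: cW].
Qed.

Lemma graph_sub_tube r : 0 < r -> graph_curve p q n m W `<=` tube r.
Proof.
move=> r0 _ [x _ <-]; exists (l_of n m (W x), x) => //=.
by rewrite (l_ofK hyp) // subrr normr0.
Qed.

Lemma tube_in_nbhs (V : set (R * R)) : open V -> graph_curve p q n m W `<=` V ->
  exists2 r : R, 0 < r & forall x w, `|w - W x| < r -> V (polar p q (l_of n m w) x).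
Proof.
move=> oV GV; pose P x d := V (polar p q (l_of n m (W x + d)) x).
have [r r0 hr] : exists2 r : R, 0 < r & forall x d, 0 <= x <= 2 * pi -> `|d| < r -> P x d.
  apply: uniform_near => x _.
  have cadd : {for (x, (0 : R)), continuous (fun u : R * R => W u.1 + u.2)}.
    apply: cvgD; last exact: cvg_snd.
    by apply: (@continuous_comp _ _ _ (fun u : R * R => u.1) W); [exact: cvg_fst|exact: cW].
  have Wadd : 0 < W (x, (0 : R)).1 + (x, (0 : R)).2 by rewrite /= addr0.
  have cl := l_of_continuous (n := n) (m := m) cadd Wadd.
  have cx1 : {for (x, (0 : R)), continuous (fun u : R * R => u.1)} by exact: cvg_fst.
  have cp := polar_continuous (p := p) (q := q) cl cx1.
  apply: cp; rewrite /= addr0; apply: open_nbhs_nbhs; split=> //.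
  by apply: GV; exists x.
exists r => // x w hw.
(* The property is encoded as a [2 pi]-periodic function of the angle, which reduces it to one
   period. *)
pose ind u : R := if `[< forall d, `|d| < r -> P u d >] then 1 else 0.
have [|s hsI] := @periodic_representative R ind x.
  by move=> u; rewrite /ind /P perW; under eq_forall do rewrite polar_periodic.
have -> : ind s = 1.
  by rewrite /ind asboolT // => d; exact: hr.
rewrite /ind; case: asboolP => [h _|_ /eqP]; last by rewrite eq_sym oner_eq0.
by have := h _ hw; rewrite /P subrKC.
Qed.

Lemma first_nonpos (f : R -> R) (a b : R) : continuous f -> a <= b -> 0 < f a -> f b <= 0 ->
  exists c, [/\ a < c <= b, f c = 0 & forall t, a <= t < c -> 0 < f t].
Proof.
move=> cf ab fa fb.
have cfN : continuous (fun t => f (- t)).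
  by move=> t; apply: continuous_comp; [exact: continuousN|exact: cf].
have [|||c [/andP[c1 c2] fc hc]] := @last_nonpos R (fun t => f (- t)) (- b) (- a) cfN.
- by rewrite lerN2.
- by rewrite opprK.
- by rewrite opprK.
exists (- c); split=> //; first by apply/andP; split; lra.
move=> t /andP[t1 t2]; have := hc (- t); rewrite opprK; apply.
by apply/andP; split; lra.
Qed.

Variables (e lo hi nu : R).
Hypothesis hs : strip B W e lo hi nu.

Let e0 : 0 < e. Proof. by case: hs => [[]]. Qed.
Let lo0 : 0 < lo. Proof. by case: hs => [[]]. Qed.
Let hi0 : 0 < hi. Proof. by case: hs => [[]]. Qed.
Let nu0 : 0 < nu. Proof. by case: hs => [[]]. Qed.

(** Keeps the motion from slowing down, so that the decay is exponential in time. *)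
Lemma speed_bounded_below : exists2 s : R, 0 < s &
  forall x w, `|w - W x| <= e -> s <= `|speed p q n m Xn Xm x w|.
Proof.
have tb := trig_poly_b p q Xm.
have cn : continuous (fun x => `|b_fun p q Xm x|).
  by move=> x; apply: cvg_norm; exact: (trig_poly_continuous tb).
have [||b b0 hb] := @periodic_pos_bounded R (fun x => `|b_fun p q Xm x|) cn.
- by move=> x; rewrite (trig_poly_periodic tb).
- by move=> x; rewrite normr_gt0 (bm_neq0 hyp).
have pq0 : 0 < p%:R + q%:R :> R by rewrite -natrD ltr0n addn_gt0 p0.
exists (b * expR (l_of n m hi) ^+ m.-1 / (p%:R + q%:R) * nu).
  by rewrite mulr_gt0 // divr_gt0 // mulr_gt0 // exprn_gt0 // expR_gt0.
move=> x w h.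
have /andP[w1 w2] := strip_bounds hs h; have w0 := strip_pos hs h.
have sl0 := slope_form_gt0 p0 q0 x.
have sl : slope_form p q x <= p%:R + q%:R.
  rewrite /slope_form; have := cos2Dsin2 x; have := sqr_ge0 (cos x); have := sqr_ge0 (sin x).
  have := ler0n R p; have := ler0n R q; nra.
have u := strip_U hs h.
have i1 : expR (l_of n m hi) ^+ m.-1 <= `|expR (l_of n m w) ^+ m.-1|.
  rewrite ger0_norm ?exprn_ge0 ?expR_ge0 // lerXn2r ?nnegrE ?expR_ge0 // ler_expR /l_of.
  by rewrite ler_pM2r ?invr_gt0 // lerN2 ler_ln ?posrE.
have i2 : (p%:R + q%:R)^-1 <= `|(slope_form p q x)^-1|.
  by rewrite normfV gtr0_norm // lef_pV2 ?posrE.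
have j1 := ler_pM (ltW b0) (exprn_ge0 m.-1 (expR_ge0 (l_of n m hi))) (hb x) i1.
have j0 : 0 <= b * expR (l_of n m hi) ^+ m.-1.
  by rewrite mulr_ge0 ?(ltW b0) // exprn_ge0 // expR_ge0.
have k0 : 0 <= (p%:R + q%:R)^-1 :> R by rewrite invr_ge0 ltW.
have j2 := ler_pM j0 k0 j1 i2.
have j3 := ler_pM (mulr_ge0 j0 k0) (ltW nu0) j2 u.
by rewrite /speed /ang_speed !normrM; exact: j3.
Qed.

Hypothesis attr : forall x, 0 < b_fun p q Xm x * (A x - B' x).

(** A bootstrap: the decay estimate holds while the trajectory is in the band, and the estimate
    itself excludes a first exit. *)
Lemma attraction : exists K c eta : R, [/\ 0 < K, 0 < c, 0 < eta &
  forall x0 w0 : R, `|w0 - W x0| < eta -> exists2 f : R -> R * R,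
    forward_solution X (polar p q (l_of n m w0) x0) f &
    forall t, 0 <= t -> exists x w : R, f t = polar p q (l_of n m w) x /\
      `|w - W x| <= K * `|w0 - W x0| * expR (- c * t)].
Proof.
have [L L0 hfl] := flow_lines_exist hyp solW hs.
have [K K0 hK] := gap_le (ratB_der hyp) (ratB_periodic hyp) solW hs.
have hN := gap_ge solW hs.
have [s0 s00 hs0] := speed_bounded_below.
have cPhi : continuous (fun x => `|A x - B' x|).
  by move=> x; apply: cvg_norm; apply: cvgB; [exact: (ratA_continuous hyp)|exact: (ratB'_continuous hyp)].
have [||F F0 hF] := @periodic_pos_bounded R _ cPhi.
- by move=> x; rewrite (ratA_periodic hyp) (ratB'_periodic hyp).
- by move=> x; rewrite normr_gt0 (const_sign_neq0 (Phi_sign hyp)).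
(* [F] and [s0] bound [|Phi|] and the speed from below, and [K] converts the deviation into the
   gap. *)
pose c : R := F * s0 / K.
have c0 : 0 < c by rewrite divr_gt0 // mulr_gt0.
(* Ratio of the two constants that compare the gap with the deviation. *)
pose K' : R := hi / nu * K.
have K'0 : 0 < K' by rewrite mulr_gt0 // divr_gt0.
have eta0 : 0 < Num.min e (e / K') by rewrite lt_min e0 divr_gt0.
exists K', c, (Num.min e (e / K')); split=> // x0 w0; rewrite lt_min => /andP[we wK].
have [y [phi [tau [[y0 dy hy] [pK tK ph0] [dphi dtau] sol]]]] := hfl x0 w0.
pose del t : R := y (phi t) - W (phi t).
pose g t : R := gap B W (phi t) (y (phi t)).
have cdel : continuous del.
  move=> t; apply: cvgB.
    apply: (@continuous_comp _ _ _ phi y); first exact: der_cont (dphi t).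
    exact: der_cont (dy (phi t)).
  by apply: (@continuous_comp _ _ _ phi W); [exact: der_cont (dphi t)|exact: cW].
have del0 : del 0 = w0 - W x0 by rewrite /del ph0 y0.
have dg t : `|del t| <= e -> is_derive t 1 g
    (- (A (phi t) - B' (phi t)) * del t * speed p q n m Xn Xm (phi t) (y (phi t))).
  move=> ht; have d := der_comp (der_gap (ratB_der hyp) solW hs ht (dy (phi t))) (dphi t).
  by rewrite (clampedE ht) in d; exact: d.
have diss t : `|del t| <= e ->
    c * g t ^+ 2 <= (A (phi t) - B' (phi t)) * speed p q n m Xn Xm (phi t) (y (phi t)) * (del t * g t).
  move=> ht; set Ph := A _ - B' _; set v := speed _ _ _ _ _ _ _ _.
  have [z [_ ze gE]] := gap_mvt solW hs ht.
  have z0 := strip_pos hs ze.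
  (* [1 + B y] and [1 + B z] share the sign of the band, so their product is nonnegative and [attr]
     decides. *)
  have sgn : 0 <= Ph * v * (del t * g t).
    have [k k0 kE] := ang_speed_pos_bm hyp (l_of n m (y (phi t))) (phi t).
    rewrite /v /speed kE /g gE -/(del t).
    have -> : Ph * (b_fun p q Xm (phi t) * k * (1 + B (phi t) * y (phi t))) *
      (del t * ((1 + B (phi t) * z) / z * del t)) =
      (b_fun p q Xm (phi t) * Ph) * k * ((1 + B (phi t) * y (phi t)) * (1 + B (phi t) * z)) *
      (z^-1 * del t ^+ 2) by ring.
    apply: mulr_ge0; last by rewrite mulr_ge0 ?sqr_ge0 // invr_ge0 ltW.
    apply: mulr_ge0; first by rewrite mulr_ge0 // ltW // attr.
    case: hs => _ _ [] hU.
      by rewrite mulr_ge0 // (le_trans (ltW nu0)) // hU.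
    by rewrite mulr_le0 // (le_trans (hU _ _ _)) // oppr_le0 ltW.
  have q1 : F * s0 <= `|Ph| * `|v|.
    by apply: ler_pM; [exact: ltW|exact: ltW|exact: hF|exact: hs0].
  clearbody Ph v; rewrite -(ger0_norm sgn) !normrM.
  have h1 := hK _ _ ht; rewrite -/(g t) -/(del t) in h1.
  have h2 : `|g t| / K <= `|del t| by rewrite ler_pdivrMr // mulrC.
  have -> : c * g t ^+ 2 = F * s0 * (`|g t| / K * `|g t|).
    by rewrite /c -[g t ^+ 2]real_normK ?num_real // expr2; field; rewrite gt_eqF.
  have q2 : `|g t| / K * `|g t| <= `|del t| * `|g t| by exact: ler_wpM2r.
  have q3 : 0 <= F * s0 by rewrite mulr_ge0 // ltW.
  have q4 : 0 <= `|g t| / K * `|g t| by rewrite mulr_ge0 // divr_ge0 // ltW.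
  exact: ler_pM q3 q4 q1 q2.
have decay t1 : 0 <= t1 -> (forall t, 0 <= t <= t1 -> `|del t| <= e) ->
    `|del t1| <= K' * `|w0 - W x0| * expR (- c * t1).
  move=> t10 hin.
  have dexp t : is_derive t 1 (fun t => expR (2 * c * t)) (expR (2 * c * t) * (2 * c)).
    by apply: derexp; apply: (derE _ (derM (derC (2 * c) t) (derX t))); ring.
  have dm t : 0 <= t <= t1 -> is_derive t 1 (fun t => - (g t ^+ 2 * expR (2 * c * t)))
      (2 * expR (2 * c * t) * ((A (phi t) - B' (phi t)) *
        speed p q n m Xn Xm (phi t) (y (phi t)) * (del t * g t) - c * g t ^+ 2)).
    move=> ht; apply: (derE _ (derN (derM (derXn 2 (dg t (hin t ht))) (dexp t)))).
    by rewrite /= expr1; ring.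
  have := der_ge0_le t10 dm; rewrite lerN2 mulr0 expR0 mulr1 => H.
  have {H} : g t1 ^+ 2 * expR (2 * c * t1) <= g 0 ^+ 2.
    apply: H => t /andP[ta tb]; rewrite mulr_ge0 ?mulr_ge0 ?expR_ge0 // subr_ge0.
    by apply: diss; apply: hin; rewrite !ltW.
  have e1 : expR (2 * c * t1) = expR (c * t1) ^+ 2.
    by rewrite expr2 -expRD; congr expR; ring.
  rewrite e1 => H.
  have E0 : 0 < expR (c * t1) by exact: expR_gt0.
  have {H} H : `|g t1| * expR (c * t1) <= `|g 0|.
    rewrite -ler_sqr ?nnegrE ?mulr_ge0 ?(ltW E0) //.
    by rewrite exprMn !real_normK ?num_real.
  have t11 : `|del t1| <= e by apply: hin; rewrite t10 lexx.
  have t00 : `|del 0| <= e by apply: hin; rewrite t10 lexx.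
  have n1 := hN _ _ t11; rewrite -/(g t1) -/(del t1) in n1.
  have n0 := hK _ _ t00; rewrite -/(g 0) -/(del 0) del0 in n0.
  rewrite mulNr expRN ler_pdivlMr //.
  have -> : K' * `|w0 - W x0| = hi / nu * (K * `|w0 - W x0|) by rewrite /K'; ring.
  have hn : 0 < hi / nu by rewrite divr_gt0.
  have n2 : `|del t1| <= hi / nu * `|g t1|.
    rewrite -ler_pdivrMl //; apply: le_trans n1.
    by rewrite invf_div.
  apply: (@le_trans _ _ (hi / nu * `|g t1| * expR (c * t1))); first by rewrite ler_wpM2r // ltW.
  by rewrite -mulrA ler_pM2l //; exact: le_trans H n0.
have stay t : 0 <= t -> `|del t| < e.
  move=> t0; rewrite ltNge; apply/negP => ht.
  have cf : continuous (fun t => e - `|del t|).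
    by move=> u; apply: cvgB; [exact: cvg_cst|apply: cvg_norm; exact: cdel].
  have [||s [/andP[s1 s2] fs hin]] := first_nonpos cf t0.
  - by rewrite subr_gt0 del0.
  - by rewrite subr_le0.
  have dse : `|del s| = e by move: fs; lra.
  have := decay s (ltW s1) _; rewrite dse => H.
  have {H} : e <= K' * `|w0 - W x0| * expR (- c * s).
    apply: H => u /andP[u0]; rewrite le_eqVlt => /predU1P[->|us]; first by rewrite dse.
    by have := hin u; rewrite u0 us => /(_ erefl); rewrite subr_gt0 => /ltW.
  apply/negP; rewrite -ltNge.
  have es : expR (- c * s) <= 1 by rewrite expR_le1 mulNr oppr_le0 mulr_ge0 // ltW.
  apply: (@le_lt_trans _ _ (K' * `|w0 - W x0|)).
    by rewrite ler_piMr // mulr_ge0 // ltW.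
  by rewrite mulrC -ltr_pdivlMr.
exists (flow_point p q n m y phi).
  split; last by rewrite /flow_point ph0 y0.
  by move=> t /= t0; apply: sol; exact: ltW (stay t t0).
move=> t t0; exists (phi t), (y (phi t)); split=> //.
by apply: decay => // u /andP[u0 _]; exact: ltW (stay u u0).
Qed.

End Attraction.

Section Stability.
Variable R : realType.
Variables (p q n m : nat) (Xn Xm : polyvf R).
Hypothesis hyp : hypotheses p q n m Xn Xm.

Lemma graph_stable (W : R -> R) :
  scalar_solution (ratA p q n m Xn Xm) (ratC p q n m Xm) (ratB p q Xn Xm) W ->
  (forall x, W (x + 2 * pi) = W x) ->
  (forall t : R, 0 < b_fun p q Xm t * Phi p q n m Xn Xm t) ->
  stable_cycle (Xn + Xm) (graph_curve p q n m W).
Proof.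
move=> solW perW attr.
have [e [lo [hi [nu hs]]]] := strip_exists (ratB_der hyp) (ratB_periodic hyp) solW perW.
have [K [c [eta [K0 c0 eta0 hatt]]]] := attraction hyp solW hs attr.
split=> [V oV GV|].
  have [r r0 hr] := tube_in_nbhs solW perW oV GV.
  have rK : 0 < Num.min eta (r / K) by rewrite lt_min eta0 divr_gt0.
  exists (tube p q n m W (Num.min eta (r / K))); split.
  - exact: (open_tube hyp solW).
  - exact: (graph_sub_tube hyp solW).
  move=> _ [[l x] /= h <-]; move: h; rewrite lt_min => /andP[h1 h2].
  have [f fsol hf] := hatt x _ h1; rewrite (w_ofK hyp) in fsol.
  exists f => // t t0; have [x' [w' [-> hw]]] := hf t t0.
  apply: hr; apply: le_lt_trans hw _.
  have es : expR (- c * t) <= 1 by rewrite expR_le1 mulNr oppr_le0 mulr_ge0 // ltW.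
  apply: (@le_lt_trans _ _ (K * `|w_of n m l - W x|)).
    by rewrite ler_piMr // mulr_ge0 // ltW.
  by rewrite mulrC -ltr_pdivlMr.
exists (tube p q n m W eta); split.
- exact: (open_tube hyp solW).
- exact: (graph_sub_tube hyp solW).
move=> _ [[l x] /= h <-].
have [f fsol hf] := hatt x _ h; rewrite (w_ofK hyp) in fsol.
exists f => // V oV GV.
have [r r0 hr] := tube_in_nbhs solW perW oV GV.
have Kr : 0 < K * eta / r by rewrite divr_gt0 // mulr_gt0.
(* By [expR z >= 1 + z], after this time [expR (c t)] exceeds [K eta / r]. *)
exists (K * eta / r / c); split; first exact: num_real.
move=> t tlarge; have t0 : 0 <= t by rewrite ltW // (lt_trans _ tlarge) // divr_gt0.
have [x' [w' [-> hw]]] := hf t t0.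
apply: hr; apply: le_lt_trans hw _.
have hE : K * eta / r < expR (c * t).
  apply: lt_le_trans (expR_ge1Dx _).
  by move: tlarge; rewrite ltr_pdivrMr // mulrC => h1; lra.
rewrite mulNr expRN ltr_pdivrMr ?expR_gt0 //.
apply: (@lt_trans _ _ (K * eta)); first by rewrite ltr_pM2l.
by rewrite [ltRHS]mulrC -ltr_pdivrMr.
Qed.

End Stability.

(** * The theorem *)

Section TimeReversal.
Variable R : realType.
Variables (p q n m : nat) (Xn Xm : polyvf R).

Lemma a_funN (X : polyvf R) (t : R) : a_fun n m (- X) t = - a_fun n m X t.
Proof. by rewrite /a_fun !vfPN !vfQN; ring. Qed.

Lemma b_funN (X : polyvf R) (t : R) : b_fun p q (- X) t = - b_fun p q X t.
Proof. by rewrite /b_fun !vfPN !vfQN; ring. Qed.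

(** Numerator and denominator change sign together, so the reversed field has the same scalar
    equation and the same cycle, while [b_m] changes sign. *)
Lemma ratAN : ratA p q n m (- Xn) (- Xm) = ratA p q n m Xn Xm.
Proof. by apply: funext => t; rewrite /ratA a_funN b_funN invrN mulrNN. Qed.

Lemma ratCN : ratC p q n m (- Xm) = ratC p q n m Xm.
Proof. by apply: funext => t; rewrite /ratC a_funN b_funN invrN mulrNN. Qed.

Lemma ratBN : ratB p q (- Xn) (- Xm) = ratB p q Xn Xm.
Proof. by apply: funext => t; rewrite /ratB !b_funN invrN mulrNN. Qed.

Lemma PhiN (t : R) : Phi p q n m (- Xn) (- Xm) t = Phi p q n m Xn Xm t.
Proof. by rewrite !PhiE /ratB' ratAN ratBN. Qed.

Lemma quasi_homogeneousN s (X : polyvf R) :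
  quasi_homogeneous p q s X -> quasi_homogeneous p q s (- X).
Proof. by move=> h l x y; have [hP hQ] := h l x y; rewrite !vfPN !vfQN hP hQ !mulrN. Qed.

Lemma hypothesesN : hypotheses p q n m Xn Xm -> hypotheses p q n m (- Xn) (- Xm).
Proof.
move=> [h0 [hn hm hb hP]]; split=> //; split.
- exact: quasi_homogeneousN.
- exact: quasi_homogeneousN.
- by move=> t; rewrite b_funN => /eqP; rewrite oppr_eq0 => /eqP; exact: hb.
- by move=> t ht; rewrite PhiN; exact: hP.
Qed.

End TimeReversal.

Section LimitCycles.
Variable R : realType.
Variables (p q n m : nat) (Xn Xm : polyvf R).
Hypothesis hyp : hypotheses p q n m Xn Xm.

Lemma at_most_one_limit_cycle : at_most_limit_cycles_with_mult (Xn + Xm) 1.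
Proof.
move=> k G injG lcG; exists (fun=> 1%N); split.
  move=> i; have [pG _] := lcG i.
  have [W [solW perW ->]] := periodic_orbit_graph hyp pG.
  exact: cycle_multiplicity_one hyp _ solW perW.
rewrite sum1_card card_ord; case: k G injG lcG => [//|[//|k]] G injG lcG.
have := injG ord0 (lift ord0 ord0).
by rewrite (periodic_orbit_unique hyp (lcG ord0).1 (lcG (lift ord0 ord0)).1) => /(_ erefl).
Qed.

Lemma periodic_orbit_surrounds G : periodic_orbit (Xn + Xm) G -> surrounds G (0, 0).
Proof.
move=> /(periodic_orbit_graph hyp)[W [solW perW ->]].
have [[p0 q0 _] _] := hyp; have [W0 _ _] := solW.
apply: (polar_graph_surrounds p0 q0 (ls := fun th => l_of n m (W th))).
  by move=> x; apply: l_of_continuous => //; exact: scalar_solution_continuous solW x.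
by move=> x; rewrite perW.
Qed.

Lemma periodic_orbit_stable G : periodic_orbit (Xn + Xm) G ->
  (forall t : R, 0 < b_fun p q Xm t * Phi p q n m Xn Xm t) -> stable_cycle (Xn + Xm) G.
Proof.
by move=> /(periodic_orbit_graph hyp)[W [solW perW ->]]; exact: graph_stable.
Qed.

Lemma periodic_orbit_unstable G : periodic_orbit (Xn + Xm) G ->
  (forall t : R, b_fun p q Xm t * Phi p q n m Xn Xm t < 0) -> unstable_cycle (Xn + Xm) G.
Proof.
move=> /(periodic_orbit_graph hyp)[W [solW perW ->]] h.
rewrite /unstable_cycle opprD; apply: graph_stable; first exact: hypothesesN.
- by rewrite ratAN ratCN ratBN.
- exact: perW.
- by move=> t; rewrite b_funN PhiN mulNr oppr_gt0.
Qed.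

End LimitCycles.

(** * A system with exactly one limit cycle *)

Section Example.
Variable R : realType.

Let x : {poly {poly R}} := 'X.
Let y : {poly {poly R}} := ('X)%:P.

Definition example_linear : polyvf R := (x, y).
(** Added to [example_linear] it gives, in ordinary polar coordinates, [r' = r - r^3] and
    [th' = r^2], with the unit circle as cycle. *)
Definition example_cubic : polyvf R :=
  ((x * x + y * y) * (- y - x), (x * x + y * y) * (x - y)).

Let linE (u v : R) : vfP example_linear u v = u /\ vfQ example_linear u v = v.
Proof. by rewrite /vfP /vfQ /= /x /y !eval2E hornerX. Qed.

Let cubE (u v : R) : vfP example_cubic u v = (u * u + v * v) * (- v - u) /\
  vfQ example_cubic u v = (u * u + v * v) * (u - v).
Proof. by rewrite /vfP /vfQ /= /x /y !eval2E hornerX. Qed.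

Let circle (t : R) : cos t * cos t + sin t * sin t = 1.
Proof. by rewrite -!expr2 cos2Dsin2. Qed.

Lemma example_hypotheses : hypotheses 1 1 1 3 example_linear example_cubic.
Proof.
have b3 (t : R) : b_fun 1 1 example_cubic t = 1.
  rewrite /b_fun !(cubE _ _).1 !(cubE _ _).2 circle -[RHS](circle t); ring.
have b1 (t : R) : b_fun 1 1 example_linear t = 0.
  by rewrite /b_fun !(linE _ _).1 !(linE _ _).2; ring.
split=> //; split.
- by move=> l u v; rewrite !(linE _ _).1 !(linE _ _).2 addnK expr1.
- move=> l u v; rewrite !(cubE _ _).1 !(cubE _ _).2 expr1.
  by rewrite (_ : (1 + 3 - 1 = 3)%N) //; split; ring.
- by move=> t; rewrite b3; apply/eqP; exact: oner_neq0.
- move=> t _; rewrite PhiE.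
  have -> : ratB' 1 1 example_linear example_cubic t = 0.
    rewrite /ratB' (_ : ratB _ _ _ _ = fun=> 0); last first.
      by apply: funext => u; rewrite /ratB b1 mul0r.
    by have [_ ->] := der_val (derC 0 t).
  rewrite /ratA b3 /a_fun (linE _ _).1 (linE _ _).2 circle subr0 divr1 mulr1.
  by apply/eqP; rewrite gt_eqF // subr_gt0 ltr_nat.
Qed.

Lemma example_cycle : limit_cycle (example_linear + example_cubic)
  (range (fun t : R => (cos t, sin t))).
Proof.
have pG : periodic_orbit (example_linear + example_cubic) (range (fun t : R => (cos t, sin t))).
  exists (fun t => (cos t, sin t)); split=> //.
  - move=> t _ /=; rewrite vfPD vfQD !(linE _ _).1 !(linE _ _).2 !(cubE _ _).1 !(cubE _ _).2 circle.
    split; first by apply: (derE _ (dercos (derX t))); ring.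
    by apply: (derE _ (dersin (derX t))); ring.
  - exists (2 * pi); first by rewrite mulr_gt0 // pi_gt0.
    by move=> t; rewrite cos_period sin_period.
  - exists pi; rewrite cospi cos0 => -[h _].
    by move: h; lra.
(* Isolation holds in the whole plane, since every periodic orbit is this one. *)
split=> //; exists setT; split=> //; first exact: openT.
by move=> G' pG' _; exact: periodic_orbit_unique example_hypotheses _ _ pG' pG.
Qed.

End Example.

Theorem theorem1p1 (R : realType) :
  (forall (p q n m : nat) (Xn Xm : polyvf R),
     hypotheses p q n m Xn Xm ->
     at_most_limit_cycles_with_mult (Xn + Xm) 1 /\
     (forall G : set (R * R), limit_cycle (Xn + Xm) G ->
        [/\ surrounds G (0, 0),
            ((forall t : R, 0 < b_fun p q Xm t * Phi p q n m Xn Xm t) ->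
               stable_cycle (Xn + Xm) G) &
            ((forall t : R, b_fun p q Xm t * Phi p q n m Xn Xm t < 0) ->
               unstable_cycle (Xn + Xm) G)])) /\
  (exists (p q n m : nat) (Xn Xm : polyvf R),
     hypotheses p q n m Xn Xm /\
     exists! G : set (R * R), limit_cycle (Xn + Xm) G).
Proof.
split=> [p q n m Xn Xm hyp|].
  split=> [|G [pG _]]; first exact: at_most_one_limit_cycle hyp.
  split.
  - exact: periodic_orbit_surrounds hyp _ pG.
  - exact: periodic_orbit_stable hyp _ pG.
  - exact: periodic_orbit_unstable hyp _ pG.
exists 1%N, 1%N, 1%N, 3%N, (example_linear R), (example_cubic R).
split; first exact: example_hypotheses.
exists (range (fun t : R => (cos t, sin t))); split; first exact: example_cycle.
move=> G [pG _]; have [pC _] := example_cycle R.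
exact: periodic_orbit_unique (example_hypotheses R) _ _ pC pG.
Qed.
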